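(* Let $a<b$ be real numbers and let $(B_1(V[a,b]),\sigma,d)$ be the shift system on the space of band-limited functions. For every $\theta\in(0,1)$, $$\mathrm{mdim}_{\mathrm M}(B_1(V[a,b]),\sigma,d)=\mathrm{mdim}_{\mathrm A}^\theta(B_1(V[a,b]),\sigma,d)=\mathrm{mdim}_{\mathrm A}(B_1(V[a,b]),\sigma,d)=2(b-a)$$ (in particular the metric mean dimension exists).
   Context: Band-limited functions. For a bounded continuous function $\varphi:\mathbb R\to\mathbb C$ let $\mathcal F(\varphi)$ be its Fourier transform as a tempered distribution, with the normalization $\mathcal F(\varphi)(\xi)=\int_{\mathbb R}e^{-2\pi i t\xi}\varphi(t)\,dt$ for integrable $\varphi$. Let $V[a,b]$ be the space of bounded continuous $\varphi:\mathbb R\to\mathbb C$ with $\mathrm{supp}\,\mathcal F(\varphi)\subset[a,b]$ (a Banach space with the $L^\infty(\mathbb R)$-norm), and $B_1(V[a,b])=\{\varphi\in V[a,b]:\|\varphi\|_{L^\infty}\le1\}$, endowed with the metric $$d(\varphi_1,\varphi_2)=\sum_{n=1}^\infty2^{-n}\|\varphi_1-\varphi_2\|_{L^\infty([-n,n])},$$ which makes it a compact metric space. The map $\sigma(\varphi)(t)=\varphi(t+1)$ is a homeomorphism of $B_1(V[a,b])$. Dynamical dimensions. For a compact metric space $(X,d)$ with a homeomorphism $T:X\to X$ and $M\in\mathbb N=\{1,2,\dots\}$ put $d_M(x,y)=\max_{0\le m<M}d(T^mx,T^my)$ and $B_{d_M}(x,r)=\{y\in X: d_M(x,y)\le r\}$.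 For a metric $d$, a subset $K$ and $\varepsilon>0$, $N_d(K,\varepsilon)$ is the minimal $n\ge1$ such that $K$ can be covered by $n$ open sets of $d$-diameter at most $\varepsilon$. For $0<\rho<r$ let $$S(X,r,\rho)=\lim_{M\to\infty}\frac1M\sup_{x\in X}\log N_{d_M}(B_{d_M}(x,r),\rho)$$ (the limit exists by sub-additivity). Then $$\mathrm{mdim}_{\mathrm A}(X,T,d)=\inf\{s>0:\exists C>0\ \forall\, 0<\rho<r,\ e^{S(X,r,\rho)}\le C(r/\rho)^s\},$$ $$\mathrm{mdim}_{\mathrm A}^\theta(X,T,d)=\inf\{s>0:\exists C>0\ \forall\, 0<r<1,\ e^{S(X,r,r^{1/\theta})}\le C(r/r^{1/\theta})^s\}.$$ The upper and lower metric mean dimensions are the $\limsup$ and $\liminf$ as $\varepsilon\to0$ of $\lim_{M\to\infty}\frac{\log N_{d_M}(X,\varepsilon)}{M\log(1/\varepsilon)}$; if they coincide, the common value is the metric mean dimension $\mathrm{mdim}_{\mathrm M}(X,T,d)$. *)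

(* Defs.v *)
From HB Require Import structures.
From mathcomp Require Import all_boot all_order all_algebra.
From mathcomp Require Import complex.
From mathcomp Require Import all_classical all_reals all_analysis.

Set Implicit Arguments.
Unset Strict Implicit.
Unset Printing Implicit Defensive.
Import Order.TTheory GRing.Theory Num.Theory.
Import numFieldNormedType.Exports.
Local Open Scope classical_set_scope.
Local Open Scope ring_scope.

(** * Dynamical dimensions

A system is a set [X] of points of a type [E], a distance [d] and a map [T]
on [E] that preserves [X]; only their restrictions to [X] matter.  Covering
numbers, and hence all dimensions, take values in the extended reals. *)

Definition dist_open (R : realType) (E : Type) (X : set E) (d : E -> E -> R)
    (U : set E) : Prop :=
  U `<=` X /\
  forall x, U x -> exists2 e : R, 0 < e & forall y, X y -> d x y < e -> U y.

Definition dist_diam (R : realType) (E : Type) (d : E -> E -> R)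
    (U : set E) : \bar R :=
  ereal_sup [set (d p.1 p.2)%:E | p in U `*` U].

Definition dist_cball (R : realType) (E : Type) (X : set E) (d : E -> E -> R)
    (x : E) (r : R) : set E :=
  [set y | X y /\ d x y <= r].

Definition covered_by (R : realType) (E : Type) (X : set E) (d : E -> E -> R)
    (K : set E) (eps : R) (n : nat) : Prop :=
  exists U : 'I_n -> set E,
    (forall i, dist_open X d (U i) /\ (dist_diam d (U i) <= eps%:E)%E) /\
    K `<=` \bigcup_i U i.

(* The minimum of a set of positive integers; +oo if there is no finite cover *)
Definition covnum (R : realType) (E : Type) (X : set E) (d : E -> E -> R)
    (K : set E) (eps : R) : \bar R :=
  ereal_inf [set (n%:R)%:E |
    n in [set n : nat | (1 <= n)%N /\ covered_by X d K eps n]].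

(* For M >= 1 the neutral element 0 is harmless since distances are >= 0 *)
Definition dyn_dist (R : realType) (E : Type) (d : E -> E -> R) (T : E -> E)
    (M : nat) (x y : E) : R :=
  \big[Num.max/0]_(m < M) d (iter m T x) (iter m T y).

Definition local_entropy (R : realType) (E : Type) (X : set E)
    (d : E -> E -> R) (T : E -> E) (r rho : R) : \bar R :=
  limn (fun M : nat => ((M%:R^-1)%:E *
    ereal_sup [set lne (covnum X (dyn_dist d T M)
                          (dist_cball X (dyn_dist d T M) x r) rho) | x in X])%E).

Definition mdimA (R : realType) (E : Type) (X : set E)
    (d : E -> E -> R) (T : E -> E) : \bar R :=
  ereal_inf [set s%:E | s in [set s : R | 0 < s /\
    exists2 C : R, 0 < C & forall r rho : R, 0 < rho -> rho < r ->
      (expeR (local_entropy X d T r rho) <= (C * (r / rho) `^ s)%:E)%E]].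

Definition mdimA_spectrum (R : realType) (E : Type) (X : set E)
    (d : E -> E -> R) (T : E -> E) (theta : R) : \bar R :=
  ereal_inf [set s%:E | s in [set s : R | 0 < s /\
    exists2 C : R, 0 < C & forall r : R, 0 < r -> r < 1 ->
      (expeR (local_entropy X d T r (r `^ theta^-1)) <=
        (C * (r / r `^ theta^-1) `^ s)%:E)%E]].

Definition mdimM_at_scale (R : realType) (E : Type) (X : set E)
    (d : E -> E -> R) (T : E -> E) (eps : R) : \bar R :=
  limn (fun M : nat => (lne (covnum X (dyn_dist d T M) X eps) *
                        ((M%:R * ln eps^-1)^-1)%:E)%E).

Definition upper_mdimM (R : realType) (E : Type) (X : set E)
    (d : E -> E -> R) (T : E -> E) : \bar R :=
  limf_esup (mdimM_at_scale X d T) (0 : R)^'+.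

Definition lower_mdimM (R : realType) (E : Type) (X : set E)
    (d : E -> E -> R) (T : E -> E) : \bar R :=
  limf_einf (mdimM_at_scale X d T) (0 : R)^'+.

(* The metric mean dimension exists and equals v *)
Definition is_mdimM (R : realType) (E : Type) (X : set E)
    (d : E -> E -> R) (T : E -> E) (v : \bar R) : Prop :=
  upper_mdimM X d T = v /\ lower_mdimM X d T = v.

(** * Fourier transforms and band-limited functions *)

Definition cintegral (R : realType) (f : R -> R[i]) : R[i] :=
  Complex (\int[@lebesgue_measure R]_t complex.Re (f t))
          (\int[@lebesgue_measure R]_t complex.Im (f t)).

Definition expi (R : realType) (x : R) : R[i] := Complex (cos x) (sin x).

Definition fourier (R : realType) (psi : R -> R[i]) (xi : R) : R[i] :=
  cintegral (fun t => expi (- (2 * pi * t * xi)) * psi t).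

(* The Fourier transform of phi as a distribution, defined by duality:
   <F(phi), psi> = <phi, F(psi)> *)
Definition fourier_distr (R : realType) (phi : R -> R[i])
    (psi : R -> R[i]) : R[i] :=
  cintegral (fun t => phi t * fourier psi t).

Definition smooth (R : realType) (f : R -> R) : Prop :=
  forall (n : nat) (t : R), derivable (derive1n n f) t 1.

Definition closed_support (R : realType) (f : R -> R[i]) : set R :=
  closure [set t | f t != 0].

Definition test_function (R : realType) (psi : R -> R[i]) : Prop :=
  [/\ smooth (fun t => complex.Re (psi t)),
      smooth (fun t => complex.Im (psi t)) &
      compact (closed_support psi)].

(* A tempered distribution enters here only through its values on compactly
   supported test functions, which determine its support. *)
Definition distr_vanishes_on (R : realType) (u : (R -> R[i]) -> R[i])
    (U : set R) : Prop :=
  forall psi, test_function psi -> closed_support psi `<=` U -> u psi = 0.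

Definition distr_support (R : realType) (u : (R -> R[i]) -> R[i]) : set R :=
  ~` \bigcup_(U in [set U : set R | open U /\ distr_vanishes_on u U]) U.

(* The codomain is cast to R[i]^o, which carries the topology of the modulus *)
Definition bandlimited (R : realType) (a b : R) : set (R -> R[i]) :=
  [set phi | [/\ continuous (phi : R -> R[i]^o),
                 exists K : R, forall t, Normc.normc (phi t) <= K &
                 distr_support (fourier_distr phi) `<=` `[a, b]]].

(* The essential supremum over D, computed on the extension of f by 0 *)
Definition Linfty_norm (R : realType) (D : set R) (f : R -> R[i]) : \bar R :=
  'N[@lebesgue_measure R]_+oo[(fun t => (Normc.normc (f t))%:E) \_ D]%E.

Definition bandlimited_ball (R : realType) (a b : R) : set (R -> R[i]) :=
  [set phi | bandlimited a b phi /\ (Linfty_norm setT phi <= 1)%E].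

(* The series is finite for bounded functions *)
Definition bl_dist (R : realType) (phi1 phi2 : R -> R[i]) : R :=
  fine (\sum_(1 <= n <oo) ((2 ^- n)%:E *
    Linfty_norm `[(- n%:R)%R, n%:R%R] (fun t => (phi1 t - phi2 t)%R)))%E.

Definition unit_shift (R : realType) (phi : R -> R[i]) : R -> R[i] :=
  fun t => phi (t + 1).

(* Main.v *)
From HB Require Import structures.
From mathcomp Require Import all_boot all_order all_algebra.
From mathcomp Require Import complex.
From mathcomp Require Import all_classical all_reals all_analysis.
From mathcomp Require Import measurable_realfun ess_sup_inf ring lra zify.
Require Import Defs.

(** Write [e(x)] for [exp (2 pi i x)] and [X] for the unit ball of functions with
frequencies in [[a, b]].  All three dimensions are read off from the growth rate
in [M] of the logarithm of covering numbers of balls of radius [r] by sets of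
diameter [rho] for the distance [d_M].  This rate lies between
[2 (b - a) ln (r / (4 rho))], for [4 rho < r <= 1], and [2 s ln (C r / rho)] for each
[s > b - a]; the factor 2 is the real dimension of the complex numbers.  Roughly,
[d_M] is the uniform distance on a neighbourhood of [[0, M]].

Upper bound ([sampling], [ball_cover_le]).  Fix [s > b - a].  Oversampling at the
points [k / s] is stable: [|phi t|] is at most a constant times the largest
sample near [t], plus an error that decays with the distance to the samples that
are ignored.  Hence a cell of the grid in the space of samples at about
[s M + O(1)] points has [d_M]-diameter at most [rho] once its sides are of order
[rho].  Only about [s M] samples matter for the rate, and in a ball of radius [r]
each of their real coordinates ranges over [O(r / rho)] cells, which gives
[(C r / rho) ^ (2 s M)] cells up to a factor that does not depend on [M].

The sampling inequality comes from Poisson summation.  Take a smooth window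
whose translates by [s] add up to 1 and whose support is slightly longer than
[s], and let [kappa] be its inverse Fourier transform; [kappa] decays fast,
[kappa 0 > 0] and [kappa (k / s) = 0] for [k <> 0].  With [c] the middle of
[[a, b]], the Fourier coefficients of the [1/s]-periodization of
[F x = phi x e((t - x) c) kappa (t - x)] are the pairings of the Fourier
transform of [phi] with test functions centred at [c + j s]; for [j <> 0] their
supports avoid [[a, b]], so the periodization is constant ([poisson] proves this
with Fejer means).  At [t] its value is [phi t * kappa 0], and at [0] it is a
weighted sum of samples.

Lower bound ([trig_bandlimited], [cover_ball_ge], [ball_cover_ge]).  The
exponentials with frequencies [j / M] in [[a, b]] span a space of about
[(b - a) M] complex dimensions inside the band-limited functions, on which, by
periodicity, [d_M] dominates half of the uniform norm on the line.  A covering of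
a ball of a normed space of real dimension [n] by balls whose radii are smaller
by a factor [q] has at least [q ^ - n] members.  The proof by volumes is replaced
by iteration: [k] steps give a covering at scale [q ^ k], to be compared with a
grid of coefficients as [k] tends to infinity.

Limits ([fekete], [entropy_exists]).  Subadditivity in [M] shows that the growth
rates exist, hence that the limits in the definitions are the expected ones, and
the two bounds pass to the limit.  The spectrum is at most [mdimA] since it
restricts the scales, it is at least [2 (b - a)] by the lower bound as [r] tends
to 0, and [mdimA] is at most [2 s] for each [s > b - a]. *)

Import Order.TTheory GRing.Theory Num.Theory.
Import numFieldNormedType.Exports.
Local Open Scope classical_set_scope.
Local Open Scope ring_scope.

Set Implicit Arguments.
Unset Strict Implicit.
Unset Printing Implicit Defensive.

Local Notation mu := (@lebesgue_measure _).
Local Notation itg f := (mu.-integrable setT (EFin \o f)).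
Local Notation Re := complex.Re.
Local Notation Im := complex.Im.
Local Notation normc := Normc.normc.

(** * Smooth functions *)

Lemma is_derive_derive1 (R : realType) (f g : R -> R) :
  (forall t : R, is_derive t 1 f (g t)) -> derive1 f = g.
Proof. by move=> fg; apply/funext => t; rewrite derive1E; apply: derive_val. Qed.

(** Smoothness by coinduction: a class of functions that contains the derivatives
of its members consists of smooth functions.  This avoids formulas for iterated
derivatives throughout. *)
Lemma smooth_coind (R : realType) (S : set (R -> R)) :
  (forall f, S f -> exists2 g, S g & forall t : R, is_derive t 1 f (g t)) ->
  forall f, S f -> smooth f.
Proof.
move=> HS f Sf n.
suff Sn : S (derive1n n f).
  by move=> t; have [g _ /(_ t) fg] := HS _ Sn; apply: ex_derive.
elim: n => [//|n IH].
have [g Sg fg] := HS _ IH.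
by rewrite derive1nS (is_derive_derive1 fg).
Qed.

Lemma smooth_derive1 (R : realType) (f : R -> R) : smooth f -> smooth (derive1 f).
Proof. by move=> sf n t; rewrite -derive1Sn; exact: sf. Qed.

Lemma smooth_is_derive (R : realType) (f : R -> R) :
  smooth f -> forall t : R, is_derive t 1 f ((derive1 f) t).
Proof.
by move=> sf t; rewrite derive1E; apply: DeriveDef => //; exact: (sf 0%N t).
Qed.

Lemma smooth_continuous (R : realType) (f : R -> R) :
  smooth f -> continuous f.
Proof.
move=> sf t; apply/differentiable_continuous/derivable1_diffP.
exact: (sf 0%N t).
Qed.

Lemma smooth_cst (R : realType) (c : R) : smooth (fun=> c : R).
Proof.
apply: (@smooth_coind _ [set f | exists c, f = fun=> c]); last by exists c.
move=> _ [d ->]; exists (fun=> 0); first by exists 0.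
by move=> t; exact: is_derive_cst.
Qed.

(** Products of smooth functions are not stable under derivation, their sums are. *)
Inductive prod_span (R : realType) : (R -> R) -> Prop :=
| prod_span1 f g : smooth f -> smooth g -> prod_span (fun t => f t * g t)
| prod_spanD f g : prod_span f -> prod_span g -> prod_span (fun t => f t + g t).

Lemma smooth_prod_span (R : realType) (f : R -> R) : prod_span f -> smooth f.
Proof.
move: f; apply: (@smooth_coind _ (@prod_span R)) => h; elim=> {h}.
  move=> f g sf sg; exists (fun t => (derive1 f) t * g t + f t * (derive1 g) t).
    exact: prod_spanD (prod_span1 (smooth_derive1 sf) sg)
                      (prod_span1 sf (smooth_derive1 sg)).
  move=> t; have ? := smooth_is_derive sf t; have ? := smooth_is_derive sg t.
  rewrite (_ : (fun u => f u * g u) = f * g) //; apply: is_derive_eq.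
  by rewrite /GRing.scale /=; ring.
move=> f g _ [f' sf' ff'] _ [g' sg' gg'].
exists (fun t => f' t + g' t); first exact: prod_spanD.
by move=> t; apply: is_deriveD.
Qed.

Lemma smoothM (R : realType) (f g : R -> R) :
  smooth f -> smooth g -> smooth (fun t => f t * g t).
Proof. by move=> sf sg; apply: smooth_prod_span; exact: prod_span1. Qed.

Lemma smoothD (R : realType) (f g : R -> R) :
  smooth f -> smooth g -> smooth (fun t => f t + g t).
Proof.
move=> sf sg; apply: smooth_prod_span.
rewrite (_ : (fun t => f t + g t) = fun t => f t * 1 + g t * 1); last first.
  by apply/funext => t; rewrite !mulr1.
apply: (@prod_spanD _ (fun t => f t * 1) (fun t => g t * 1)).
  exact: (@prod_span1 _ f (fun=> 1) sf (@smooth_cst R 1)).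
exact: (@prod_span1 _ g (fun=> 1) sg (@smooth_cst R 1)).
Qed.

Lemma smoothZ (R : realType) (c : R) (f : R -> R) :
  smooth f -> smooth (fun t => c * f t).
Proof. by move=> sf; exact: (@smoothM _ (fun=> c) f (@smooth_cst R c) sf). Qed.

Lemma smoothN (R : realType) (f : R -> R) : smooth f -> smooth (fun t => - f t).
Proof.
move=> sf; rewrite (_ : (fun t => - f t) = fun t => -1 * f t).
  exact: (@smoothZ _ (-1) f sf).
by apply/funext => t; rewrite mulN1r.
Qed.

Lemma smoothB (R : realType) (f g : R -> R) :
  smooth f -> smooth g -> smooth (fun t => f t - g t).
Proof. by move=> sf sg; exact: (@smoothD _ f (fun t => - g t) sf (smoothN sg)). Qed.

Lemma is_derive_affine (R : realType) (k c t : R) :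
  is_derive t 1 (fun u : R => k * u + c) k.
Proof.
rewrite (_ : (fun u => k * u + c) = (cst k * id + cst c)%R) //.
by apply: is_derive_eq; rewrite /GRing.scale /= mulr0 addr0 mulr1 addr0.
Qed.

Lemma smooth_affine (R : realType) (f : R -> R) (k c : R) :
  smooth f -> smooth (fun t => f (k * t + c)).
Proof.
move=> sf; apply: (@smooth_coind _ [set h | exists a g,
   smooth g /\ h = fun t => a * g (k * t + c)]); last first.
  by exists 1, f; split; [exact: sf|apply/funext => t; rewrite mul1r].
move=> _ [a [g [sg ->]]]; exists (fun t => (a * k) * (derive1 g) (k * t + c)).
  by exists (a * k), (derive1 g); split; [exact: smooth_derive1|].
move=> t; have gd := smooth_is_derive sg (k * t + c).
have kd := is_derive_affine k c t.
have gk := @is_derive1_comp _ g (fun u => k * u + c) t _ _ gd kd.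
rewrite (_ : (fun u => a * g (k * u + c)) = cst a * (g \o (fun u => k * u + c))) //.
by apply: is_derive_eq; rewrite /GRing.scale /= mulr0 addr0; ring.
Qed.

Lemma smooth_cos (R : realType) : smooth (@cos R).
Proof.
apply: (@smooth_coind _ [set h | exists c, h = fun t => cos (1 * t + c)]).
  move=> _ [c ->]; exists (fun t => cos (1 * t + (c + pi / 2))).
    by exists (c + pi / 2).
  move=> t; rewrite addrA cosDpihalf.
  have := @is_derive1_comp _ cos (fun u => 1 * u + c) t _ _
    (is_derive_cos (1 * t + c)) (is_derive_affine 1 c t).
  by rewrite mulr1.
by exists 0; apply/funext => t; rewrite mul1r addr0.
Qed.

Lemma smooth_sin (R : realType) : smooth (@sin R).
Proof.
rewrite (_ : sin = fun t => cos (1 * t + - (pi / 2))).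
  exact/smooth_affine/smooth_cos.
by apply/funext => t; rewrite mul1r cosBpihalf.
Qed.

Lemma derive1_near0 (R : realType) (p : R -> R) (u : R) :
  (\forall v \near u, p v = 0) -> (derive1 p) u = 0.
Proof.
move=> pu; suff d0 : is_derive u 1 p 0 by rewrite derive1E derive_val.
apply: (@near_eq_is_derive _ _ _ (cst 0)).
by apply: filterS pu => v ->.
Qed.

(** Near a zero of [g] the numerator vanishes identically, which makes the
convention [0^-1 = 0] harmless; numerators with that property are stable under
the numerator [f' g - k f g'] of the quotient rule. *)
Lemma smooth_div (R : realType) (f g : R -> R) :
  smooth f -> smooth g ->
  (forall t, g t = 0 -> \forall u \near t, f u = 0) ->
  smooth (fun t => f t / g t).
Proof.
move=> sf sg fg0.
apply: (@smooth_coind _ [set h | exists2 p, (smooth p /\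
    (forall t, g t = 0 -> \forall u \near t, p u = 0)) &
    exists k, h = fun t => p t * (g t)^-1 ^+ k.+1]); last first.
  exists f; first by split; [exact: sf|exact: fg0].
  by exists 0%N; apply/funext => t; rewrite expr1.
move=> _ [p [sp p0] [k ->]].
pose q := fun t => (derive1 p) t * g t + (- k.+1%:R) * (p t * (derive1 g) t).
exists (fun t => q t * (g t)^-1 ^+ k.+2).
  exists q; last by exists k.+1.
  split.
    apply: smoothD; first exact: smoothM (smooth_derive1 sp) sg.
    by apply: smoothZ; exact: smoothM sp (smooth_derive1 sg).
  move=> t gt0; have /near_join := p0 _ gt0; apply: filterS => u pu.
  rewrite /q (nbhs_singleton pu) mul0r mulr0 addr0.
  by rewrite (_ : (derive1 p) u = 0) ?mul0r//; exact: derive1_near0.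
move=> t.
have [gt0|gt0] := eqVneq (g t) 0.
  rewrite gt0 invr0 expr0n mulr0; apply: (@near_eq_is_derive _ _ _ (cst 0)).
  by apply: filterS (p0 _ gt0) => u pu; rewrite pu mul0r.
have pd := smooth_is_derive sp t; have gd := smooth_is_derive sg t.
have gV := is_deriveV gt0 gd.
rewrite (_ : (fun u => p u * (g u)^-1 ^+ k.+1) =
  p * (fun u => (g u)^-1) ^+ k.+1); last first.
  by apply/funext => u; rewrite !fctE.
apply: is_derive_eq; rewrite /GRing.scale /= /q !fctE !exprS -mulr_natr.
by field.
Qed.

(** The functions [p(1/x) exp (- 1/x)], extended by 0: unlike [exp (- 1/x)] alone,
this family is stable under derivation. *)
Definition flat (R : realType) (p : {poly R}) (x : R) : R :=
  if 0 < x then p.[x^-1] * expR (- x^-1) else 0.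

Lemma flat_bound (R : realType) (p : {poly R}) :
  exists2 C : R, 0 <= C & forall x, `|flat p x| <= C * `|x|.
Proof.
exists (\sum_(i < size p) `|p`_i| * (i.+1)`!%:R).
  by apply: sumr_ge0 => i _; rewrite mulr_ge0.
move=> x; rewrite /flat; case: ifPn => [x0|_]; last first.
  by rewrite normr0 mulr_ge0// sumr_ge0// => i _; rewrite mulr_ge0.
rewrite horner_coef mulr_suml mulr_suml (le_trans (ler_norm_sum _ _ _))//.
apply: ler_sum => i _; rewrite !normrM -!mulrA ler_wpM2l//.
rewrite (ger0_norm (expR_ge0 _)) (gtr0_norm x0) ger0_norm ?exprn_ge0 ?invr_ge0 ?(ltW x0)//.
rewrite expRN ler_pdivrMr ?expR_gt0//.
have := @expR_ge1Dxn _ x^-1 i; rewrite invr_ge0 (ltW x0) => /(_ isT) h.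
have f0 : 0 < (i.+1)`!%:R :> R by rewrite ltr0n fact_gt0.
rewrite -mulrA -ler_pdivrMl// -ler_pdivrMl//.
apply: (le_trans _ h); rewrite (_ : x^-1 * _ = x^-1 ^+ i.+1 / (i.+1)`!%:R).
  by rewrite lerDr.
by rewrite exprS; ring.
Qed.

Lemma is_derive_flat (R : realType) (p : {poly R}) (x : R) :
  is_derive x 1 (flat p) (flat ('X^2 * (p - deriv p)) x).
Proof.
have [x0|x0|->] := ltgtP x 0.
- rewrite /flat ltNge (ltW x0) /=; apply: (@near_eq_is_derive _ _ _ (cst 0)).
  near=> u; rewrite /= ifF//; apply/negbTE; rewrite -leNgt ltW//.
  by near: u; exact: lt_nbhsl.
- rewrite /flat x0.
  have vd : is_derive x 1 (fun y : R => y^-1) (- x ^- 2).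
    have := @is_deriveV _ id x 1 1 (lt0r_neq0 x0) (is_derive_id x 1).
    by rewrite /GRing.scale /= mulr1.
  have pd := @is_derive1_comp _ (horner p) _ _ _ _ (is_derive_poly p x^-1) vd.
  have ed := @is_derive1_comp _ expR (- (fun y : R => y^-1)) x _ _ (is_derive_expR (- x^-1)) (is_deriveN vd).
  apply: (@near_eq_is_derive _ _ _
    ((horner p \o (fun y : R => y^-1)) * (expR \o - (fun y : R => y^-1)))).
    near=> u; rewrite ifT//.
    by near: u; exact: lt_nbhsr.
  apply: is_derive_eq; rewrite /GRing.scale /= !hornerE !fctE /=.
  by rewrite exprVn; ring.
- have [C C0 hC] := flat_bound ('X * p).
  have f0 q : @flat R q 0 = 0 by rewrite /flat ltxx.
  apply/is_derive1_caratheodory; exists (flat ('X * p)); split.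
  + move=> z; rewrite f0 !subr0 /flat; case: ifPn => [z0|]; last by rewrite mul0r.
    by rewrite !hornerE; field; rewrite gt_eqF.
  + rewrite /prop_for /continuous_at f0; apply/cvgr0Pnorm_lt => e e0.
    have C1 : 0 < C + 1 by rewrite ltr_wpDl.
    near=> z; apply: (le_lt_trans (hC z)).
    apply: (@le_lt_trans _ _ ((C + 1) * `|z|)).
      by rewrite ler_wpM2r// lerDl.
    rewrite -ltr_pdivlMl//.
    near: z; exists ((C + 1)^-1 * e).
      by rewrite /= mulr_gt0 ?invr_gt0.
    by move=> y; rewrite /= sub0r normrN.
  + by rewrite !f0.
Unshelve. all: by end_near. Qed.

Lemma smooth_flat (R : realType) (p : {poly R}) : smooth (flat p).
Proof.
apply: (@smooth_coind _ [set h | exists p, h = flat p]); last by exists p.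
move=> _ [q ->]; exists (flat ('X^2 * (q - deriv q))); first by eexists.
exact: is_derive_flat.
Qed.

(** A smooth step from 0 on the left of [-1] to 1 on the right of [1].  The quotient
is defined everywhere since the supports of the two flat functions cover the
line; their arguments are affine maps in the shape of [smooth_affine]. *)
Definition step (R : realType) (x : R) : R :=
  flat 1 (1 * x + 1) / (flat 1 (1 * x + 1) + flat 1 (-1 * x + 1)).

Lemma flat1_gt0 (R : realType) (x : R) : 0 < x -> 0 < flat 1 x.
Proof. by move=> x0; rewrite /flat x0 hornerE mul1r expR_gt0. Qed.

Lemma flat1_le0 (R : realType) (x : R) : x <= 0 -> flat 1 x = 0.
Proof. by move=> x0; rewrite /flat ltNge x0. Qed.

Lemma flat1_ge0 (R : realType) (x : R) : 0 <= flat 1 x.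
Proof.
by case: (ltP 0 x) => [/flat1_gt0/ltW//|/flat1_le0 ->].
Qed.

Lemma step_den_gt0 (R : realType) (x : R) :
  0 < flat 1 (1 * x + 1) + flat 1 (-1 * x + 1).
Proof.
case: (ltP 0 (1 * x + 1)) => x1.
  by rewrite ltr_wpDr ?flat1_ge0 ?flat1_gt0.
by rewrite ltr_wpDl ?flat1_ge0// flat1_gt0//; lra.
Qed.

Lemma smooth_step (R : realType) : smooth (@step R).
Proof.
have s1 : smooth (fun x : R => flat 1 (1 * x + 1)).
  by apply: smooth_affine; exact: smooth_flat.
have s2 : smooth (fun x : R => flat 1 (-1 * x + 1)).
  by apply: smooth_affine; exact: smooth_flat.
apply: (smooth_div s1 (smoothD s1 s2)) => t t0.
by have := step_den_gt0 t; rewrite t0 ltxx.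
Qed.

Lemma step_le (R : realType) (x : R) : x <= -1 -> step x = 0.
Proof. by move=> x1; rewrite /step flat1_le0 ?mul0r//; lra. Qed.

Lemma step_ge (R : realType) (x : R) : 1 <= x -> step x = 1.
Proof.
move=> x1; rewrite /step (@flat1_le0 _ (-1 * x + 1)) ?addr0; last by lra.
by rewrite mulfV// gt_eqF// flat1_gt0//; lra.
Qed.

Lemma step_ge0 (R : realType) (x : R) : 0 <= step x.
Proof. by rewrite divr_ge0 ?flat1_ge0 ?ltW ?step_den_gt0. Qed.

Lemma step_le1 (R : realType) (x : R) : step x <= 1.
Proof.
by rewrite /step ler_pdivrMr ?step_den_gt0// [leRHS]mul1r lerDl flat1_ge0.
Qed.

(** * Integrals of functions with decay *)

(** The majorant used for all integrals and sums: it is integrable, its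
primitive [atan] bounds its sums, and it is comparable to its translates. *)
Definition wgt (R : realType) (x : R) : R := (1 + x ^+ 2)^-1.

Lemma wgt_gt0 (R : realType) (x : R) : 0 < wgt x.
Proof. by rewrite invr_gt0 ltr_pwDl// sqr_ge0. Qed.

Lemma wgt_ge0 (R : realType) (x : R) : 0 <= wgt x.
Proof. exact/ltW/wgt_gt0. Qed.

Lemma wgt_le1 (R : realType) (x : R) : wgt x <= 1.
Proof. by rewrite invf_le1 ?ltr_pwDl ?sqr_ge0// lerDl sqr_ge0. Qed.

Lemma continuous_wgt (R : realType) : continuous (@wgt R).
Proof. exact: continuous_oneDsqrV. Qed.

Lemma integrable_wgt (R : realType) : itg (@wgt R).
Proof.
apply/integrableP; split.
  by apply/measurable_EFinP; apply: continuous_measurable_fun; exact: continuous_wgt.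
under eq_integral do rewrite /= ger0_norm ?wgt_ge0//.
rewrite ge0_symfun_integralT; last 3 first.
- exact: wgt_ge0.
- exact: continuous_wgt.
- by move=> x; rewrite /wgt /= sqrrN.
rewrite -set_itvcy// (integral0y_oneDsqr R) -EFinM ltry//.
Qed.

Lemma integrable_decay (R : realType) (f : R -> R) (K : R) :
  continuous f -> (forall x, `|f x| <= K * wgt x) -> itg f.
Proof.
move=> cf fK; have := integrableZl (@measurableT _ _) K (integrable_wgt R).
apply: le_integrable => //.
  by apply/measurable_EFinP; exact: continuous_measurable_fun.
move=> x _ /=; rewrite lee_fin (le_trans (fK x))// ler_norm//.
Qed.

Lemma Rintegral_decay (R : realType) (f : R -> R) (K : R) :
  continuous f -> (forall x, `|f x| <= K * wgt x) ->
  `|\int[mu]_x f x| <= K * \int[mu]_x @wgt R x.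
Proof.
move=> cf fK; have itf := integrable_decay cf fK.
apply: (le_trans (le_normr_Rintegral _ itf)) => //.
rewrite -RintegralZl//; last exact: integrable_wgt.
apply: le_Rintegral => //.
  by have := integrable_norm itf.
by have := integrableZl (@measurableT _ _) K (integrable_wgt R).
Qed.

Lemma measurable_translate (R : realType) (c : R) :
  measurable_fun [set: measurableTypeR R]
    ((fun x : R => x + c) : measurableTypeR R -> measurableTypeR R).
Proof.
apply: continuous_measurable_fun => x.
by apply: cvgD; [exact: cvg_id|exact: cvg_cst].
Qed.

Lemma lebesgue_translate (R : realType) (c : R) (A : set R) : measurable A ->
  @lebesgue_measure R A = @lebesgue_measure R ((fun x => x + c) @^-1` A).
Proof.
have mc := measurable_translate c.
pose HBi := isMeasurableFun.Build _ _ _ _ _ mc.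
pose F : {mfun _ >-> _} := MeasurableFun.Pack (MeasurableFun.Class HBi).
apply: (@lebesgue_measure_unique R (pushforward lebesgue_measure F)).
move=> _ [[a b] /= _ <-]; rewrite /pushforward /=.
rewrite (_ : _ @^-1` _ = `]a - c, b - c]%classic); last first.
  by apply/seteqP; split => x /=; rewrite !in_itv/= ltrBlDr lerBrDr.
rewrite !lebesgue_measure_itv /= !lte_fin ltrD2r.
by case: ifP => // _; rewrite -!EFinD; congr EFin; ring.
Qed.

Lemma ge0_integral_translate (R : realType) (f : R -> \bar R) (c : R) :
  measurable_fun [set: R] f -> (forall x, 0 <= f x)%E ->
  (\int[mu]_x f (x + c)%R = \int[mu]_x f x)%E.
Proof.
move=> mf f0; have mc := measurable_translate c.
have h := @ge0_integral_pushforward _ _ _ _ R _ mc (@lebesgue_measure R) setT f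
  measurableT.
rewrite preimage_setT /= in h; rewrite /comp in h; rewrite -h//.
by apply: eq_measure_integral => A mA _; exact/esym/lebesgue_translate.
Qed.

Lemma integrable_translate (R : realType) (f : R -> R) (c : R) :
  itg f -> itg (fun x => f (x + c)).
Proof.
move=> /integrableP[mf f1]; apply/integrableP; split.
  exact: (@measurableT_comp _ _ _ _ _ _ _ _ _ mf (measurable_translate c)).
rewrite (@ge0_integral_translate R (fun x => `|(f x)%:E|%E))//.
exact: measurableT_comp.
Qed.

Lemma Rintegral_translate (R : realType) (f : R -> R) (c : R) :
  itg f -> \int[mu]_x f (x + c) = \int[mu]_x f x.
Proof.
move=> itf; have /integrableP[mf _] := itf; have mc := measurable_translate c.
rewrite /Rintegral; congr fine.
have h := @integral_pushforward _ _ _ _ R _ mc (@lebesgue_measure R) setT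
  (EFin \o f) mf.
rewrite preimage_setT /= in h; rewrite /comp in h.
rewrite -h//; last exact: integrable_translate.
by apply: eq_measure_integral => A mA _; exact/esym/lebesgue_translate.
Qed.

(** * Integrals of compactly supported functions *)

Definition csupp (R : realType) (A : R) (f : R -> R) :=
  forall t, A < `|t| -> f t = 0.

Lemma csupp_decay (R : realType) (A : R) (f : R -> R) :
  continuous f -> csupp A f -> exists2 B : R, 0 <= B &
    (forall x, `|f x| <= B) /\ forall x, `|f x| <= B * wgt x.
Proof.
move=> cf sf.
have [M0 hM] : exists M0 : R, forall x, `|f x| <= M0.
  have cI : {within `[- `|A|, `|A|], continuous f} by exact: continuous_subspaceT.
  have [M0 [_ hM]] := compact_bounded (continuous_compact cI (@segment_compact _ _ _)).
  exists (Num.max 0 (M0 + 1)) => x; rewrite le_max.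
  case: (leP `|x| `|A|) => xA.
    apply/orP; right; apply: hM; first by rewrite ltrDl.
    by exists x => //=; rewrite in_itv/= -ler_norml.
  by rewrite sf ?normr0 ?lexx// (le_lt_trans (ler_norm _) xA).
have M00 : 0 <= M0 by exact: le_trans (hM 0).
have A0 : 0 <= A ^+ 2 by exact: sqr_ge0.
exists (M0 * (1 + A ^+ 2)); first by rewrite mulr_ge0// addr_ge0.
split=> x.
  by rewrite (le_trans (hM x))// ler_peMr// lerDl.
rewrite /wgt; case: (leP `|x| `|A|) => xA; last first.
  rewrite sf ?normr0; last by rewrite (le_lt_trans (ler_norm _) xA).
  by rewrite mulr_ge0 ?wgt_ge0// mulr_ge0// addr_ge0.
rewrite -mulrA (le_trans (hM x))// ler_peMr// ler_pdivlMr ?mul1r ?ltr_pwDl ?sqr_ge0//.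
by rewrite lerD2l -[x ^+ 2]real_normK ?num_real// -[A ^+ 2]real_normK ?num_real// lerXn2r ?nnegrE.
Qed.

Lemma integrable_csupp (R : realType) (A : R) (f : R -> R) :
  continuous f -> csupp A f -> itg f.
Proof.
by move=> cf sf; have [B _ [_ hB]] := csupp_decay cf sf; exact: integrable_decay hB.
Qed.

Lemma integral_derive0 (R : realType) (A : R) (G g : R -> R) :
  (forall t : R, is_derive t 1 G (g t)) -> continuous g -> csupp A G ->
  \int[mu]_x g x = 0.
Proof.
move=> Gg cg sG.
pose B := `|A| + 1.
have AB : A < B by rewrite /B (le_lt_trans (ler_norm A))// ltrDl.
have B0 : 0 < B by rewrite ltr_wpDl.
have sg : csupp B g.
  move=> t tB; rewrite -(is_derive_derive1 Gg); apply: derive1_near0.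
  have : \forall v \near t, A < `|v|.
    exists (`|t| - A) => [|v] /=; first by rewrite subr_gt0 (lt_trans AB tB).
    by have := ler_normD (t - v) v; rewrite subrK; lra.
  by apply: filterS => v; exact: sG.
have -> : \int[mu]_x g x = \int[mu]_(x in `[- B, B]) g x.
  rewrite [RHS]Rintegral_mkcond; apply: eq_Rintegral => x _.
  rewrite patchE; case: ifPn => //; rewrite notin_setE /= in_itv/= -ler_norml.
  by move/negP; rewrite -ltNge; exact: sg.
have cG : continuous G.
  by move=> t; apply/differentiable_continuous/derivable1_diffP; have [] := Gg t.
rewrite /Rintegral (@continuous_FTC2 _ g G).
- by rewrite !sG ?normrN ?gtr0_norm// -EFinB subrr.
- by rewrite gtrN.
- exact: continuous_subspaceT.
- split; [by move=> t _; have [] := Gg t|apply: cvg_at_right_filter; exact: cG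
         |apply: cvg_at_left_filter; exact: cG].
- by move=> t _; rewrite (is_derive_derive1 Gg).
Qed.

(** * Cosine and sine transforms *)

Definition ct (R : realType) (f : R -> R) (x : R) : R :=
  \int[mu]_t (cos (2 * pi * t * x) * f t).
Definition st (R : realType) (f : R -> R) (x : R) : R :=
  \int[mu]_t (sin (2 * pi * t * x) * f t).

Lemma continuous_lin (R : realType) (a b : R) :
  continuous (fun t : R => a * t * b).
Proof.
move=> t; apply: cvgM; last exact: cvg_cst.
by apply: cvgM; [exact: cvg_cst|exact: cvg_id].
Qed.

Lemma continuous_cosM (R : realType) (f : R -> R) (x : R) :
  continuous f -> continuous (fun t => cos (2 * pi * t * x) * f t).
Proof.
move=> cf t; apply: cvgM; last exact: cf.
by apply: continuous_comp; [exact: continuous_lin|exact: continuous_cos].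
Qed.

Lemma continuous_sinM (R : realType) (f : R -> R) (x : R) :
  continuous f -> continuous (fun t => sin (2 * pi * t * x) * f t).
Proof.
move=> cf t; apply: cvgM; last exact: cf.
by apply: continuous_comp; [exact: continuous_lin|exact: continuous_sin].
Qed.

Lemma csuppM (R : realType) (A : R) (g f : R -> R) :
  csupp A f -> csupp A (fun t => g t * f t).
Proof. by move=> sf t tA; rewrite sf ?mulr0. Qed.

Lemma integrable_cosM (R : realType) (A : R) (f : R -> R) (x : R) :
  continuous f -> csupp A f -> itg (fun t => cos (2 * pi * t * x) * f t).
Proof.
move=> cf sf; apply: (@integrable_csupp _ A); last exact: csuppM.
exact: continuous_cosM.
Qed.

Lemma integrable_sinM (R : realType) (A : R) (f : R -> R) (x : R) :
  continuous f -> csupp A f -> itg (fun t => sin (2 * pi * t * x) * f t).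
Proof.
move=> cf sf; apply: (@integrable_csupp _ A); last exact: csuppM.
exact: continuous_sinM.
Qed.

Lemma ct_bound (R : realType) (A : R) (f : R -> R) : continuous f -> csupp A f ->
  exists2 K : R, 0 <= K & forall x, `|ct f x| <= K /\ `|st f x| <= K.
Proof.
move=> cf sf; have [B B0 [_ hB]] := csupp_decay cf sf.
exists (B * \int[mu]_x @wgt R x).
  by rewrite mulr_ge0// Rintegral_ge0// => x _; exact: wgt_ge0.
move=> x; split; apply: Rintegral_decay.
- exact: continuous_cosM.
- by move=> t; rewrite normrM (le_trans _ (hB t))// ler_piMl// cos_max.
- exact: continuous_sinM.
- by move=> t; rewrite normrM (le_trans _ (hB t))// ler_piMl// sin_max.
Qed.

Lemma is_derive_lin (R : realType) (x t : R) :
  is_derive t 1 (fun u : R => 2 * pi * u * x) (2 * pi * x).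
Proof.
have := @is_derive_affine R (2 * pi * x) 0 t.
by congr is_derive; apply/funext => u; rewrite addr0; ring.
Qed.

Lemma csupp_derive1 (R : realType) (A : R) (f : R -> R) :
  csupp A f -> csupp A (derive1 f).
Proof.
move=> af t tA; apply: derive1_near0.
exists (`|t| - A) => [|v] /=; first by rewrite subr_gt0.
by move=> tv; apply: af; have := ler_normD (t - v) v; rewrite subrK; lra.
Qed.

Lemma ct_derive1 (R : realType) (A : R) (f : R -> R) (x : R) :
  smooth f -> csupp A f ->
  ct (derive1 f) x = 2 * pi * x * st f x /\
  st (derive1 f) x = - (2 * pi * x * ct f x).
Proof.
move=> sf af.
have cf := smooth_continuous sf; have cf' := smooth_continuous (smooth_derive1 sf).
have af' := csupp_derive1 af.
have d1 (t : R) : is_derive t 1 (fun u => cos (2 * pi * u * x) * f u)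
   (cos (2 * pi * t * x) * derive1 f t - 2 * pi * x * (sin (2 * pi * t * x) * f t)).
  have fd := smooth_is_derive sf t.
  have cd := @is_derive1_comp _ cos (fun u => 2 * pi * u * x) t _ _
    (is_derive_cos _) (is_derive_lin x t).
  rewrite (_ : (fun u => cos (2 * pi * u * x) * f u) =
     (cos \o (fun u => 2 * pi * u * x)) * f) //.
  by apply: is_derive_eq; rewrite /GRing.scale /=; ring.
have d2 (t : R) : is_derive t 1 (fun u => sin (2 * pi * u * x) * f u)
   (sin (2 * pi * t * x) * derive1 f t + 2 * pi * x * (cos (2 * pi * t * x) * f t)).
  have fd := smooth_is_derive sf t.
  have cd := @is_derive1_comp _ sin (fun u => 2 * pi * u * x) t _ _
    (is_derive_sin _) (is_derive_lin x t).
  rewrite (_ : (fun u => sin (2 * pi * u * x) * f u) =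
     (sin \o (fun u => 2 * pi * u * x)) * f) //.
  by apply: is_derive_eq; rewrite /GRing.scale /=; ring.
have ic := integrable_cosM x cf af; have iss := integrable_sinM x cf af.
have ic' := integrable_cosM x cf' af'; have iss' := integrable_sinM x cf' af'.
split.
- apply/eqP; rewrite -subr_eq0 -RintegralZl// -RintegralB//; last first.
    by have := integrableZl (@measurableT _ _) (2 * pi * x) iss.
  apply/eqP; apply: (integral_derive0 d1); last exact: csuppM af.
  move=> t; apply: cvgB; first exact: continuous_cosM.
  by apply: cvgM; [exact: cvg_cst|exact: continuous_sinM].
- apply/eqP; rewrite -addr_eq0 -RintegralZl// -RintegralD//; last first.
    by have := integrableZl (@measurableT _ _) (2 * pi * x) ic.
  apply/eqP; apply: (integral_derive0 d2); last exact: csuppM af.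
  move=> t; apply: cvgD; first exact: continuous_sinM.
  by apply: cvgM; [exact: cvg_cst|exact: continuous_cosM].
Qed.

Lemma ct_decay_pow (R : realType) (A : R) (n : nat) (f : R -> R) :
  smooth f -> csupp A f ->
  exists2 K : R, 0 <= K & forall x,
    `|x| ^+ n * `|ct f x| <= K /\ `|x| ^+ n * `|st f x| <= K.
Proof.
elim: n f => [|n IH] f sf af.
  have [K K0 h] := ct_bound (smooth_continuous sf) af.
  by exists K => // x; rewrite expr0 !mul1r.
have [K K0 h] := IH _ (smooth_derive1 sf) (csupp_derive1 af).
have p1 : 1 <= 2 * pi :> R by have := pi_ge2 R; lra.
exists K => // x; have [hc hs] := h x; have [ec es] := ct_derive1 x sf af.
rewrite !exprSr -!mulrA; split.
  apply: le_trans hs; rewrite ler_wpM2l ?exprn_ge0// es normrN !normrM.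
  by rewrite ler_wpM2r// ler_peMl// -normrM ger0_norm//; lra.
apply: le_trans hc; rewrite ler_wpM2l ?exprn_ge0// ec !normrM.
by rewrite ler_wpM2r// ler_peMl// -normrM ger0_norm//; lra.
Qed.

(** The square of [wgt] leaves one factor to spare: one factor makes integrals
and sums converge, the other one makes their tails small. *)
Lemma ct_decay (R : realType) (A : R) (f : R -> R) :
  smooth f -> csupp A f ->
  exists2 K : R, 0 <= K & forall x,
    `|ct f x| <= K * wgt x ^+ 2 /\ `|st f x| <= K * wgt x ^+ 2.
Proof.
move=> sf af.
have [K0 K00 h0] := ct_decay_pow 0 sf af.
have [K2 K20 h2] := ct_decay_pow 2 sf af.
have [K4 K40 h4] := ct_decay_pow 4 sf af.
exists (K0 + 2 * K2 + K4); first by rewrite !addr_ge0 ?mulr_ge0.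
move=> x; rewrite /wgt exprVn.
have p0 : 0 < (1 + x ^+ 2) ^+ 2 by rewrite exprn_gt0// ltr_pwDl ?sqr_ge0.
have e2 : `|x| ^+ 2 = x ^+ 2 by rewrite real_normK ?num_real.
have e4 : `|x| ^+ 4 = x ^+ 4 by rewrite -[4%N]/(2 * 2)%N !exprM e2.
have := h0 x; have := h2 x; have := h4 x; rewrite e2 e4 expr0.
move=> [a4 b4] [a2 b2] [a0 b0].
have ex : (1 + x ^+ 2) ^+ 2 = 1 + 2 * x ^+ 2 + x ^+ 4 by ring.
by split; rewrite ler_pdivlMr// ex; lra.
Qed.

(** * Complex-valued functions *)

Lemma complex_ext (R : realType) (x y : R[i]) :
  Re x = Re y -> Im x = Im y -> x = y.
Proof. by case: x => a b; case: y => c d /= -> ->. Qed.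

Lemma ReM (R : realType) (x y : R[i]) : Re (x * y) = Re x * Re y - Im x * Im y.
Proof. by case: x => a b; case: y => c d. Qed.

Lemma ImM (R : realType) (x y : R[i]) : Im (x * y) = Re x * Im y + Im x * Re y.
Proof. by case: x => a b; case: y => c d. Qed.

Lemma ReD (R : realType) (x y : R[i]) : Re (x + y) = Re x + Re y.
Proof. by case: x => a b; case: y => c d. Qed.

Lemma ImD (R : realType) (x y : R[i]) : Im (x + y) = Im x + Im y.
Proof. by case: x => a b; case: y => c d. Qed.

Lemma ReN (R : realType) (x : R[i]) : Re (- x) = - Re x.
Proof. by case: x. Qed.

Lemma ImN (R : realType) (x : R[i]) : Im (- x) = - Im x.
Proof. by case: x. Qed.

Lemma normcE (R : realType) (x : R[i]) :
  normc x = Num.sqrt (Re x ^+ 2 + Im x ^+ 2).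
Proof. by case: x. Qed.

Lemma Re_le_normc (R : realType) (x : R[i]) : `|Re x| <= normc x.
Proof.
by rewrite normcE -sqrtr_sqr ler_wsqrtr// lerDl sqr_ge0.
Qed.

Lemma Im_le_normc (R : realType) (x : R[i]) : `|Im x| <= normc x.
Proof.
by rewrite normcE -sqrtr_sqr ler_wsqrtr// lerDr sqr_ge0.
Qed.

Lemma normc_le (R : realType) (x : R[i]) : normc x <= `|Re x| + `|Im x|.
Proof.
rewrite normcE -[leRHS]ger0_norm ?addr_ge0// -sqrtr_sqr ler_wsqrtr// sqrrD.
rewrite !real_normK ?num_real// lerD2r lerDl mulrn_wge0// mulr_ge0//.
Qed.

Lemma normc_ge0 (R : realType) (x : R[i]) : 0 <= normc x.
Proof. exact: le_trans (Re_le_normc x). Qed.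

(** Continuity comes with the bound since integrals need both.  Two majorants are
used: constants, and [wgt ^ 2], for which products with bounded functions are
integrable and have summable periodizations. *)
Definition dominated (R : realType) (m : R -> R) (f : R -> R[i]) :=
  [/\ continuous (fun t => Re (f t)), continuous (fun t => Im (f t)) &
      exists2 K : R, 0 <= K &
        forall t, `|Re (f t)| <= K * m t /\ `|Im (f t)| <= K * m t].

Local Notation bdd := (dominated (fun=> 1)).
Local Notation decay := (dominated (fun t => wgt t ^+ 2)).

Lemma dominatedD (R : realType) (m : R -> R) (f g : R -> R[i]) :
  dominated m f -> dominated m g -> dominated m (fun t => f t + g t).
Proof.
move=> [f1 f2 [K K0 hK]] [g1 g2 [L L0 hL]]; split.
- under eq_fun do rewrite ReD; by move=> t; apply: cvgD; [exact: f1|exact: g1].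
- under eq_fun do rewrite ImD; by move=> t; apply: cvgD; [exact: f2|exact: g2].
- exists (K + L); first exact: addr_ge0.
  move=> t; have [k1 k2] := hK t; have [l1 l2] := hL t.
  by rewrite ReD ImD !mulrDl; split; rewrite (le_trans (ler_normD _ _))// lerD.
Qed.

Lemma dominatedM (R : realType) (m n : R -> R) (f g : R -> R[i]) :
  dominated m f -> dominated n g -> dominated (fun t => m t * n t) (fun t => f t * g t).
Proof.
move=> [f1 f2 [K K0 hK]] [g1 g2 [L L0 hL]]; split.
- under eq_fun do rewrite ReM; move=> t; apply: cvgB; apply: cvgM;
    by [exact: f1|exact: g1|exact: f2|exact: g2].
- under eq_fun do rewrite ImM; move=> t; apply: cvgD; apply: cvgM;
    by [exact: f1|exact: g1|exact: f2|exact: g2].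
- exists (K * L * 2); first by rewrite !mulr_ge0.
  move=> t; have [k1 k2] := hK t; have [l1 l2] := hL t.
  rewrite (_ : K * L * 2 * (m t * n t) =
    K * m t * (L * n t) + K * m t * (L * n t)); last by ring.
  rewrite ReM ImM; split.
    by rewrite (le_trans (ler_normB _ _))// !normrM lerD// ler_pM.
  by rewrite (le_trans (ler_normD _ _))// !normrM lerD// ler_pM.
Qed.

Lemma bdd_decay (R : realType) (f g : R -> R[i]) :
  bdd f -> decay g -> decay (fun t => f t * g t).
Proof.
move=> bf dg; have := dominatedM bf dg.
by under [X in dominated X]eq_fun do rewrite mul1r.
Qed.

Lemma bddM (R : realType) (f g : R -> R[i]) :
  bdd f -> bdd g -> bdd (fun t => f t * g t).
Proof.
move=> bf dg; have := dominatedM bf dg.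
by under [X in dominated X]eq_fun do rewrite mul1r.
Qed.

Lemma bdd_cst (R : realType) (c : R[i]) : bdd (fun=> c).
Proof.
split; [by move=> t; exact: cvg_cst|by move=> t; exact: cvg_cst|].
exists (`|Re c| + `|Im c|); first by rewrite addr_ge0.
by move=> t; rewrite mulr1; split; rewrite ?lerDl ?lerDr.
Qed.

Lemma bdd_expi (R : realType) (a b : R) : bdd (fun t => expi (a * t + b)).
Proof.
have ca : continuous (fun t => a * t + b).
  move=> t; apply: cvgD; last exact: cvg_cst.
  by apply: cvgM; [exact: cvg_cst|exact: cvg_id].
split.
- by move=> t /=; apply: continuous_comp; [exact: ca|exact: continuous_cos].
- by move=> t /=; apply: continuous_comp; [exact: ca|exact: continuous_sin].
- by exists 1 => // t; rewrite mulr1; split; [exact: cos_max|exact: sin_max].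
Qed.

Lemma decay_integrable (R : realType) (F : R -> R[i]) : decay F ->
  itg (fun t => Re (F t)) /\ itg (fun t => Im (F t)).
Proof.
move=> [c1 c2 [K K0 hK]].
have hw t : K * wgt t ^+ 2 <= K * wgt t.
  by rewrite ler_wpM2l// expr2 ler_piMl ?wgt_ge0 ?wgt_le1.
by split; apply: (@integrable_decay _ _ K) => // t; have [k1 k2] := hK t;
  apply: (le_trans _ (hw t)).
Qed.

Lemma cintegralD (R : realType) (F G : R -> R[i]) : decay F -> decay G ->
  cintegral (fun t => F t + G t) = cintegral F + cintegral G.
Proof.
move=> /decay_integrable[f1 f2] /decay_integrable[g1 g2].
rewrite /cintegral; apply: complex_ext; rewrite ?ReD ?ImD /=.
  by under eq_Rintegral do rewrite ReD; rewrite RintegralD.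
by under eq_Rintegral do rewrite ImD; rewrite RintegralD.
Qed.

Lemma cintegralZ (R : realType) (c : R[i]) (F : R -> R[i]) : decay F ->
  cintegral (fun t => c * F t) = c * cintegral F.
Proof.
move=> /decay_integrable[f1 f2].
have z1 r : itg (fun t => r * Re (F t)) by have := integrableZl (@measurableT _ _) r f1.
have z2 r : itg (fun t => r * Im (F t)) by have := integrableZl (@measurableT _ _) r f2.
rewrite /cintegral; apply: complex_ext; rewrite ?ReM ?ImM /=.
  under eq_Rintegral do rewrite ReM.
  by rewrite RintegralB// !RintegralZl.
under eq_Rintegral do rewrite ImM.
by rewrite RintegralD// !RintegralZl.
Qed.

Lemma cintegral_translate (R : realType) (F : R -> R[i]) (c : R) : decay F ->
  cintegral (fun t => F (t + c)) = cintegral F.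
Proof.
move=> /decay_integrable[f1 f2]; rewrite /cintegral; congr Complex.
  exact: (@Rintegral_translate _ (fun t => Re (F t))).
exact: (@Rintegral_translate _ (fun t => Im (F t))).
Qed.

(** Together with [supp_in], a description of test functions that is checked
pointwise, without closures or compactness. *)
Definition csmooth (R : realType) (psi : R -> R[i]) :=
  smooth (fun t => Re (psi t)) /\ smooth (fun t => Im (psi t)).

Definition supp_in (R : realType) (c d : R) (psi : R -> R[i]) :=
  forall t, psi t != 0 -> c <= t <= d.

Lemma supp_in_closed_support (R : realType) (c d : R) (psi : R -> R[i]) :
  supp_in c d psi -> closed_support psi `<=` `[c, d].
Proof.
move=> sp; rewrite /closed_support.
have -> : `[c, d]%classic = closure `[c, d]%classic :> set R.
  by apply/closure_id; exact: interval_closed.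
by apply: closure_subset => t /sp; rewrite /= in_itv.
Qed.

Lemma supp_in_test (R : realType) (c d : R) (psi : R -> R[i]) :
  csmooth psi -> supp_in c d psi -> test_function psi.
Proof.
move=> [s1 s2] sp; split; [exact: s1|exact: s2|].
apply: (@subclosed_compact _ _ `[c, d]%classic).
- exact: closed_closure.
- exact: segment_compact.
- exact: supp_in_closed_support.
Qed.

Lemma test_supp_in (R : realType) (psi : R -> R[i]) : test_function psi ->
  exists A : R, supp_in (- A) A psi.
Proof.
move=> [_ _ /compact_bounded [M [_ hM]]]; exists (M + 1) => t pt.
rewrite -ler_norml; apply: hM; first by rewrite ltrDl.
exact: subset_closure.
Qed.

Lemma supp_in_csupp (R : realType) (A : R) (psi : R -> R[i]) :
  supp_in (- A) A psi ->
  csupp A (fun t => Re (psi t)) /\ csupp A (fun t => Im (psi t)).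
Proof.
move=> sp; suff h t : A < `|t| -> psi t = 0 by split=> t /h ->.
move=> tA; apply/eqP/negPn/negP => /sp; rewrite -ler_norml.
by rewrite leNgt tA.
Qed.

Lemma supp_in_widen (R : realType) (c d : R) (psi : R -> R[i]) :
  supp_in c d psi -> exists A : R, supp_in (- A) A psi.
Proof.
move=> sp; exists (`|c| + `|d|) => t /sp /andP[ct td].
have := ler_norm d; have := ler_norm (- c); rewrite normrN => hc hd.
have := normr_ge0 c; have := normr_ge0 d; lra.
Qed.

Lemma continuous_ct (R : realType) (A : R) (f : R -> R) :
  continuous f -> csupp A f -> continuous (ct f) /\ continuous (st f).
Proof.
move=> cf sf; have itf := integrable_csupp cf sf.
have ff : itg (fun t => `|f t|) by exact: integrable_norm itf.
split=> x.
  apply: (@continuity_under_integral R _ _ mu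
      (fun x t => cos (2 * pi * t * x) * f t) setT measurableT (x - 1) (x + 1)
      _ _ (fun t => `|f t|) ff) => //.
  - by move=> y _; exact: integrable_cosM sf.
  - apply: aeW => t _ y _; apply: cvgM; last exact: cvg_cst.
    apply: continuous_comp; last exact: continuous_cos.
    by apply: cvgM; [exact: cvg_cst|exact: cvg_id].
  - by move=> y _; apply: aeW => t _; rewrite normrM ler_piMl// cos_max.
  - by rewrite inE /= in_itv /=; apply/andP; split; lra.
apply: (@continuity_under_integral R _ _ mu
    (fun x t => sin (2 * pi * t * x) * f t) setT measurableT (x - 1) (x + 1)
    _ _ (fun t => `|f t|) ff) => //.
- by move=> y _; exact: integrable_sinM sf.
- apply: aeW => t _ y _; apply: cvgM; last exact: cvg_cst.
  apply: continuous_comp; last exact: continuous_sin.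
  by apply: cvgM; [exact: cvg_cst|exact: cvg_id].
- by move=> y _; apply: aeW => t _; rewrite normrM ler_piMl// sin_max.
- by rewrite inE /= in_itv /=; apply/andP; split; lra.
Qed.

Lemma fourierE (R : realType) (A : R) (psi : R -> R[i]) (x : R) :
  csmooth psi -> supp_in (- A) A psi ->
  fourier psi x =
    Complex (ct (fun t => Re (psi t)) x + st (fun t => Im (psi t)) x)
            (ct (fun t => Im (psi t)) x - st (fun t => Re (psi t)) x).
Proof.
move=> [/smooth_continuous c1 /smooth_continuous c2] /supp_in_csupp[s1 s2].
rewrite /fourier /cintegral /ct /st; congr Complex.
  rewrite -RintegralD//; [|exact: integrable_cosM s1|exact: integrable_sinM s2].
  by apply: eq_Rintegral => t _; rewrite ReM /= cosN sinN mulNr opprK.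
rewrite -RintegralB//; [|exact: integrable_cosM s2|exact: integrable_sinM s1].
by apply: eq_Rintegral => t _; rewrite ImM /= cosN sinN mulNr.
Qed.

Lemma decay_fourier (R : realType) (A : R) (psi : R -> R[i]) :
  csmooth psi -> supp_in (- A) A psi -> decay (fourier psi).
Proof.
move=> ps sp; rewrite (_ : fourier psi = fun x =>
    Complex (ct (fun t => Re (psi t)) x + st (fun t => Im (psi t)) x)
            (ct (fun t => Im (psi t)) x - st (fun t => Re (psi t)) x)); last first.
  by apply/funext => x; exact: fourierE ps sp.
move: ps sp => [s1 s2] /supp_in_csupp[a1 a2].
have [c1 c1'] := continuous_ct (smooth_continuous s1) a1.
have [c2 c2'] := continuous_ct (smooth_continuous s2) a2.
have [K K0 hK] := ct_decay s1 a1; have [L L0 hL] := ct_decay s2 a2.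
split => /=.
- by move=> x; apply: cvgD; [exact: c1|exact: c2'].
- by move=> x; apply: cvgB; [exact: c2|exact: c1'].
- exists (K + L); first exact: addr_ge0.
  move=> t; rewrite mulrDl; have [k1 k2] := hK t; have [l1 l2] := hL t; split.
    by rewrite (le_trans (ler_normD _ _))// lerD.
  by rewrite (le_trans (ler_normB _ _))// addrC lerD.
Qed.

Lemma fourierD (R : realType) (A : R) (psi1 psi2 : R -> R[i]) (x : R) :
  csmooth psi1 -> csmooth psi2 -> supp_in (- A) A psi1 -> supp_in (- A) A psi2 ->
  fourier (fun t => psi1 t + psi2 t) x = fourier psi1 x + fourier psi2 x.
Proof.
move=> [/smooth_continuous c1 /smooth_continuous c2]
  [/smooth_continuous c3 /smooth_continuous c4]
  /supp_in_csupp[s1 s2] /supp_in_csupp[s3 s4].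
have h (f : R -> R[i]) : continuous (fun t => Re (f t)) ->
    continuous (fun t => Im (f t)) -> csupp A (fun t => Re (f t)) ->
    csupp A (fun t => Im (f t)) ->
    itg (fun t => Re (expi (- (2 * pi * t * x)) * f t)) /\
    itg (fun t => Im (expi (- (2 * pi * t * x)) * f t)).
  move=> d1 d2 e1 e2; split.
    under eq_fun do rewrite ReM /= cosN sinN mulNr opprK.
    by have := integrableD (@measurableT _ _) (integrable_cosM x d1 e1) (integrable_sinM x d2 e2).
  under eq_fun do rewrite ImM /= cosN sinN mulNr.
  by have := integrableB (@measurableT _ _) (integrable_cosM x d2 e2) (integrable_sinM x d1 e1).
have [i1 i2] := h _ c1 c2 s1 s2; have [j1 j2] := h _ c3 c4 s3 s4.
rewrite /fourier /cintegral; apply: complex_ext; rewrite ?ReD ?ImD /=.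
  by under eq_Rintegral do rewrite mulrDr ReD; rewrite RintegralD.
by under eq_Rintegral do rewrite mulrDr ImD; rewrite RintegralD.
Qed.

Lemma fourier_distrD (R : realType) (A : R) (phi psi1 psi2 : R -> R[i]) :
  bdd phi ->
  csmooth psi1 -> csmooth psi2 -> supp_in (- A) A psi1 -> supp_in (- A) A psi2 ->
  fourier_distr phi (fun t => psi1 t + psi2 t) =
  fourier_distr phi psi1 + fourier_distr phi psi2.
Proof.
move=> bphi p1 p2 s1 s2; rewrite /fourier_distr -cintegralD.
- by congr cintegral; apply/funext => t; rewrite (fourierD _ p1 p2 s1 s2) mulrDr.
- exact: bdd_decay bphi (decay_fourier p1 s1).
- exact: bdd_decay bphi (decay_fourier p2 s2).
Qed.

(** * Supports of Fourier transforms *)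

Definition rscale (R : realType) (r : R) (z : R[i]) : R[i] :=
  Complex (r * Re z) (r * Im z).

Lemma csmooth_rscale (R : realType) (chi : R -> R) (psi : R -> R[i]) :
  smooth chi -> csmooth psi -> csmooth (fun t => rscale (chi t) (psi t)).
Proof. by move=> sc [s1 s2]; split; apply: smoothM. Qed.

Lemma rscale_neq0 (R : realType) (r : R) (z : R[i]) :
  rscale r z != 0 -> r != 0 /\ z != 0.
Proof.
move=> h; split; apply: contra h => /eqP ->.
  by apply/eqP/complex_ext; rewrite /= mul0r.
by apply/eqP/complex_ext; rewrite /= mulr0.
Qed.

Definition cutoff (R : realType) (p q t : R) : R :=
  step (2 / (q - p) * t + - ((p + q) / (q - p))).

Lemma cutoff_le (R : realType) (p q t : R) : p < q -> t <= p -> cutoff p q t = 0.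
Proof.
move=> pq tp; apply: step_le; rewrite -mulrAC -mulrBl ler_pdivrMr ?subr_gt0//.
lra.
Qed.

Lemma cutoff_ge (R : realType) (p q t : R) : p < q -> q <= t -> cutoff p q t = 1.
Proof.
move=> pq tp; apply: step_ge; rewrite -mulrAC -mulrBl ler_pdivlMr ?subr_gt0//.
lra.
Qed.

Lemma fourier_distr0 (R : realType) (phi psi : R -> R[i]) :
  (forall t, psi t = 0) -> fourier_distr phi psi = 0.
Proof.
move=> p0; have f0 x : fourier psi x = 0.
  rewrite /fourier /cintegral; apply: complex_ext => /=;
    by under eq_Rintegral do rewrite p0 mulr0; rewrite Rintegral_cst// mul0r.
rewrite /fourier_distr /cintegral; apply: complex_ext => /=;
  by under eq_Rintegral do rewrite f0 mulr0; rewrite Rintegral_cst// mul0r.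
Qed.

(** By definition a distribution vanishes near each point off its support; that it
vanishes on the whole complement needs a partition of unity.  On the line it is
enough to let the right end [x] of the supports move from [c] to [d]: at
the supremum [x0] of the good values of [x], a cutoff splits a test function
into one supported on the left of a good value and one supported near [x0]. *)
Lemma fourier_distr_off (R : realType) (phi : R -> R[i]) (a b c d : R) :
  bdd phi -> distr_support (fourier_distr phi) `<=` `[a, b] ->
  d < a \/ b < c ->
  forall psi, csmooth psi -> supp_in c d psi -> fourier_distr phi psi = 0.
Proof.
move=> bphi sphi cdab; pose P x := forall psi, csmooth psi ->
  supp_in c x psi -> fourier_distr phi psi = 0.
case: (ltP d c) => [dc psi ps sp|cd].
  apply: fourier_distr0 => t; apply/eqP/negPn/negP => /sp /andP[ct td].
  by have := lt_le_trans (le_lt_trans td dc) ct; rewrite ltxx.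
pose S := [set x | x <= d /\ P x].
have Slow x : x < c -> S x.
  move=> xc; split; first by lra.
  move=> psi ps sp; apply: fourier_distr0 => t; apply/eqP/negPn/negP.
  by move=> /sp; lra.
have S0 : S !=set0 by exists (c - 1); apply: Slow; lra.
have Sd : ubound S d by move=> x [].
have supS : has_sup S by split => //; exists d.
set x0 := sup S.
have x0d : x0 <= d by exact: sup_le_ub.
have x0c : c <= x0.
  rewrite leNgt; apply/negP => x0c.
  have : (x0 + c) / 2 <= x0 by apply: (ub_le_sup (proj2 supS)); apply: Slow; lra.
  by lra.
have [U [oU vU] Ux0] : exists2 U, open U /\ distr_vanishes_on (fourier_distr phi) U & U x0.
  apply: contrapT => nU; have : distr_support (fourier_distr phi) x0.
    by move=> [U [oU vU] Ux]; apply: nU; exists U.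
  by move=> /sphi; rewrite /= in_itv /=; lra.
have [r /= r0 hr] : exists2 r : R, 0 < r & forall y, `|x0 - y| < r -> U y.
  have /nbhs_ballP[r /= r0 hr] := open_nbhs_nbhs (conj oU Ux0).
  by exists r => // y; exact: hr.
have [x [xd Px] xx0] : exists2 x, S x & x0 - r / 2 < x.
  by have [x Sx xh] := sup_adherent (divr_gt0 r0 (ltr0n _ 2)) supS; exists x.
pose y := Num.min (x0 + r / 2) d.
have Sy : S y.
  split; first by rewrite ge_min lexx orbT.
  move=> psi ps sp.
  pose chi := cutoff (x0 - r * 3 / 4) (x0 - r / 2).
  have schi : smooth chi by apply: smooth_affine; exact: smooth_step.
  have schi' : smooth (fun t => 1 - chi t) by exact: smoothB (@smooth_cst R 1) schi.
  have pq : x0 - r * 3 / 4 < x0 - r / 2 by lra.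
  have -> : psi = fun t => rscale (1 - chi t) (psi t) + rscale (chi t) (psi t).
    by apply/funext => t; apply: complex_ext; rewrite ?ReD ?ImD /=; ring.
  have sp1 : supp_in c x (fun t => rscale (1 - chi t) (psi t)).
    move=> t /rscale_neq0[ct /sp /andP[-> _]] /=.
    rewrite leNgt; apply: contra ct => xt.
    by rewrite /chi cutoff_ge ?subrr//; lra.
  have sp2 : supp_in (x0 - r * 3 / 4) (x0 + r / 2) (fun t => rscale (chi t) (psi t)).
    move=> t /rscale_neq0[ct /sp /andP[_ ty]].
    have -> : t <= x0 + r / 2 by apply: (le_trans ty); rewrite ge_min lexx.
    rewrite andbT leNgt; apply: contra ct => xt.
    by rewrite /chi cutoff_le//; lra.
  have [A1 sA1] := supp_in_widen sp1; have [A2 sA2] := supp_in_widen sp2.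
  have cs1 := csmooth_rscale schi' ps; have cs2 := csmooth_rscale schi ps.
  have sA B f A : supp_in (- A) A f -> A <= B -> supp_in (- B) B f.
    by move=> h AB t /h; lra.
  rewrite (@fourier_distrD _ (Num.max A1 A2))//; last 2 first.
  - by apply: sA sA1 _; rewrite le_max lexx.
  - by apply: sA sA2 _; rewrite le_max lexx orbT.
  rewrite (Px _ cs1 sp1) add0r.
  apply: vU; first exact: supp_in_test sp2.
  move=> t /(supp_in_closed_support sp2); rewrite /= in_itv /= => tt.
  by apply: hr; rewrite ltr_norml; lra.
have : y <= x0 by exact: (ub_le_sup (proj2 supS)).
rewrite /y ge_min => /orP[|dx0]; first by lra.
move: Sy => [_]; rewrite /y /Num.min ifF; first exact.
by apply/negbTE; rewrite -leNgt; lra.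
Qed.

(** * The Fejer kernel *)

Lemma cos_pi_even (R : realType) (n : nat) : cos (2 * pi * n%:R) = 1 :> R.
Proof.
have := periodicn (@cosD2pi R) n 0.
by rewrite add0r cos0 => e; rewrite -[RHS]e; congr cos; rewrite -(mulr_natr _ n) -(mulr_natl pi 2); ring.
Qed.

Lemma sin_pi_even (R : realType) (n : nat) : sin (2 * pi * n%:R) = 0 :> R.
Proof.
have := periodicn (@sinD2pi R) n 0.
by rewrite add0r sin0 => e; rewrite -[RHS]e; congr sin; rewrite -(mulr_natr _ n) -(mulr_natl pi 2); ring.
Qed.

(** The squared modulus of the sum of [exp (i k x)] over [k < N], which is [N] times
the Fejer kernel of order [N]. *)
Definition fejer (R : realType) (N : nat) (x : R) : R :=
  (\sum_(k < N) cos (k%:R * x)) ^+ 2 + (\sum_(k < N) sin (k%:R * x)) ^+ 2.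

Lemma fejer_ge0 (R : realType) (N : nat) (x : R) : 0 <= fejer N x.
Proof. by rewrite addr_ge0 ?sqr_ge0. Qed.

(** The real form of [`|1 - e^ix|^2 `|sum_(k < N) e^ikx|^2 = `|1 - e^iNx|^2] *)
Lemma fejer_closed (R : realType) (N : nat) (x : R) :
  (2 - 2 * cos x) * fejer N x = 2 - 2 * cos (N%:R * x).
Proof.
rewrite /fejer; set P := \sum_(k < N) cos _; set Q := \sum_(k < N) sin _.
have [h1 h2] : P * (1 - cos x) + Q * sin x = 1 - cos (N%:R * x) /\
    Q * (1 - cos x) - P * sin x = - sin (N%:R * x).
  rewrite {}/P {}/Q; elim: N => [|N [IH1 IH2]].
    by rewrite !big_ord0 mulr0n !mul0r cos0 sin0; split; ring.
  rewrite !big_ord_recr /= -(natr1 N) (mulrDl _ 1) mul1r cosD sinD.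
  split.
    apply: (@eq_trans _ _ ((1 - cos (N%:R * x)) +
      (cos (N%:R * x) * (1 - cos x) + sin (N%:R * x) * sin x))); last by ring.
    by rewrite -IH1; ring.
  apply: (@eq_trans _ _ (- sin (N%:R * x) +
      (sin (N%:R * x) * (1 - cos x) - cos (N%:R * x) * sin x))); last by ring.
  by rewrite -IH2; ring.
have c1 := cos2Dsin2 x; have c2 := cos2Dsin2 (N%:R * x).
have -> : 2 - 2 * cos (N%:R * x) = (1 - cos (N%:R * x)) ^+ 2 + (- sin (N%:R * x)) ^+ 2.
  have -> : (- sin (N%:R * x)) ^+ 2 = 1 - cos (N%:R * x) ^+ 2 by rewrite sqrrN; lra.
  by ring.
rewrite -h1 -h2.
have -> : 2 - 2 * cos x = (1 - cos x) ^+ 2 + (sin x) ^+ 2.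
  have -> : sin x ^+ 2 = 1 - cos x ^+ 2 by lra.
  by ring.
by ring.
Qed.

Lemma fejerE (R : realType) (N : nat) (x : R) :
  fejer N x = \sum_(k < N) \sum_(l < N) cos (`|k%:Z - l%:Z|%N%:R * x).
Proof.
rewrite /fejer !expr2 !big_distrlr -big_split /=; apply: eq_bigr => k _.
rewrite -big_split /=; apply: eq_bigr => l _.
have e : `|k%:R - l%:R| = `|k%:Z - l%:Z|%N%:R :> R.
  by rewrite natr_absz intr_norm rmorphB.
by rewrite -cosB -mulrBl -[LHS]cos_norm -[RHS]cos_norm !normrM normr_nat e.
Qed.

Lemma Rintegral_sum (R : realType) (D : set R) (n : nat) (f : 'I_n -> R -> R) :
  measurable D -> (forall i, mu.-integrable D (EFin \o f i)) ->
  mu.-integrable D (EFin \o (fun x => \sum_(i < n) f i x)) /\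
  \int[mu]_(x in D) (\sum_(i < n) f i x) = \sum_(i < n) \int[mu]_(x in D) f i x.
Proof.
move=> mD; elim: n f => [|n IH] f itf.
  split; last by under eq_Rintegral do rewrite big_ord0; rewrite big_ord0 Rintegral_cst// mul0r.
  under eq_fun do rewrite big_ord0.
  exact: integrable0.
have [i1 e1] := IH (fun i => f (widen_ord (leqnSn n) i)) (fun i => itf _).
split.
  under eq_fun do rewrite big_ord_recr /=.
  by have := @integrableD _ _ _ (@lebesgue_measure R) D mD _ _ i1 (itf ord_max).
under eq_Rintegral do rewrite big_ord_recr /=.
by rewrite RintegralD// e1 big_ord_recr.
Qed.

Lemma integrable_seg (R : realType) (a b : R) (f : R -> R) :
  continuous f -> mu.-integrable `[a, b] (EFin \o f).
Proof.
move=> cf; apply: continuous_compact_integrable; first exact: segment_compact.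
exact: continuous_subspaceT.
Qed.

Lemma Rintegral_seg_cat (R : realType) (a b c : R) (f : R -> R) :
  continuous f -> a <= b -> b <= c ->
  \int[mu]_(x in `[a, c]) f x = \int[mu]_(x in `[a, b]) f x + \int[mu]_(x in `[b, c]) f x.
Proof.
move=> cf ab bc; have := @Rintegral_itvB R f (BLeft a) (BRight c) b (integrable_seg a c cf).
rewrite !bnd_simp => /(_ ab bc).
rewrite Rintegral_itv_obnd_cbnd; first by move=> <-; rewrite addrC subrK.
apply: integrableS (@integrable_seg R b c f cf) => //.
by apply: subset_itvr; rewrite bnd_simp.
Qed.

Lemma Rintegral_seg_translate (R : realType) (a b c : R) (f : R -> R) :
  continuous f ->
  \int[mu]_(x in `[a + c, b + c]) f x = \int[mu]_(x in `[a, b]) f (x + c).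
Proof.
move=> cf; rewrite Rintegral_mkcond -(@Rintegral_translate _ _ c); last first.
  rewrite -restrict_EFin; apply/integrable_restrict => //=.
  by rewrite setTI; exact: integrable_seg.
rewrite [RHS]Rintegral_mkcond; apply: eq_Rintegral => x _; rewrite !patchE.
by rewrite !mem_setE !in_itv /= !lerD2r.
Qed.

Lemma sin_pi_nat (R : realType) (n : nat) : sin (n%:R * pi) = 0 :> R.
Proof.
have := alternatingn (@sinDpi R) n 0.
by rewrite add0r sin0 mulr0 mulr_natl.
Qed.

Lemma continuous_cosn (R : realType) (a b : R) :
  continuous (fun x => cos (a * (b * x))).
Proof.
move=> x; apply: continuous_comp; last exact: continuous_cos.
by apply: cvgM; [exact: cvg_cst|apply: cvgM; [exact: cvg_cst|exact: cvg_id]].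
Qed.

Lemma continuous_fejer (R : realType) (N : nat) (b : R) :
  continuous (fun x => fejer N (b * x)).
Proof.
under eq_fun do rewrite fejerE.
move=> x; apply: cvg_big; [exact: add_continuous|move=> k _].
apply: cvg_big; [exact: add_continuous|move=> l _].
exact: continuous_cosn.
Qed.

Lemma fejer_le (R : realType) (N : nat) (x : R) : fejer N x <= 2 * N%:R ^+ 2.
Proof.
have h (f : R -> R) : (forall y, `|f y| <= 1) ->
    (\sum_(k < N) f (k%:R * x)) ^+ 2 <= N%:R ^+ 2.
  move=> f1; rewrite -[leLHS]real_normK ?num_real// lerXn2r ?nnegrE//.
  rewrite (le_trans (ler_norm_sum _ _ _))//.
  have -> : N%:R = \sum_(k < N) 1 :> R by rewrite sumr_const card_ord.
  by apply: ler_sum.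
rewrite /fejer mulr_natl mulr2n lerD//; apply: h => y.
  exact: cos_max.
exact: sin_max.
Qed.

Lemma integral_cosn (R : realType) (h : R) (j : nat) : 0 < h -> (0 < j)%N ->
  \int[mu]_(x in `[- (h / 2), h / 2]) cos (j%:R * (2 * pi / h * x)) = 0.
Proof.
move=> h0 j0; pose a : R := j%:R * (2 * pi / h).
have a0 : a != 0.
  by rewrite /a mulf_neq0 ?pnatr_eq0 -?lt0n// mulf_neq0 ?invr_neq0 ?gt_eqF// mulr_gt0// pi_gt0.
have Fd (x : R) : is_derive x 1 (fun x => a^-1 * sin (a * x + 0)) (cos (j%:R * (2 * pi / h * x))).
  have sd := @is_derive1_comp _ sin (fun u => a * u + 0) x _ _
    (is_derive_sin _) (is_derive_affine a 0 x).
  rewrite (_ : (fun x => _) = cst a^-1 * (sin \o (fun u => a * u + 0))) //.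
  rewrite (_ : j%:R * (2 * pi / h * x) = a * x + 0); last by rewrite /a addr0 mulrA.
  apply: is_derive_eq; rewrite /GRing.scale /=.
  by move: (cos _) (sin _) => u v; rewrite mulr0 addr0 mulrCA mulVf ?mulr1.
have cF : continuous (fun x => a^-1 * sin (a * x + 0)).
  by move=> x; apply/differentiable_continuous/derivable1_diffP; have [] := Fd x.
rewrite /Rintegral (@continuous_FTC2 _ _ (fun x => a^-1 * sin (a * x + 0))).
- rewrite !addr0 mulrN sinN (_ : a * (h / 2) = j%:R * pi); last first.
    by rewrite /a; field; rewrite gt_eqF.
  by rewrite sin_pi_nat oppr0 mulr0 -EFinB subrr.
- by lra.
- exact/continuous_subspaceT/continuous_cosn.
- split; [by move=> t _; have [] := Fd t|apply: cvg_at_right_filter; exact: cF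
         |apply: cvg_at_left_filter; exact: cF].
- by move=> t _; rewrite (is_derive_derive1 Fd).
Qed.

Lemma integral_fejer (R : realType) (h : R) (N : nat) : 0 < h ->
  \int[mu]_(x in `[- (h / 2), h / 2]) fejer N (2 * pi / h * x) = N%:R * h.
Proof.
move=> h0; under eq_Rintegral do rewrite fejerE.
have ic (n : nat) : mu.-integrable `[- (h / 2), h / 2]
   (EFin \o (fun x => cos (n%:R * (2 * pi / h * x)))).
  exact/integrable_seg/continuous_cosn.
have h1 k := Rintegral_sum (f := fun (l : 'I_N) x =>
    cos (`|k%:Z - l%:Z|%N%:R * (2 * pi / h * x))) (measurable_itv `[- (h / 2), h / 2]) (fun l => ic _).
have [_ ->] := Rintegral_sum (f := fun (k : 'I_N) x => \sum_(l < N)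
    cos (`|k%:Z - l%:Z|%N%:R * (2 * pi / h * x))) (measurable_itv `[- (h / 2), h / 2])
    (fun k => (h1 k).1).
rewrite (eq_bigr (fun=> h)); first by rewrite sumr_const card_ord mulr_natl.
move=> k _; have [_ ->] := h1 k.
rewrite (bigD1 k) //= subrr absz0 big1 => [|l lk].
  under eq_Rintegral do rewrite mul0r cos0.
  rewrite Rintegral_cst//= lebesgue_measure_itv/= lte_fin ifT; last by lra.
  by rewrite -EFinB /= mul1r addr0; lra.
apply: integral_cosn => //; rewrite absz_gt0 subr_eq0.
by apply: contra lk => /eqP [] /val_inj ->.
Qed.

Lemma integral_fejerM (R : realType) (H : R -> R) (C w : R) (N : nat) :
  continuous H -> (forall x, `|H x| <= C * wgt x) ->
  (forall j : nat, (0 < j)%N -> \int[mu]_x (H x * cos (j%:R * (w * x))) = 0) ->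
  \int[mu]_x (H x * fejer N (w * x)) = N%:R * \int[mu]_x H x.
Proof.
move=> cH hH H0; under eq_Rintegral do rewrite fejerE big_distrr.
have ic (n : nat) : itg (fun x => H x * cos (n%:R * (w * x))).
  apply: (@integrable_decay _ _ C).
    by move=> x; apply: cvgM; [exact: cH|exact: continuous_cosn].
  by move=> x; rewrite normrM (le_trans _ (hH x))// ler_piMr// cos_max.
have h1 (k : nat) := Rintegral_sum (f := fun (l : 'I_N) x =>
    H x * cos (`|k%:Z - l%:Z|%N%:R * (w * x))) (@measurableT _ R) (fun l => ic _).
have h2 (k : nat) : (fun x => \sum_(l < N) H x * cos (`|k%:Z - l%:Z|%N%:R * (w * x))) =
  (fun x => H x * \sum_(l < N) cos (`|k%:Z - l%:Z|%N%:R * (w * x))).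
  by apply/funext => x; rewrite big_distrr.
have h3 (k : 'I_N) : itg (fun x => H x * \sum_(l < N) cos (`|k%:Z - l%:Z|%N%:R * (w * x))).
  by rewrite -(h2 k); exact: (h1 k).1.
have [_ ->] := Rintegral_sum (f := fun (k : 'I_N) x => H x * \sum_(l < N)
    cos (`|k%:Z - l%:Z|%N%:R * (w * x))) (@measurableT _ R) h3.
rewrite (eq_bigr (fun=> \int[mu]_x H x)); first by rewrite sumr_const card_ord mulr_natl.
move=> k _; rewrite -(h2 k); have [_ ->] := h1 k.
rewrite (bigD1 k) //= subrr absz0 big1 => [|l lk].
  by under eq_Rintegral do rewrite mul0r cos0 mulr1; rewrite addr0.
apply: H0 => //; rewrite absz_gt0 subr_eq0.
by apply: contra lk => /eqP [] /val_inj ->.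
Qed.

(** * Sums of [wgt] along arithmetic progressions *)

(** The mean value theorem for [atan], whose derivative is [wgt]; along a
progression of step [h] the right-hand sides telescope. *)
Lemma wgt_le_atan (R : realType) (h x : R) : 0 < h ->
  wgt x <= 2 * (1 + h ^+ 2) / h * (atan (x + h) - atan x).
Proof.
move=> h0.
have [||y] := @MVT_segment R atan (fun y => (1 + y ^+ 2)^-1) x (x + h) _ (fun y _ => is_derive1_atan y).
- by lra.
- exact/continuous_subspaceT/continuous_atan.
rewrite in_itv /= => /andP[xy yx] ->.
rewrite (addrC x) addrK (mulrC _^-1) mulrA divfK ?gt_eqF//.
rewrite /wgt ler_pdivlMr ?ltr_pwDl ?sqr_ge0// ler_pdivrMl ?ltr_pwDl ?sqr_ge0//.
have : y ^+ 2 <= 2 * x ^+ 2 + 2 * h ^+ 2.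
  have e : y = x + (y - x) by lra.
  set u := y - x in e; have u0 : 0 <= u by rewrite subr_ge0.
  have uh : u <= h by rewrite /u; lra.
  have h1 := sqr_ge0 (x - u).
  have h2 : u ^+ 2 <= h ^+ 2 by apply: lerXn2r; rewrite ?nnegrE //; exact: ltW.
  rewrite e (_ : (x + u) ^+ 2 = 2 * x ^+ 2 + 2 * u ^+ 2 - (x - u) ^+ 2); last by ring.
  by lra.
by have := mulr_ge0 (sqr_ge0 x) (sqr_ge0 h); lra.
Qed.

Lemma sum_wgt (R : realType) (h a : R) (n : nat) : 0 < h ->
  \sum_(i < n) wgt (a + i%:R * h) <= 2 * (1 + h ^+ 2) / h * pi.
Proof.
move=> h0; have c0 : 0 <= 2 * (1 + h ^+ 2) / h.
  by rewrite divr_ge0 ?ltW// mulr_gt0// ltr_pwDl ?sqr_ge0.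
apply: (@le_trans _ _ (2 * (1 + h ^+ 2) / h * (atan (a + n%:R * h) - atan a))).
  elim: n => [|n IH]; first by rewrite big_ord0 mul0r addr0 subrr mulr0.
  rewrite big_ord_recr /= (le_trans (lerD IH (wgt_le_atan _ h0)))//.
  rewrite -mulrDr ler_wpM2l// (_ : a + n.+1%:R * h = a + n%:R * h + h); last first.
    by rewrite -natr1; ring.
  by lra.
rewrite ler_wpM2l//.
by have := atan_ltpi2 (a + n%:R * h); have := atan_gtNpi2 a; lra.
Qed.

Lemma wgtN (R : realType) (x : R) : wgt (- x) = wgt x.
Proof. by rewrite /wgt sqrrN. Qed.

Lemma wgt_le_wgt (R : realType) (x y : R) : 0 <= y -> y <= `|x| -> wgt x <= wgt y.
Proof.
move=> y0 yx; rewrite /wgt lef_pV2 ?posrE ?ltr_pwDl ?sqr_ge0//.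
by rewrite lerD2l -[x ^+ 2]real_normK ?num_real// lerXn2r ?nnegrE.
Qed.

Lemma wgt_small (R : realType) (h D e : R) : 0 < h -> 0 <= D -> 0 < e ->
  exists K0 : nat, forall K : nat, (K0 <= K)%N -> D * wgt (K%:R * h) <= e.
Proof.
move=> h0 D0 e0; exists (Num.bound (D / (e * h))) => K K0K.
have hK : D / (e * h) < K%:R.
  have b0 : 0 <= D / (e * h) by rewrite divr_ge0// ltW// mulr_gt0.
  by have := archi_boundP b0; move=> /lt_le_trans; apply; rewrite ler_nat.
rewrite /wgt ler_pdivrMr ?ltr_pwDl ?sqr_ge0//.
move: hK; rewrite ltr_pdivrMr ?mulr_gt0// => hK.
have {}hK : D < e * (K%:R * h) by lra.
move: (K%:R * h) hK => y hK; apply: (le_trans (ltW hK)).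
rewrite ler_wpM2l//; first exact: ltW.
by have := sqr_ge0 (y - 1); have := sqr_ge0 (y + 1); rewrite !expr2; lra.
Qed.

(** * Poisson summation *)

(** Symmetric partial sums of the [h]-periodization of [H] *)
Definition psum (R : realType) (h : R) (H : R -> R) (K : nat) (x : R) : R :=
  H x + \sum_(i < K) (H (x + i.+1%:R * h) + H (x - i.+1%:R * h)).

Lemma psumS (R : realType) (h : R) (H : R -> R) (K : nat) (x : R) :
  psum h H K.+1 x = psum h H K x + (H (x + K.+1%:R * h) + H (x - K.+1%:R * h)).
Proof. by rewrite /psum big_ord_recr /= addrA. Qed.

Lemma continuous_translate (R : realType) (H : R -> R) (c : R) :
  continuous H -> continuous (fun x => H (x + c)).
Proof.
move=> cH x; apply: (@continuous_comp _ _ _ (fun x : R => x + c) H); last exact: cH.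
by apply: cvgD; [exact: cvg_id|exact: cvg_cst].
Qed.

Lemma continuous_psum (R : realType) (h : R) (H : R -> R) (K : nat) :
  continuous H -> continuous (psum h H K).
Proof.
move=> cH; elim: K => [|K IH] x.
  have -> : psum h H 0 = H by apply/funext => y; rewrite /psum big_ord0 addr0.
  exact: cH.
have -> : psum h H K.+1 = fun x =>
    psum h H K x + (H (x + K.+1%:R * h) + H (x - K.+1%:R * h)).
  by apply/funext => y; rewrite psumS.
by apply: cvgD; [exact: IH|apply: cvgD; exact: continuous_translate].
Qed.

(** Of the two factors [wgt] one is summed along the lattice and the other one is
bounded by its value at distance [K h]. *)
Lemma psum_tail (R : realType) (h C x : R) (H : R -> R) (K K' : nat) :
  0 < h -> 0 <= C -> (forall x, `|H x| <= C * wgt x ^+ 2) ->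
  `|x| <= h / 2 -> (K <= K')%N ->
  `|psum h H K' x - psum h H K x| <=
    2 * C * (2 * (1 + h ^+ 2) / h * pi) * wgt (K%:R * h).
Proof.
move=> h0 C0 hH xh KK'.
have big_arg (s : R) (i : nat) : (K <= i)%N -> `|s| <= h / 2 ->
    `|H (s + i.+1%:R * h)| <= C * wgt (K%:R * h) * wgt (s + i.+1%:R * h) /\
    `|H (s - i.+1%:R * h)| <= C * wgt (K%:R * h) * wgt (- s + i.+1%:R * h).
  move=> Ki sh.
  have hi : K%:R * h <= i%:R * h by rewrite ler_pM2r// ler_nat.
  have := sh; rewrite ler_norml => /andP[s1 s2].
  have K0 : 0 <= K%:R * h by rewrite mulr_ge0// ltW.
  have h1 : K%:R * h <= `|s + i.+1%:R * h|.
    by apply: le_trans (ler_norm _); rewrite -natr1 mulrDl mul1r; lra.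
  have h2 : K%:R * h <= `|s - i.+1%:R * h|.
    by rewrite distrC; apply: le_trans (ler_norm _); rewrite -natr1 mulrDl mul1r; lra.
  split; apply: (le_trans (hH _)); rewrite -mulrA ler_wpM2l// expr2.
    by rewrite ler_wpM2r ?wgt_ge0// wgt_le_wgt.
  rewrite -(wgtN (- s + _)) opprD opprK.
  by rewrite ler_wpM2r ?wgt_ge0// wgt_le_wgt.
have -> : psum h H K' x - psum h H K x = \sum_(K <= i < K')
    (H (x + i.+1%:R * h) + H (x - i.+1%:R * h)).
  rewrite /psum -!(big_mkord xpredT (fun i => H (x + i.+1%:R * h) + H (x - i.+1%:R * h))).
  by rewrite (big_cat_nat (leq0n K) KK')/=; ring.
set c := 2 * (1 + h ^+ 2) / h * pi.
have step1 (s : R) : `|s| <= h / 2 -> \sum_(K <= i < K') wgt (s + i.+1%:R * h) <= c.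
  move=> sh; apply: le_trans (sum_wgt (s + h) K' h0).
  rewrite -(big_mkord xpredT (fun i => wgt (s + h + i%:R * h))) (big_cat_nat (leq0n K) KK')/=.
  rewrite [leRHS]addrC -[leLHS]addr0 lerD//; last first.
    by apply: sumr_ge0 => i _; exact: wgt_ge0.
  by apply: ler_sum => i _; rewrite -natr1 mulrDl mul1r (addrC (_ * h)) addrA.
apply: (le_trans (ler_norm_sum _ _ _)).
apply: (@le_trans _ _ (\sum_(K <= i < K') C * wgt (K%:R * h) * wgt (x + i.+1%:R * h) +
    \sum_(K <= i < K') C * wgt (K%:R * h) * wgt (- x + i.+1%:R * h))).
  rewrite -big_split /= big_nat_cond [leRHS]big_nat_cond; apply: ler_sum => i.
  move=> /andP[/andP[Ki _] _]; have [b1 b2] := big_arg x i Ki xh.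
  by rewrite (le_trans (ler_normD _ _))// lerD.
rewrite -!mulr_sumr -mulrDr.
have s1 := step1 x xh; have s2 := step1 (- x); rewrite normrN in s2; have {}s2 := s2 xh.
rewrite (_ : 2 * C * c * wgt (K%:R * h) = C * wgt (K%:R * h) * (c + c)); last by ring.
by rewrite ler_wpM2l ?mulr_ge0 ?wgt_ge0// lerD.
Qed.

Lemma integral_unfold (R : realType) (h : R) (H F : R -> R) (K : nat) : 0 < h ->
  continuous H -> continuous F -> (forall x, F (x + h) = F x) ->
  \int[mu]_(x in `[- (h / 2 + K%:R * h), h / 2 + K%:R * h]) (H x * F x) =
  \int[mu]_(x in `[- (h / 2), h / 2]) (psum h H K x * F x).
Proof.
move=> h0 cH cF pF.
have pFn (n : nat) x : F (x + n%:R * h) = F x.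
  elim: n => [|n IH]; first by rewrite mul0r addr0.
  by rewrite -natr1 mulrDl mul1r addrA pF IH.
have pFN (n : nat) x : F (x - n%:R * h) = F x by rewrite -(pFn n) subrK.
have cHF : continuous (fun x => H x * F x).
  by move=> x; apply: cvgM; [exact: cH|exact: cF].
have cHc c : continuous (fun x => H (x + c) * F x).
  by move=> x; apply: cvgM; [exact: continuous_translate|exact: cF].
elim: K => [|K IH].
  by rewrite mul0r addr0; apply: eq_Rintegral => x _; rewrite /psum big_ord0 addr0.
have Kh0 : 0 <= K%:R * h by rewrite mulr_ge0// ltW.
have KS : K.+1%:R * h = K%:R * h + h by rewrite -natr1 mulrDl mul1r.
rewrite (@Rintegral_seg_cat _ _ (- (h / 2 + K%:R * h)))//; [|by rewrite KS; lra..].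
rewrite (@Rintegral_seg_cat _ (- (h / 2 + K%:R * h)) (h / 2 + K%:R * h))//; [|by rewrite ?KS; lra..].
rewrite IH.
rewrite (_ : - (h / 2 + K.+1%:R * h) = - (h / 2) + - (K.+1%:R * h)); last by ring.
rewrite (_ : - (h / 2 + K%:R * h) = h / 2 + - (K.+1%:R * h)); last by rewrite KS; lra.
rewrite (_ : h / 2 + K%:R * h = - (h / 2) + K.+1%:R * h); last by rewrite KS; lra.
rewrite !Rintegral_seg_translate//.
under [X in X + _]eq_Rintegral do rewrite pFN.
under [X in _ + (_ + X)]eq_Rintegral do rewrite pFn.
rewrite -RintegralD//; [|apply: integrable_seg|exact/integrable_seg/cHc].
  rewrite -RintegralD//; [|exact/integrable_seg/cHc|apply: integrable_seg].
    by apply: eq_Rintegral => x _; rewrite psumS; ring.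
  move=> x; apply: cvgD; last exact: cHc.
  by apply: cvgM; [exact: continuous_psum|exact: cF].
by move=> x; apply: cvgM; [exact: continuous_psum|exact: cF].
Qed.

Lemma cos_gap (R : realType) (h d x : R) : 0 < h -> 0 < d -> d <= `|x| -> `|x| <= h / 2 ->
  0 < 2 - 2 * cos (2 * pi / h * d) /\
  2 - 2 * cos (2 * pi / h * d) <= 2 - 2 * cos (2 * pi / h * x).
Proof.
move=> h0 d0 dx xh; have w0 : 0 < 2 * pi / h by rewrite divr_gt0// mulr_gt0// pi_gt0.
have m (y : R) : 0 <= y -> y <= h / 2 -> 2 * pi / h * y \in `[0, pi].
  move=> y0; rewrite -(ler_pM2l w0) => yh; rewrite in_itv /=; apply/andP; split.
    by rewrite mulr_ge0// ltW.
  by apply: (le_trans yh); rewrite le_eqVlt; apply/orP; left; apply/eqP; field; rewrite gt_eqF.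
have dh := le_trans dx xh.
have mx := m _ (normr_ge0 x) xh; have md := m d (ltW d0) dh.
have cd : cos (2 * pi / h * `|x|) <= cos (2 * pi / h * d).
  by rewrite leNgt (ltr_cos mx md) -leNgt ler_pM2l.
have c1 : cos (2 * pi / h * d) < 1.
  have m0 : (0 : R) \in `[0, pi] by rewrite in_itv /= lexx pi_ge0.
  by rewrite -[ltRHS]cos0 (ltr_cos m0 md) mulr_gt0.
have e : cos (2 * pi / h * x) = cos (2 * pi / h * `|x|).
  by rewrite -[LHS]cos_norm normrM gtr0_norm.
by rewrite e; lra.
Qed.

Lemma Rintegral_setC_le (R : realType) (f : R -> R) (C D : R) :
  continuous f -> (forall x, `|f x| <= C * wgt x) ->
  forall eps, (forall x, D < `|x| -> `|f x| <= eps * wgt x) -> 0 <= eps ->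
  `|\int[mu]_x f x - \int[mu]_(x in `[- D, D]) f x| <= eps * \int[mu]_x @wgt R x.
Proof.
move=> cf hC eps heps eps0; have itf := integrable_decay cf hC.
have mD : measurable (`[- D, D]%classic : set R) by exact: measurable_itv.
have mDC : measurable (~` `[- D, D]%classic : set R) by exact: measurableC.
have -> : \int[mu]_x f x = \int[mu]_(x in `[- D, D]) f x + \int[mu]_(x in ~` `[- D, D]) f x.
  by rewrite -Rintegral_setU ?setUv//; apply/disj_setPCl.
rewrite addrAC subrr add0r.
have itD : mu.-integrable (~` `[- D, D]) (EFin \o f) by exact: integrableS itf.
have itw : mu.-integrable (~` `[- D, D]) (EFin \o (fun x => eps * wgt x)).
  apply: (@integrableS _ _ _ _ setT) => //.
  by have := integrableZl (@measurableT _ _) eps (integrable_wgt R).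
have hh := @le_normr_Rintegral _ _ _ (@lebesgue_measure R) _ _ mDC itD.
apply: (le_trans hh).
apply: (@le_trans _ _ (\int[mu]_(x in ~` `[- D, D]) (eps * wgt x))).
  apply: le_Rintegral => //; first by have := integrable_norm itD.
  move=> x /=; rewrite in_itv /= -ler_norml => /negP; rewrite -ltNge; exact: heps.
rewrite -RintegralZl//; last exact: integrable_wgt.
have itw' : itg (fun x => eps * wgt x).
  by have := integrableZl (@measurableT _ _) eps (integrable_wgt R).
rewrite [leRHS](_ : _ = \int[mu]_(x in `[- D, D]) (eps * wgt x) +
    \int[mu]_(x in ~` `[- D, D]) (eps * wgt x)); last first.
  by rewrite -Rintegral_setU ?setUv//; apply/disj_setPCl.
by rewrite lerDr Rintegral_ge0// => x _; rewrite mulr_ge0 ?wgt_ge0.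
Qed.

(** Averaging [H] against the Fejer kernel only sees the zeroth Fourier
coefficient of the periodization, while the kernel concentrates at the lattice
points. *)
Lemma poisson (R : realType) (h C : R) (H : R -> R) : 0 < h -> 0 <= C ->
  continuous H -> (forall x, `|H x| <= C * wgt x ^+ 2) ->
  (forall j : nat, (0 < j)%N ->
    \int[mu]_x (H x * cos (j%:R * (2 * pi / h * x))) = 0) ->
  forall e, 0 < e -> exists K0 : nat, forall K : nat, (K0 <= K)%N ->
    `|h * psum h H K 0 - \int[mu]_x H x| <= e.
Proof.
move=> h0 C0 cH hH H0 e e0.
set m := \int[mu]_x H x; set W := \int[mu]_x @wgt R x.
have W0 : 0 <= W by apply: Rintegral_ge0 => x _; exact: wgt_ge0.
(* the error is split into thirds: oscillation of the periodization near 0 (itself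
  three terms of size [e1]), kernel away from 0, tail of the integral *)
pose e1 := e / (9 * h).
have e10 : 0 < e1 by rewrite divr_gt0// mulr_gt0.
set c := 2 * C * (2 * (1 + h ^+ 2) / h * pi).
have c0 : 0 <= c.
  by rewrite !mulr_ge0 ?pi_ge0 ?invr_ge0 ?addr_ge0 ?sqr_ge0// ltW.
have [K1 hK1] := wgt_small h0 c0 e10.
have tail K K' x : (K <= K')%N -> `|x| <= h / 2 ->
    `|psum h H K' x - psum h H K x| <= c * wgt (K%:R * h).
  by move=> KK' xh; exact: psum_tail.
have [d0 d00 hd0] : exists2 d : R, 0 < d &
    forall x, `|x| < d -> `|psum h H K1 x - psum h H K1 0| <= e1.
  have := @continuous_psum R h H K1 cH 0 => /cvgrPdist_le/(_ e1 e10).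
  move=> [d /= d0 hd]; exists d => // x xd.
  by rewrite distrC; apply: hd; rewrite /= sub0r normrN.
pose d := Num.min d0 (h / 2).
have h20 : 0 < h / 2 by rewrite divr_gt0.
have d_gt0 : 0 < d by rewrite lt_min d00.
have dd0 : d <= d0 by rewrite ge_min lexx.
have equi K x : (K1 <= K)%N -> `|x| <= h / 2 -> `|x| < d ->
    `|psum h H K x - psum h H K 0| <= 3 * e1.
  move=> KK xh xd.
  have h00 : `|0 : R| <= h / 2 by rewrite normr0 ltW.
  have t1 := le_trans (tail _ _ _ KK xh) (hK1 _ (leqnn _)).
  have t2 := le_trans (tail _ _ _ KK h00) (hK1 _ (leqnn _)).
  have t3 := hd0 x (lt_le_trans xd dd0).
  move: t1 t2 t3; rewrite !ler_norml => /andP[? ?] /andP[? ?] /andP[? ?].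
  by apply/andP; split; lra.
pose B := C + c.
have bound K x : `|x| <= h / 2 -> `|psum h H K x| <= B.
  move=> xh; have := tail 0%N K x (leq0n _) xh.
  have w1 := @wgt_le1 R (0%:R * h).
  have : c * wgt (0%:R * h) <= c by rewrite ler_piMr.
  have : `|psum h H 0 x| <= C.
    rewrite /psum big_ord0 addr0 (le_trans (hH x))// ler_piMr//.
    by rewrite expr_le1// ?wgt_ge0 ?wgt_le1.
  have := ler_normD (psum h H K x - psum h H 0 x) (psum h H 0 x).
  by rewrite subrK /B; lra.
pose q := 2 - 2 * cos (2 * pi / h * d).
have dh2 : d <= h / 2 by rewrite ge_min lexx orbT.
have q0 : 0 < q.
  by have [] := @cos_gap R h d d h0 d_gt0; rewrite ?gtr0_norm.
have fq N x : d <= `|x| -> `|x| <= h / 2 -> fejer N (2 * pi / h * x) <= 4 / q.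
  move=> dx xh; have [_ hq] := cos_gap h0 d_gt0 dx xh.
  rewrite ler_pdivlMr//; apply: (@le_trans _ _ (fejer N (2 * pi / h * x) *
      (2 - 2 * cos (2 * pi / h * x)))).
    by rewrite ler_wpM2l// fejer_ge0.
  by rewrite mulrC fejer_closed; have := cos_geN1 (N%:R * (2 * pi / h * x)); lra.
have B0 : 0 <= B by rewrite addr_ge0.
have [N N0 hN] : exists2 N : nat, (0 < N)%N & 8 * B * h / q <= N%:R * (e / 3).
  have p0 : 0 <= 8 * B * h / q / (e / 3).
    by apply: divr_ge0; [apply: divr_ge0; [rewrite !mulr_ge0// ltW|exact: ltW]|lra].
  exists (Num.bound (8 * B * h / q / (e / 3))).+1 => //.
  rewrite -ler_pdivrMr ?divr_gt0//; apply/ltW/(lt_trans (archi_boundP p0)).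
  by rewrite ltr_nat.
have N0' : 0 < N%:R :> R by rewrite ltr0n.
have NC0 : 0 <= 2 * N%:R * C * W by rewrite !mulr_ge0.
have [K2 hK2] := wgt_small h0 NC0 (divr_gt0 e0 (ltr0n _ 3)).
exists (maxn K1 K2) => K; rewrite geq_max => /andP[KK1 KK2].
set F := fun x => fejer N (2 * pi / h * x).
have cF : continuous F by exact: continuous_fejer.
have pF x : F (x + h) = F x.
  rewrite /F mulrDr (_ : 2 * pi / h * h = pi *+ 2); last first.
    by rewrite divfK ?gt_eqF// mulr_natl.
  rewrite !fejerE; apply: eq_bigr => k _; apply: eq_bigr => l _.
  move: `|_|%N => j; rewrite mulrDr (mulr_natl (pi *+ 2) j).
  exact: (periodicn (@cosD2pi R)).
have cpF : continuous (fun x => psum h H K x * F x).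
  by move=> x; apply: cvgM; [exact: continuous_psum|exact: cF].
have I1 : `|\int[mu]_(x in `[- (h / 2), h / 2]) (psum h H K x * F x) -
    psum h H K 0 * (N%:R * h)| <= 3 * e1 * (N%:R * h) + 8 * B / q * h.
  rewrite -(integral_fejer N h0) -/F.
  have iF : mu.-integrable `[- (h / 2), h / 2] (EFin \o F) by exact: integrable_seg.
  have ik k : mu.-integrable `[- (h / 2), h / 2] (EFin \o (fun x => k * F x)).
    apply: integrable_seg => x; apply: cvgM; [exact: cvg_cst|exact: cF].
  rewrite -!RintegralZl// -RintegralB//; last exact: integrable_seg.
  have ic : mu.-integrable `[- (h / 2), h / 2] (EFin \o (fun=> 8 * B / q)).
    by apply: integrable_seg => x; exact: cvg_cst.
  have -> : 8 * B / q * h = \int[mu]_(x in `[- (h / 2), h / 2]) (8 * B / q).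
    rewrite Rintegral_cst//= lebesgue_measure_itv/= lte_fin ifT; last by lra.
    by rewrite -EFinB /=; congr (_ * _); lra.
  rewrite -RintegralD//.
  have cd : continuous (fun x => psum h H K x * F x - psum h H K 0 * F x).
    by move=> x; apply: cvgB; [exact: cpF|apply: cvgM; [exact: cvg_cst|exact: cF]].
  apply: le_trans (le_normr_Rintegral _ (integrable_seg _ _ cd)) _ => //.
  apply: le_Rintegral => //.
  - by have := integrable_norm (@integrable_seg _ (- (h / 2)) (h / 2) _ cd).
  - by have := @integrableD _ _ _ (@lebesgue_measure R) `[- (h / 2), h / 2]%classic
      (measurable_itv _) _ _ (ik (3 * e1)) ic.
  move=> x /=; rewrite in_itv /= -ler_norml => xh.
  rewrite -mulrBl normrM (ger0_norm (fejer_ge0 _ _)) -/(F x).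
  have F0 : 0 <= F x by exact: fejer_ge0.
  case: (ltP `|x| d) => xd.
    rewrite -[leLHS]addr0 lerD//; first by rewrite ler_wpM2r// equi.
    by rewrite !mulr_ge0// invr_ge0 ltW.
  rewrite -[leLHS]add0r lerD//; first by apply: mulr_ge0 => //; lra.
  rewrite (_ : 8 * B / q = (B + B) * (4 / q)); last by ring.
  apply: ler_pM => //; last exact: fq.
  by rewrite (le_trans (ler_normB _ _))// lerD// bound// normr0 ltW.
have I2 : `|N%:R * m - \int[mu]_(x in `[- (h / 2), h / 2]) (psum h H K x * F x)| <=
    2 * N%:R ^+ 2 * C * wgt (K%:R * h) * W.
  rewrite -(integral_unfold K h0 cH cF pF) /m.
  rewrite -(@integral_fejerM _ H C _ N cH _ H0); last first.
    move=> x; rewrite (le_trans (hH x))// ler_wpM2l// expr2 ler_piMl//.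
      exact: wgt_ge0.
    exact: wgt_le1.
  apply: (@Rintegral_setC_le _ _ (2 * N%:R ^+ 2 * C)).
  - by move=> x; apply: cvgM; [exact: cH|exact: cF].
  - move=> x; rewrite normrM (ger0_norm (fejer_ge0 _ _)).
    rewrite (_ : 2 * N%:R ^+ 2 * C * wgt x = C * wgt x * (2 * N%:R ^+ 2)); last by ring.
    apply: ler_pM => //; rewrite ?fejer_ge0 ?fejer_le//.
    by rewrite (le_trans (hH x))// ler_wpM2l// expr2 ler_piMl// ?wgt_ge0 ?wgt_le1.
  - move=> x Kx; rewrite normrM (ger0_norm (fejer_ge0 _ _)).
    rewrite (_ : 2 * N%:R ^+ 2 * C * _ * wgt x =
      C * (wgt (K%:R * h) * wgt x) * (2 * N%:R ^+ 2)); last by ring.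
    apply: ler_pM => //; rewrite ?fejer_ge0 ?fejer_le//.
    rewrite (le_trans (hH x))// ler_wpM2l// expr2 ler_wpM2r ?wgt_ge0//.
    apply: wgt_le_wgt; first by rewrite mulr_ge0// ltW.
    by lra.
  - by rewrite !mulr_ge0 ?wgt_ge0.
have {}hK2 := hK2 K KK2.
have I3 : `|N%:R * (h * psum h H K 0 - m)| <= N%:R * e.
  have n1 : 3 * e1 * (N%:R * h) = N%:R * (e / 3).
    by rewrite /e1; field; rewrite gt_eqF.
  have n2 : 8 * B / q * h = 8 * B * h / q by rewrite mulrAC.
  have n3 : 2 * N%:R ^+ 2 * C * wgt (K%:R * h) * W <= N%:R * (e / 3).
    rewrite (_ : 2 * N%:R ^+ 2 * C * wgt (K%:R * h) * W =
      N%:R * (2 * N%:R * C * W * wgt (K%:R * h))); last by ring.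
    by rewrite ler_wpM2l// ltW.
  move: I1 I2; rewrite n1 n2 !ler_norml => /andP[? ?] /andP[? ?].
  by apply/andP; split; lra.
move: I3; rewrite normrM gtr0_norm// ler_pM2l//.
Qed.

(** * Complex form of Poisson summation *)

Lemma wgt_translate (R : realType) (x c : R) : wgt (x + c) <= 2 * (1 + c ^+ 2) * wgt x.
Proof.
rewrite /wgt ler_pdivlMr ?ltr_pwDl ?sqr_ge0// ler_pdivrMl ?ltr_pwDl ?sqr_ge0//.
have h0 := sqr_ge0 (x + 2 * c).
have h1 : (x + 2 * c) ^+ 2 = 2 * (x + c) ^+ 2 + 2 * c ^+ 2 - x ^+ 2 by ring.
have h2 := mulr_ge0 (sqr_ge0 (x + c)) (sqr_ge0 c).
lra.
Qed.

Lemma decay_translate (R : realType) (F : R -> R[i]) (c : R) :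
  decay F -> decay (fun x => F (x + c)).
Proof.
move=> [c1 c2 [K K0 hK]]; split.
- exact: (@continuous_translate _ (fun t => Re (F t)) c c1).
- exact: (@continuous_translate _ (fun t => Im (F t)) c c2).
- have p0 : 0 <= 2 * (1 + c ^+ 2) by rewrite mulr_ge0// addr_ge0 ?sqr_ge0.
  exists (K * (2 * (1 + c ^+ 2)) ^+ 2); first by rewrite mulr_ge0// sqr_ge0.
  move=> t; have h : K * wgt (t + c) ^+ 2 <= K * (2 * (1 + c ^+ 2)) ^+ 2 * wgt t ^+ 2.
    rewrite -mulrA -exprMn ler_wpM2l//; apply: lerXn2r.
    - exact: wgt_ge0.
    - by rewrite nnegrE; apply: mulr_ge0 => //; exact: wgt_ge0.
    - exact: wgt_translate.
  by have [k1 k2] := hK (t + c); split; apply: le_trans h.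
Qed.

Lemma expiD (R : realType) (x y : R) : expi (x + y) = expi x * expi y.
Proof. by apply: complex_ext; rewrite ?ReM ?ImM /= ?cosD ?sinD; ring. Qed.

Lemma expi0 (R : realType) : expi 0 = 1 :> R[i].
Proof. by rewrite /expi cos0 sin0. Qed.

Lemma normc_expi (R : realType) (x : R) : normc (expi x) = 1.
Proof. by rewrite normcE /= cos2Dsin2 sqrtr1. Qed.

Lemma cpoisson (R : realType) (h : R) (F : R -> R[i]) : 0 < h -> decay F ->
  (forall j : nat, (0 < j)%N ->
    cintegral (fun x => F x * expi (j%:R * (2 * pi / h * x))) = 0 /\
    cintegral (fun x => F x * expi (- (j%:R * (2 * pi / h * x)))) = 0) ->
  forall e, 0 < e -> exists K0 : nat, forall K : nat, (K0 <= K)%N ->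
    `|h * psum h (fun x => Re (F x)) K 0 - Re (cintegral F)| <= e /\
    `|h * psum h (fun x => Im (F x)) K 0 - Im (cintegral F)| <= e.
Proof.
move=> h0 dF F0 e e0; have [c1 c2 [C C0 hC]] := dF.
have dE (j : nat) z : decay (fun x => F x * expi (z * (j%:R * (2 * pi / h * x)))).
  rewrite (_ : (fun x => F x * _) =
    fun x => expi (z * (j%:R * (2 * pi / h * x))) * F x); last first.
    by apply/funext => x; rewrite mulrC.
  apply: bdd_decay dF; have := bdd_expi (z * (j%:R * (2 * pi / h))) 0.
  by congr dominated; apply/funext => x; rewrite addr0 !mulrA.
have cosF (j : nat) : (0 < j)%N ->
   \int[mu]_x (Re (F x) * cos (j%:R * (2 * pi / h * x))) = 0 /\
   \int[mu]_x (Im (F x) * cos (j%:R * (2 * pi / h * x))) = 0.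
  move=> j0; have [f1 f2] := F0 _ j0.
  have d1 := dE j 1; have d2 := dE j (-1).
  have := cintegralD d1 d2.
  have -> : cintegral (fun t => F t * expi (1 * (j%:R * (2 * pi / h * t)))) = 0.
    by rewrite -f1; congr cintegral; apply/funext => x; rewrite mul1r.
  have -> : cintegral (fun t => F t * expi (-1 * (j%:R * (2 * pi / h * t)))) = 0.
    by rewrite -f2; congr cintegral; apply/funext => x; rewrite mulN1r.
  rewrite addr0 => z0.
  have [i1 i2] := decay_integrable (dominatedD d1 d2).
  have cc : continuous (fun x => cos (j%:R * (2 * pi / h * x))) by exact: continuous_cosn.
  have bc (f : R -> R) : continuous f -> (forall x, `|f x| <= C * wgt x ^+ 2) ->
     itg (fun x => f x * cos (j%:R * (2 * pi / h * x))).
    move=> cf hf; apply: (@integrable_decay _ _ C).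
      by move=> x; apply: cvgM; [exact: cf|exact: cc].
    move=> x; rewrite normrM (@le_trans _ _ `|f x|)// ?ler_piMr ?cos_max//.
    by rewrite (le_trans (hf x))// ler_wpM2l// expr2 ler_piMl ?wgt_ge0 ?wgt_le1.
  have e1 : \int[mu]_x (2 * (Re (F x) * cos (j%:R * (2 * pi / h * x)))) = 0.
    rewrite -[RHS](congr1 (@complex.Re R) z0) /cintegral /=; apply: eq_Rintegral => x _.
    by rewrite ReD !ReM /= mul1r mulN1r cosN sinN; ring.
  have e2 : \int[mu]_x (2 * (Im (F x) * cos (j%:R * (2 * pi / h * x)))) = 0.
    rewrite -[RHS](congr1 (@complex.Im R) z0) /cintegral /=; apply: eq_Rintegral => x _.
    by rewrite ImD !ImM /= mul1r mulN1r cosN sinN; ring.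
  rewrite RintegralZl// in e1; last by apply: bc => // x; have [] := hC x.
  rewrite RintegralZl// in e2; last by apply: bc => // x; have [] := hC x.
  by split; lra.
have [K1 h1] := poisson h0 C0 c1 (fun x => (hC x).1) (fun j j0 => (cosF j j0).1) e0.
have [K2 h2] := poisson h0 C0 c2 (fun x => (hC x).2) (fun j j0 => (cosF j j0).2) e0.
exists (maxn K1 K2) => K; rewrite geq_max => /andP[k1 k2].
by split; [exact: h1|exact: h2].
Qed.

(** * The frequency window *)

(** The frequency window: a smoothed indicator function of the segment [[- s/2, s/2]],
obtained as a difference of two translated steps, so that its translates by
multiples of [s] add up to 1. *)
Definition window (R : realType) (eta s x : R) : R :=
  cutoff (- eta) eta (1 * x + s / 2) - cutoff (- eta) eta (1 * x + - (s / 2)).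

Lemma smooth_cutoff (R : realType) (p q : R) : smooth (cutoff p q).
Proof. by apply: smooth_affine; exact: smooth_step. Qed.

Lemma smooth_window (R : realType) (eta s : R) : smooth (window eta s).
Proof. by apply: smoothB; apply: smooth_affine; exact: smooth_cutoff. Qed.

Lemma csupp_window (R : realType) (eta s : R) : 0 < eta -> 0 < s ->
  csupp (s / 2 + eta) (window eta s).
Proof.
move=> e0 s0 t; rewrite /window; have ee : - eta < eta by lra.
rewrite ltr_normr => /orP[] ht.
  by rewrite !cutoff_ge ?subrr//; lra.
by rewrite !cutoff_le ?subrr//; lra.
Qed.

Lemma window_ge0 (R : realType) (eta s x : R) : 0 < eta -> eta < s / 2 ->
  0 <= window eta s x.
Proof.
move=> e0 es; rewrite /window; have ee : - eta < eta by lra.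
case: (leP x 0) => x0.
  rewrite (@cutoff_le _ _ _ (1 * x + - (s / 2)))//; last by lra.
  by rewrite subr0 step_ge0.
rewrite (@cutoff_ge _ _ _ (1 * x + s / 2))//; last by lra.
by rewrite subr_ge0 step_le1.
Qed.

Lemma window_eq1 (R : realType) (eta s x : R) : 0 < eta ->
  `|x| <= s / 2 - eta -> window eta s x = 1.
Proof.
move=> e0; rewrite ler_norml => /andP[x1 x2]; have ee : - eta < eta by lra.
by rewrite /window cutoff_ge ?cutoff_le ?subr0//; lra.
Qed.

Lemma ct_window0_gt0 (R : realType) (eta s : R) : 0 < eta -> eta < s / 2 ->
  0 < ct (window eta s) 0.
Proof.
move=> e0 es; have s0 : 0 < s by lra.
have cw := smooth_continuous (@smooth_window R eta s).
have sw := csupp_window e0 s0.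
have -> : ct (window eta s) 0 = \int[mu]_x window eta s x.
  by apply: eq_Rintegral => x _; rewrite mulr0 cos0 mul1r.
pose r := s / 2 - eta; have r0 : 0 < r by rewrite /r; lra.
have itw := integrable_csupp cw sw.
have mD : measurable (`[- r, r]%classic : set R) by exact: measurable_itv.
have -> : \int[mu]_x window eta s x = \int[mu]_(x in `[- r, r]) window eta s x +
    \int[mu]_(x in ~` `[- r, r]) window eta s x.
  rewrite -Rintegral_setU ?setUv//; [exact: measurableC|exact/disj_setPCl].
apply: ltr_wpDr; first by apply: Rintegral_ge0 => x _; exact: window_ge0.
rewrite (@eq_Rintegral _ _ _ _ _ (fun=> 1)); last first.
  move=> x; rewrite inE /= in_itv /= -ler_norml; exact: window_eq1.
rewrite Rintegral_cst//= lebesgue_measure_itv/= lte_fin ifT; last by lra.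
by rewrite -EFinB /= mul1r; lra.
Qed.

Lemma derive1_cutoff (R : realType) (eta : R) : 0 < eta ->
  csupp eta (derive1 (cutoff (- eta) eta)).
Proof.
move=> e0 t; have ee : - eta < eta by lra.
rewrite ltr_normr => /orP[] ht.
  rewrite derive1E; suff d0 : is_derive (t : R) 1 (cutoff (- eta) eta : R -> R) 0 by exact: derive_val.
  apply: (@near_eq_is_derive R R R (fun=> 1) _ t 1 0).
  exists (t - eta) => [|v] /=; first by rewrite subr_gt0.
  by rewrite ltr_norml => /andP[_ tv]; rewrite cutoff_ge//; lra.
apply: derive1_near0; exists (- t - eta) => [|v] /=; first by rewrite subr_gt0.
by rewrite ltr_norml => /andP[tv _]; rewrite cutoff_le//; lra.
Qed.

(** The transform of the window vanishes at the nonzero multiples of [1/s]: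
up to a factor it is the transform of the derivative of the window, which is a
difference of two bumps at distance [s]. *)
Lemma window_zeros (R : realType) (eta s : R) (k : nat) (z : R) :
  0 < eta -> 0 < s -> z = 1 \/ z = -1 -> (0 < k)%N ->
  ct (window eta s) (z * (k%:R / s)) = 0 /\ st (window eta s) (z * (k%:R / s)) = 0.
Proof.
move=> e0 s0 hz k0; set y := z * (k%:R / s).
have kR : 0 < k%:R :> R by rewrite ltr0n.
have y0 : y != 0.
  have q0 : 0 < k%:R / s by rewrite divr_gt0.
  by rewrite /y; case: hz => ->; apply/eqP; lra.
have [h1 h2] := ct_derive1 y (@smooth_window R eta s) (csupp_window e0 s0).
have [beta betaE] : exists b, b = derive1 (cutoff (- eta) eta) by eexists.
have cb : continuous beta.
  by rewrite betaE; exact: smooth_continuous (smooth_derive1 (@smooth_cutoff R _ _)).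
have ab : csupp eta beta by rewrite betaE; exact: derive1_cutoff.
have dw : derive1 (window eta s) =
    fun x => beta (x + s / 2) - beta (x + - (s / 2)).
  rewrite betaE; apply: is_derive_derive1 => x.
  have d1 := @is_derive1_comp _ (cutoff (- eta) eta) (fun u => 1 * u + s / 2) x _ _
    (smooth_is_derive (@smooth_cutoff R _ _) _) (is_derive_affine 1 (s / 2) x).
  have d2 := @is_derive1_comp _ (cutoff (- eta) eta) (fun u => 1 * u + - (s / 2)) x _ _
    (smooth_is_derive (@smooth_cutoff R _ _) _) (is_derive_affine 1 (- (s / 2)) x).
  by rewrite mulr1 mul1r in d1; rewrite mulr1 mul1r in d2; exact: is_deriveB d1 d2.
have tr (g : R -> R) c : continuous g -> (forall u, `|g u| <= 1) ->
  itg (fun x => g x * beta (x + c)) /\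
  \int[mu]_x (g x * beta (x + c)) = \int[mu]_x (g (x - c) * beta x).
  move=> cg g1.
  have i1 : itg (fun x => g (x - c) * beta x).
    apply: (@integrable_csupp _ eta); last exact: csuppM.
    by move=> x; apply: cvgM; [exact: continuous_translate|exact: cb].
  split; last by rewrite -[RHS](Rintegral_translate c i1); apply: eq_Rintegral => x _; rewrite addrK.
  have := integrable_translate c i1; by under eq_fun do rewrite addrK.
have shiftE x : 2 * pi * (x + s / 2) * y = 2 * pi * (x - s / 2) * y + z * (pi *+ 2 *+ k).
  by rewrite -(mulr_natl _ k) -(mulr_natl pi 2) /y; field; rewrite gt_eqF.
have cosE x : cos (2 * pi * (x + s / 2) * y) = cos (2 * pi * (x - s / 2) * y).
  rewrite shiftE; case: hz => ->; first by rewrite mul1r (periodicn (@cosD2pi R)).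
  by rewrite mulN1r -[in RHS](subrK (pi *+ 2 *+ k) (2 * pi * (x - s / 2) * y))
    (periodicn (@cosD2pi R)).
have sinE x : sin (2 * pi * (x + s / 2) * y) = sin (2 * pi * (x - s / 2) * y).
  rewrite shiftE; case: hz => ->; first by rewrite mul1r (periodicn (@sinD2pi R)).
  by rewrite mulN1r -[in RHS](subrK (pi *+ 2 *+ k) (2 * pi * (x - s / 2) * y))
    (periodicn (@sinD2pi R)).
have cC : continuous (fun x => cos (2 * pi * x * y)).
  by move=> x; apply: continuous_comp; [exact: continuous_lin|exact: continuous_cos].
have cS : continuous (fun x => sin (2 * pi * x * y)).
  by move=> x; apply: continuous_comp; [exact: continuous_lin|exact: continuous_sin].
have z1 : ct (derive1 (window eta s)) y = 0.
  rewrite dw /ct; under eq_Rintegral do rewrite mulrBr.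
  have [i1 e1] := tr _ (s / 2) cC (fun u => cos_max _).
  have [i2 e2] := tr _ (- (s / 2)) cC (fun u => cos_max _).
  rewrite RintegralB; [|exact: measurableT|exact: i1|exact: i2].
  apply/eqP; rewrite e1 e2 subr_eq0; apply/eqP.
  by apply: eq_Rintegral => x _; rewrite opprK cosE.
have z2 : st (derive1 (window eta s)) y = 0.
  rewrite dw /st; under eq_Rintegral do rewrite mulrBr.
  have [i1 e1] := tr _ (s / 2) cS (fun u => sin_max _).
  have [i2 e2] := tr _ (- (s / 2)) cS (fun u => sin_max _).
  rewrite RintegralB; [|exact: measurableT|exact: i1|exact: i2].
  apply/eqP; rewrite e1 e2 subr_eq0; apply/eqP.
  by apply: eq_Rintegral => x _; rewrite opprK sinE.
have py : 2 * pi * y != 0.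
  by apply: mulf_neq0 => //; rewrite gt_eqF// mulr_gt0// pi_gt0.
move: h1 h2; rewrite z1 z2 => /esym/eqP; rewrite mulf_eq0 (negbTE py) /= => /eqP ->.
by move=> /esym/eqP; rewrite oppr_eq0 mulf_eq0 (negbTE py) /= => /eqP ->.
Qed.

(** * Band-limited functions *)

(** The form in which band limitation is used; unlike the inclusion of
supports, it is visibly stable under differences. *)
Definition band (R : realType) (a b : R) (phi : R -> R[i]) :=
  bdd phi /\ forall c d psi, d < a \/ b < c -> csmooth psi -> supp_in c d psi ->
    fourier_distr phi psi = 0.

Lemma continuous_Re_Im (R : realType) (phi : R -> R[i]) :
  continuous (phi : R -> R[i]^o) ->
  continuous (fun t => Re (phi t)) /\ continuous (fun t => Im (phi t)).
Proof.
move=> cphi.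
have h t (e : R) : 0 < e -> \forall u \near t, normc (phi t - phi u) < e.
  move=> e0; have := cphi t => /cvgrPdist_lt /(_ (e%:C)%C).
  rewrite ltcR => /(_ e0); apply: filterS => u.
  by rewrite normc_def ltcR normcE.
split=> t; apply/cvgrPdist_lt => e e0; have := h t e e0; apply: filterS => u.
  by apply: le_lt_trans; rewrite -ReN -ReD Re_le_normc.
by apply: le_lt_trans; rewrite -ImN -ImD Im_le_normc.
Qed.

Lemma bandlimited_band (R : realType) (a b : R) (phi : R -> R[i]) :
  bandlimited a b phi -> band a b phi.
Proof.
move=> [cphi [K hK] sphi].
have bphi : bdd phi.
  have [c1 c2] := continuous_Re_Im cphi.
  split => //; exists K; first exact: le_trans (normc_ge0 (phi 0)) (hK 0).
  by move=> t; rewrite mulr1; split; apply: le_trans (hK t);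
    [exact: Re_le_normc|exact: Im_le_normc].
split=> // c d psi cd; exact: (fourier_distr_off bphi sphi cd).
Qed.

Lemma dominatedN (R : realType) (m : R -> R) (f : R -> R[i]) :
  dominated m f -> dominated m (fun t => - f t).
Proof.
move=> [c1 c2 [K K0 hK]]; split.
- have -> : (fun t => Re (- f t)) = fun t => - Re (f t) by apply/funext => t; exact: ReN.
  by move=> t; apply: cvgN; exact: c1.
- have -> : (fun t => Im (- f t)) = fun t => - Im (f t) by apply/funext => t; exact: ImN.
  by move=> t; apply: cvgN; exact: c2.
- by exists K => // t; rewrite ReN ImN !normrN.
Qed.

Lemma bandB (R : realType) (a b : R) (f g : R -> R[i]) :
  band a b f -> band a b g -> band a b (fun t => f t - g t).
Proof.
move=> [bf hf] [bg hg]; have bN := dominatedN bg; split; first exact: dominatedD.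
move=> c d psi cd ps sp; have [A sA] := supp_in_widen sp.
have df := decay_fourier ps sA.
have e1 := hf _ _ _ cd ps sp; have e2 := hg _ _ _ cd ps sp.
rewrite /fourier_distr in e1 e2 *.
have dg := bdd_decay bg df; have dN := bdd_decay (bdd_cst (-1)) dg.
rewrite (_ : (fun t => _) = fun t => f t * fourier psi t + -1 * (g t * fourier psi t)).
  by rewrite cintegralD// ?cintegralZ// ?e1 ?e2 ?mulr0 ?addr0//; exact: bdd_decay.
by apply/funext => t; rewrite mulrBl mulN1r.
Qed.

Lemma decay_csupp (R : realType) (A : R) (f : R -> R[i]) :
  continuous (fun t => Re (f t)) -> continuous (fun t => Im (f t)) ->
  csupp A (fun t => Re (f t)) -> csupp A (fun t => Im (f t)) -> decay f.
Proof.
move=> c1 c2 s1 s2; have [B B0 [h1 _]] := csupp_decay c1 s1.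
have [D D0 [h2 _]] := csupp_decay c2 s2.
have p0 : 0 < 1 + A ^+ 2 by rewrite ltr_pwDl ?sqr_ge0.
have w1 x : `|x| <= `|A| -> 1 <= (1 + A ^+ 2) * wgt x.
  move=> xA; rewrite /wgt ler_pdivlMr ?ltr_pwDl ?sqr_ge0// mul1r lerD2l.
  by rewrite -[x ^+ 2]real_normK ?num_real// -[A ^+ 2]real_normK ?num_real// lerXn2r ?nnegrE.
have key (g : R -> R) (E : R) x : csupp A g -> 0 <= E -> `|g x| <= E ->
    `|g x| <= E * (1 + A ^+ 2) ^+ 2 * wgt x ^+ 2.
  move=> sg E0 gE; case: (leP `|x| `|A|) => xA.
    rewrite (le_trans gE)// -mulrA ler_peMr// -exprMn; exact: exprn_ege1 (w1 _ xA).
  rewrite sg ?normr0; last by rewrite (le_lt_trans (ler_norm _) xA).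
  by apply: mulr_ge0; [apply: mulr_ge0 => //|]; exact: sqr_ge0.
split => //; exists ((B + D) * (1 + A ^+ 2) ^+ 2).
  by apply: mulr_ge0; [exact: addr_ge0|exact: sqr_ge0].
have E0 : 0 <= B + D by exact: addr_ge0.
move=> t; split; [apply: (key (fun t => Re (f t)) (B + D) t s1 E0)|
  apply: (key (fun t => Im (f t)) (B + D) t s2 E0)].
  by rewrite (le_trans (h1 t))// lerDl.
by rewrite (le_trans (h2 t))// lerDr.
Qed.

(** * Sampling inequality *)

(** The inverse Fourier transform of the window. *)
Definition kappa (R : realType) (eta s y : R) : R[i] :=
  Complex (ct (window eta s) y) (st (window eta s) y).

(** The window moved to the frequency [tau] and modulated so that its transform
is centered at the time [t] *)
Definition atom (R : realType) (eta s t tau x : R) : R[i] :=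
  rscale (window eta s (1 * x + - tau)) (expi (2 * pi * t * x + 0)).

Lemma csmooth_atom (R : realType) (eta s t tau : R) : csmooth (atom eta s t tau).
Proof.
split; apply: smoothM.
- by apply: smooth_affine; exact: smooth_window.
- by apply: smooth_affine; exact: smooth_cos.
- by apply: smooth_affine; exact: smooth_window.
- by apply: smooth_affine; exact: smooth_sin.
Qed.

Lemma supp_atom (R : realType) (eta s t tau : R) : 0 < eta -> 0 < s ->
  supp_in (tau - (s / 2 + eta)) (tau + (s / 2 + eta)) (atom eta s t tau).
Proof.
move=> e0 s0 x /rscale_neq0[wx _].
have : `|1 * x + - tau| <= s / 2 + eta.
  rewrite leNgt; apply: contra wx => h; apply/eqP.
  exact: (csupp_window e0 s0 h).
by rewrite ler_norml => /andP[? ?]; apply/andP; split; lra.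
Qed.

Lemma fourier_atom (R : realType) (eta s t tau x : R) : 0 < eta -> 0 < s ->
  fourier (atom eta s t tau) x =
    expi (2 * pi * (t - x) * tau) * kappa eta s (t - x).
Proof.
move=> e0 s0; pose g xi := rscale (window eta s xi) (expi (2 * pi * xi * (t - x))).
have cw := smooth_continuous (@smooth_window R eta s).
have sw := csupp_window e0 s0.
have dg : decay g.
  apply: (@decay_csupp _ (s / 2 + eta)) => /=.
  - by move=> u; apply: cvgM; [exact: cw|apply: continuous_comp; [exact: continuous_lin|exact: continuous_cos]].
  - by move=> u; apply: cvgM; [exact: cw|apply: continuous_comp; [exact: continuous_lin|exact: continuous_sin]].
  - by move=> u hu; rewrite sw ?mul0r.
  - by move=> u hu; rewrite sw ?mul0r.
have -> : kappa eta s (t - x) = cintegral g.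
  by rewrite /kappa /cintegral /ct /st; congr Complex; apply: eq_Rintegral => u _; rewrite mulrC.
rewrite -cintegralZ//; set k := expi _.
have dkg : decay (fun xi => k * g xi) := bdd_decay (bdd_cst k) dg.
rewrite -(cintegral_translate (- tau) dkg) /fourier; congr cintegral.
apply/funext => u; rewrite /k /g /atom !mul1r addr0.
have rM r (z w : R[i]) : z * rscale r w = rscale r (z * w).
  by apply: complex_ext; rewrite ?ReM ?ImM /= ?ReM ?ImM; ring.
by rewrite !rM -!expiD; congr (rscale _ (expi _)); ring.
Qed.

Lemma sum_wgt_lattice (R : realType) (h t : R) (K : nat) : 0 < h ->
  wgt (t - 0) + \sum_(i < K) (wgt (t - i.+1%:R * h) + wgt (t + i.+1%:R * h)) <=
  1 + 2 * (2 * (1 + h ^+ 2) / h * pi).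
Proof.
move=> h0; rewrite lerD ?wgt_le1// big_split /= mulr_natl mulr2n lerD//.
  apply: le_trans (sum_wgt (- t + h) K h0); apply: ler_sum => i _.
  rewrite -wgtN -natr1 (_ : - (t - (i%:R + 1) * h) = - t + h + i%:R * h) //; ring.
apply: le_trans (sum_wgt (t + h) K h0); apply: ler_sum => i _.
by rewrite -natr1 (_ : t + (i%:R + 1) * h = t + h + i%:R * h) //; ring.
Qed.

(** Poisson summation for the product [F] of [phi] with the transform of an atom:
as the other frequencies in [c + s Z] miss the band, the sums of [F] over the
lattices [t + h Z] and [h Z] agree, both being the integral of [F] divided by
[h].  The first has the only nonzero term [F t] by [window_zeros]; the second is
a sum of samples, with weights of order [wgt (t - k h)], in which the bound [A]
is used only for the samples at distance more than [T] from [t]. *)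
Lemma sampling (R : realType) (a b s : R) : a < b -> b - a < s ->
  exists2 C : R, 0 < C & forall phi, band a b phi ->
    forall t delta A T : R, 0 <= delta -> 0 <= T ->
    (forall x, normc (phi x) <= A) ->
    (forall k : int, `|t - k%:~R * s^-1| <= T -> normc (phi (k%:~R * s^-1)) <= delta) ->
    normc (phi t) <= C * (delta + A * wgt T).
Proof.
move=> ab sab; have s0 : 0 < s by lra.
pose eta := (s - (b - a)) / 4; pose c := (a + b) / 2; pose h := s^-1.
have h0 : 0 < h by rewrite invr_gt0.
have e0 : 0 < eta by rewrite /eta; lra.
have es : eta < s / 2 by rewrite /eta; lra.
have cw := smooth_continuous (@smooth_window R eta s).
have sw := csupp_window e0 s0.
have [K K0 hK] := ct_decay (@smooth_window R eta s) sw.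
have k0 := ct_window0_gt0 e0 es.
set k_0 := ct (window eta s) 0 in k0.
pose cs := 1 + 2 * (2 * (1 + h ^+ 2) / h * pi).
have cs1 : 1 <= cs.
  rewrite /cs lerDl !mulr_ge0 ?pi_ge0 ?invr_ge0 ?addr_ge0 ?sqr_ge0//; lra.
have C0 : 0 < 2 * (2 * K * cs + 1) / k_0.
  rewrite divr_gt0// mulr_gt0// ltr_wpDl// !mulr_ge0//; lra.
exists (2 * (2 * K * cs + 1) / k_0) => // phi [bphi hphi] t delta A T d0 T0 hA hs.
have A0 : 0 <= A by exact: le_trans (normc_ge0 _) (hA 0).
pose F x := phi x * fourier (atom eta s t c) x.
have [A1 sA1] := supp_in_widen (@supp_atom R eta s t c e0 s0).
have dF : decay F by exact: bdd_decay bphi (decay_fourier (@csmooth_atom R eta s t _) sA1).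
have FE x : F x = phi x * (expi (2 * pi * (t - x) * c) * kappa eta s (t - x)).
  by rewrite /F fourier_atom.
(* the frequencies [c + j s], [j <> 0], are at distance more than [s/2 + eta] from the
   band, because [eta] is less than half of [s - (b - a)] *)
have Fj (j : nat) z y : (0 < j)%N -> z = 1 \/ z = -1 ->
    cintegral (fun x => F (x + y) * expi (z * (j%:R * (2 * pi / h * x)))) = 0.
  move=> j0 hz; pose tau := c - z * j%:R * s.
  have j1 : 1 <= j%:R :> R by rewrite ler1n.
  have js : s <= j%:R * s by rewrite ler_peMl// ltW.
  have off : tau + (s / 2 + eta) < a \/ b < tau - (s / 2 + eta).
    by rewrite /tau /c /eta; case: hz => ->; [left|right]; lra.
  have := hphi _ _ _ off (@csmooth_atom R eta s t tau) (@supp_atom R eta s t tau e0 s0).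
  rewrite /fourier_distr.
  have dG : decay (fun x => phi x * fourier (atom eta s t tau) x).
    have [A2 sA2] := supp_in_widen (@supp_atom R eta s t tau e0 s0).
    exact: bdd_decay bphi (decay_fourier (@csmooth_atom R eta s t _) sA2).
  rewrite -(cintegral_translate y dG) => e.
  pose u := expi (2 * pi * (z * j%:R * s) * (t - y)).
  rewrite -[RHS](mulr0 u) -e -cintegralZ; last exact: decay_translate dG.
  congr cintegral; apply/funext => x; rewrite FE fourier_atom//.
  have hE : expi (2 * pi * (t - (x + y)) * c) * expi (z * (j%:R * (2 * pi / h * x))) =
      u * expi (2 * pi * (t - (x + y)) * tau).
    by rewrite /u -!expiD; congr expi; rewrite /tau /h invrK; ring.
  transitivity (phi (x + y) * kappa eta s (t - (x + y)) *
    (expi (2 * pi * (t - (x + y)) * c) * expi (z * (j%:R * (2 * pi / h * x)))));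
    first by ring.
  by rewrite hE; ring.
have P y e : 0 < e -> exists K0 : nat, forall K : nat, (K0 <= K)%N ->
    `|h * psum h (fun x => Re (F (x + y))) K 0 - Re (cintegral F)| <= e /\
    `|h * psum h (fun x => Im (F (x + y))) K 0 - Im (cintegral F)| <= e.
  move=> ee; have := @cpoisson _ h (fun x => F (x + y)) h0 (decay_translate y dF) _ e ee.
  rewrite (cintegral_translate y dF); apply => j j0; split.
    by rewrite -[RHS](Fj j 1 y j0 (or_introl erefl)); congr cintegral; apply/funext => x; rewrite mul1r.
  by rewrite -[RHS](Fj j (-1) y j0 (or_intror erefl)); congr cintegral; apply/funext => x; rewrite mulN1r.
have kap0 (z : R) (i : nat) : z = 1 \/ z = -1 -> kappa eta s (z * (i.+1%:R * h)) = 0.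
  move=> hz; have [z1 z2] := window_zeros e0 s0 hz (ltn0Sn i).
  by rewrite /kappa /h z1 z2.
have F0 (i : nat) : F (i.+1%:R * h + t) = 0 /\ F (- (i.+1%:R * h) + t) = 0.
  split; rewrite FE.
    rewrite (_ : t - _ = -1 * (i.+1%:R * h)); last by ring.
    by rewrite kap0 ?mulr0//; right.
  rewrite (_ : t - _ = 1 * (i.+1%:R * h)); last by ring.
  by rewrite kap0 ?mulr0//; left.
have Ft : F t = phi t * Complex k_0 0.
  rewrite FE subrr mulr0 mul0r expi0 mul1r /kappa; congr (_ * Complex _ _).
  rewrite /st; under eq_Rintegral do rewrite mulr0 sin0 mul0r.
  by rewrite Rintegral_cst// mul0r.
have zero_of_small (x : R) : (forall e, 0 < e -> `|x| <= e) -> x = 0.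
  move=> hx; apply/eqP/negPn/negP => x0.
  have xp : 0 < `|x| by rewrite normr_gt0.
  by have := hx (`|x| / 2); rewrite divr_gt0// => /(_ isT); lra.
have intF : Re (cintegral F) = h * k_0 * Re (phi t) /\ Im (cintegral F) = h * k_0 * Im (phi t).
  have pE (f : R[i] -> R) K1 : f 0 = 0 -> psum h (fun x => f (F (x + t))) K1 0 = f (F t).
    move=> f0; rewrite /psum add0r big1 ?addr0// => i _.
    by rewrite add0r sub0r; have [-> ->] := F0 i; rewrite f0 addr0.
  split; apply/eqP; rewrite eq_sym -subr_eq0; apply/eqP/zero_of_small => e ee.
    have [K1 /(_ _ (leqnn _))[+ _]] := P t e ee.
    by rewrite pE// Ft ReM /= mulr0 subr0 (_ : h * k_0 * _ = h * (Re (phi t) * k_0))//; ring.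
  have [K1 /(_ _ (leqnn _))[_ +]] := P t e ee.
  by rewrite pE// Ft ImM /= mulr0 add0r (_ : h * k_0 * _ = h * (Im (phi t) * k_0))//; ring.
pose X := delta + A * wgt T.
have X0 : 0 <= X by rewrite addr_ge0// mulr_ge0// wgt_ge0.
have Fk (k : int) : normc (F (k%:~R * h)) <= 2 * K * X * wgt (t - k%:~R * h).
  rewrite FE !Normc.normcM normc_expi mul1r.
  have [k1 k2] := hK (t - k%:~R * h).
  have hk : normc (kappa eta s (t - k%:~R * h)) <= 2 * K * wgt (t - k%:~R * h) ^+ 2.
    by apply: (le_trans (normc_le _)) => /=; rewrite -mulrA mulr_natl mulr2n lerD.
  set w := wgt (t - k%:~R * h) in hk *.
  have w0 : 0 <= w by exact: wgt_ge0.
  rewrite (_ : 2 * K * X * w = X * (2 * K * w)); last by ring.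
  case: (leP `|t - k%:~R * h| T) => tT.
    apply: ler_pM; rewrite ?normc_ge0//.
      by rewrite (le_trans (hs k tT))// lerDl mulr_ge0// wgt_ge0.
    rewrite (le_trans hk)// ler_wpM2l ?mulr_ge0// expr2 ler_piMr//; exact: wgt_le1.
  apply: (@le_trans _ _ (A * (2 * K * (wgt T * w)))).
    apply: ler_pM; rewrite ?normc_ge0//.
    rewrite (le_trans hk)// ler_wpM2l ?mulr_ge0// expr2 ler_wpM2r//.
    by apply: wgt_le_wgt => //; exact: ltW.
  rewrite (_ : A * _ = (A * wgt T) * (2 * K * w)); last by ring.
  by rewrite ler_wpM2r ?mulr_ge0// lerDr.
have sumF (f : R[i] -> R) K1 : (forall z, `|f z| <= normc z) ->
    `|psum h (fun x => f (F (x + 0))) K1 0| <= 2 * K * X * cs.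
  move=> hf; have hfk (k : int) x : x = k%:~R * h ->
      `|f (F x)| <= 2 * K * X * wgt (t - k%:~R * h).
    by move=> ->; exact: le_trans (hf _) (Fk k).
  apply: (@le_trans _ _ (2 * K * X * (wgt (t - 0) +
    \sum_(i < K1) (wgt (t - i.+1%:R * h) + wgt (t + i.+1%:R * h))))); last first.
    by apply: ler_wpM2l; [rewrite !mulr_ge0|exact: sum_wgt_lattice].
  rewrite /psum mulrDr (le_trans (ler_normD _ _))// lerD//.
    by have := hfk 0 (0 + 0); rewrite mul0r addr0; apply.
  rewrite mulr_sumr (le_trans (ler_norm_sum _ _ _))//; apply: ler_sum => i _.
  rewrite mulrDr (le_trans (ler_normD _ _))// lerD//.
    by apply: (hfk (Posz i.+1)); rewrite addr0 add0r.
  have := hfk (- Posz i.+1) (0 - i.+1%:R * h + 0).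
  by rewrite mulrNz mulNr opprK; apply; rewrite addr0 sub0r.
have compare (r q : R) : 0 <= q -> (forall e, 0 < e -> exists2 p, `|p| <= q &
    `|h * p - h * k_0 * r| <= e) -> k_0 * `|r| <= q.
  move=> q0 hr; rewrite leNgt; apply/negP => qr.
  have [|p pq hh] := hr (h * ((k_0 * `|r| - q) / 2)).
    by rewrite mulr_gt0// divr_gt0// subr_gt0.
  have {}hh : `|p - k_0 * r| <= (k_0 * `|r| - q) / 2.
    rewrite -(ler_pM2l h0); apply: le_trans hh.
    by rewrite -[X in X * `|_|](gtr0_norm h0) -normrM mulrBr mulrA.
  have : `|k_0 * r| <= `|p| + `|p - k_0 * r|.
    by have := ler_normB p (p - k_0 * r); rewrite opprB addrC subrK.
  by rewrite normrM (gtr0_norm k0); lra.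
have q0 : 0 <= 2 * K * X * cs by rewrite !mulr_ge0// (le_trans _ cs1).
have re : k_0 * `|Re (phi t)| <= 2 * K * X * cs.
  apply: compare => // e ee; have [K1 /(_ _ (leqnn _))[+ _]] := P 0 e ee.
  rewrite intF.1; exists (psum h (fun x => Re (F (x + 0))) K1 0) => //.
  by apply: sumF; exact: Re_le_normc.
have im : k_0 * `|Im (phi t)| <= 2 * K * X * cs.
  apply: compare => // e ee; have [K1 /(_ _ (leqnn _))[_ +]] := P 0 e ee.
  rewrite intF.2; exists (psum h (fun x => Im (F (x + 0))) K1 0) => //.
  by apply: sumF; exact: Im_le_normc.
apply: (le_trans (normc_le _)); rewrite -/X.
rewrite (_ : _ / k_0 * X = (2 * (2 * K * X * cs) + 2 * X) / k_0); last by ring.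
by rewrite ler_pdivlMr// mulrDl ![_ * k_0]mulrC; lra.
Qed.

(** * Trigonometric polynomials are band-limited *)

Lemma cos_eq1_small (R : realType) (x : R) : `|x| <= pi -> cos x = 1 -> x = 0.
Proof.
move=> xpi cx; have m0 : (0 : R) \in `[0, pi] by rewrite in_itv /= lexx pi_ge0.
have mx : `|x| \in `[0, pi] by rewrite in_itv /= normr_ge0.
have : `|x| = 0 by apply: (cos_inj mx m0); rewrite cos_norm cos0.
by move/eqP; rewrite normr_eq0 => /eqP.
Qed.

Lemma test_near0 (R : realType) (psi : R -> R[i]) (t : R) :
  ~ closed_support psi t -> \forall u \near t, psi u = 0.
Proof.
move=> ht; have oC : open (~` closed_support psi) by apply: closed_openC; exact: closed_closure.
have := open_nbhs_nbhs (conj oC ht); apply: filterS => u hu.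
by apply/eqP/negPn/negP => pu; apply: hu; apply: subset_closure.
Qed.

(** If [c] is off the support of [psi], then [psi = (e^(i theta) - 1) chi] with
[theta] a small multiple of [x - c] and [chi] again a test function, so that the
integrand is a difference of two translates of one integrable function. *)
Lemma fourier_inversion_off (R : realType) (c : R) (psi : R -> R[i]) :
  test_function psi -> ~ closed_support psi c ->
  cintegral (fun t => expi (2 * pi * c * t + 0) * fourier psi t) = 0.
Proof.
move=> tpsi hc; have [s1 s2 _] := tpsi; have [A0 sA0] := test_supp_in tpsi.
pose A := `|A0|.
have sA : supp_in (- A) A psi.
  by move=> t /sA0; rewrite -!ler_norml => /le_trans; apply; exact: ler_norm.
have A_ge0 : 0 <= A by exact: normr_ge0.
pose L := A + `|c| + 1.
have L0 : 0 < L by rewrite /L ltr_wpDl// addr_ge0.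
pose th x := pi / L * x + - (pi / L * c).
pose g x := 2 - 2 * cos (th x).
have sth : smooth (fun x => cos (th x)) by apply: smooth_affine; exact: smooth_cos.
have sth' : smooth (fun x => sin (th x)) by apply: smooth_affine; exact: smooth_sin.
have sg : smooth g by apply: smoothB; [exact: smooth_cst|apply: smoothZ; exact: sth].
have near0 t : g t = 0 -> \forall u \near t, psi u = 0.
  move=> gt0; apply: test_near0 => ct.
  have := supp_in_closed_support sA ct; rewrite /= in_itv /= => /andP[t1 t2].
  have : th t = 0.
    apply: cos_eq1_small; last by move: gt0; rewrite /g; lra.
    rewrite /th -mulrBr normrM gtr0_norm ?divr_gt0 ?pi_gt0//.
    rewrite mulrAC ler_pdivrMr// ler_pM2l ?pi_gt0// /L.
    have : `|t| <= A by rewrite ler_norml t1.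
    by have := ler_normB t c; lra.
  rewrite /th -mulrBr => /eqP; rewrite mulf_eq0 gt_eqF ?divr_gt0 ?pi_gt0//=.
  by rewrite subr_eq0 => /eqP tc; apply: hc; rewrite -tc.
pose num x := psi x * Complex (cos (th x) - 1) (- sin (th x)).
pose chi x : R[i] := Complex (Re (num x) / g x) (Im (num x) / g x).
have sc1 : smooth (fun x => cos (th x) - 1) by apply: smoothB; [exact: sth|exact: smooth_cst].
have n1 : smooth (fun x => Re (num x)).
  rewrite (_ : (fun x => _) = fun x =>
    Re (psi x) * (cos (th x) - 1) + Im (psi x) * sin (th x)); last first.
    by apply/funext => x; rewrite /num ReM /=; ring.
  by apply: smoothD; [exact: smoothM s1 sc1|exact: smoothM s2 sth'].
have n2 : smooth (fun x => Im (num x)).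
  rewrite (_ : (fun x => _) = fun x =>
    Im (psi x) * (cos (th x) - 1) - Re (psi x) * sin (th x)); last first.
    by apply/funext => x; rewrite /num ImM /=; ring.
  by apply: smoothB; [exact: smoothM s2 sc1|exact: smoothM s1 sth'].
have n0 t : g t = 0 -> \forall u \near t, num u = 0.
  by move=> /near0; apply: filterS => u pu; rewrite /num pu mul0r.
have x1 : smooth (fun x => Re (chi x)).
  by apply: (smooth_div n1 sg) => t /n0; apply: filterS => u ->.
have x2 : smooth (fun x => Im (chi x)).
  by apply: (smooth_div n2 sg) => t /n0; apply: filterS => u ->.
have sx : supp_in (- A) A chi.
  move=> t ht; apply: sA; apply: contra ht => /eqP pt.
  by apply/eqP/complex_ext; rewrite /= /num pt mul0r mul0r.
have [a1 a2] := supp_in_csupp sx.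
have dx : decay chi := decay_csupp (smooth_continuous x1) (smooth_continuous x2) a1 a2.
have psiE x : psi x = expi (th x) * chi x + -1 * chi x.
  have [gx|gx] := eqVneq (g x) 0.
    have p0 := nbhs_singleton (near0 _ gx); have q0 : chi x = 0.
      by apply: complex_ext; rewrite /= /num p0 mul0r mul0r.
    by rewrite p0 q0 !mulr0 addr0.
  have cs := cos2Dsin2 (th x).
  have gE : g x = (cos (th x) - 1) ^+ 2 + sin (th x) ^+ 2 by rewrite /g; lra.
  have key (p q : R) : p = (cos (th x) * ((p * (cos (th x) - 1) + q * sin (th x)) / g x) -
      sin (th x) * ((q * (cos (th x) - 1) - p * sin (th x)) / g x)) -
      (p * (cos (th x) - 1) + q * sin (th x)) / g x.
    rewrite [RHS](_ : _ = p * ((cos (th x) - 1) ^+ 2 + sin (th x) ^+ 2) / g x); last by field.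
    by rewrite -gE mulfK.
  have key' (p q : R) : q = (cos (th x) * ((q * (cos (th x) - 1) - p * sin (th x)) / g x) +
      sin (th x) * ((p * (cos (th x) - 1) + q * sin (th x)) / g x)) -
      (q * (cos (th x) - 1) - p * sin (th x)) / g x.
    rewrite [RHS](_ : _ = q * ((cos (th x) - 1) ^+ 2 + sin (th x) ^+ 2) / g x); last by field.
    by rewrite -gE mulfK.
  apply: complex_ext; rewrite ?ReD ?ImD ?ReM ?ImM /= /num ?ReM ?ImM /=.
    rewrite [LHS](key _ (Im (psi x))); ring.
  rewrite [LHS](key' (Re (psi x)) _); ring.
pose h := (2 * L)^-1; pose k := expi (- (2 * pi * h * c)).
have dm y : decay (fun x => expi (- (2 * pi * x * y)) * chi x).
  apply: bdd_decay dx; have := bdd_expi (- (2 * pi * y)) 0.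
  by congr dominated; apply/funext => x; rewrite addr0; congr expi; ring.
have fE x : fourier psi x = k * fourier chi (x - h) + -1 * fourier chi x.
  rewrite /fourier -!cintegralZ// -cintegralD; last 2 first.
  - exact: bdd_decay (bdd_cst k) (dm _).
  - exact: bdd_decay (bdd_cst (-1)) (dm _).
  congr cintegral; apply/funext => u; rewrite psiE mulrDr mulrA -expiD.
  rewrite /k (mulrA (expi _) (expi _)) -expiD; congr (expi _ * _ + _); last by ring.
  by rewrite /th /h; field; rewrite gt_eqF.
pose G x := expi (2 * pi * c * x + 0) * fourier chi x.
have dG : decay G.
  exact: bdd_decay (bdd_expi _ _) (decay_fourier (conj x1 x2) sx).
have dG' := decay_translate (- h) dG.
rewrite (_ : (fun t => _) = fun t => G (t + - h) + -1 * G t); last first.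
  apply/funext => t; rewrite fE /G mulrDr mulrA /k -expiD; congr (expi _ * _ + _); last by ring.
  by ring.
rewrite cintegralD// ?cintegralZ// ?(cintegral_translate (- h) dG) ?mulN1r ?subrr//.
exact: bdd_decay (bdd_cst (-1)) dG.
Qed.

Lemma bdd_sum (R : realType) (n : nat) (f : 'I_n -> R -> R[i]) :
  (forall i, bdd (f i)) -> bdd (fun t => \sum_(i < n) f i t).
Proof.
elim: n f => [|n IH] f hf.
  have := bdd_cst (0 : R[i]); by congr dominated; apply/funext => t; rewrite big_ord0.
have := dominatedD (IH (fun i => f (widen_ord (leqnSn n) i)) (fun i => hf _)) (hf ord_max).
by congr dominated; apply/funext => t; rewrite big_ord_recr.
Qed.

Lemma cintegral_sum (R : realType) (n : nat) (f : 'I_n -> R -> R[i]) :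
  (forall i, decay (f i)) ->
  decay (fun t => \sum_(i < n) f i t) /\
  cintegral (fun t => \sum_(i < n) f i t) = \sum_(i < n) cintegral (f i).
Proof.
elim: n f => [|n IH] f hf.
  have z0 : decay (fun=> (0 : R[i])).
    split; [by move=> t; exact: cvg_cst|by move=> t; exact: cvg_cst|].
    by exists 0 => // t; rewrite /= normr0 mul0r.
  have -> : (fun t => \sum_(i < 0) f i t) = fun=> 0 by apply/funext => t; rewrite big_ord0.
  split=> //; rewrite big_ord0 /cintegral; apply: complex_ext => /=;
    by rewrite Rintegral_cst// mul0r.
have [d1 e1] := IH (fun i => f (widen_ord (leqnSn n) i)) (fun i => hf _).
have -> : (fun t => \sum_(i < n.+1) f i t) = fun t =>
    \sum_(i < n) f (widen_ord (leqnSn n) i) t + f ord_max t.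
  by apply/funext => t; rewrite big_ord_recr.
split; first exact: dominatedD.
by rewrite cintegralD// e1 big_ord_recr.
Qed.

Lemma continuous_complex (R : realType) (phi : R -> R[i]) :
  continuous (fun t => Re (phi t)) -> continuous (fun t => Im (phi t)) ->
  continuous (phi : R -> R[i]^o).
Proof.
move=> c1 c2 t; apply/cvgrPdist_lt => e; rewrite ltcE /= => /andP[/eqP e2 e1].
have e20 : 0 < Re e / 2 by rewrite divr_gt0.
have h1 : \forall u \near t, `|Re (phi t) - Re (phi u)| < Re e / 2.
  by have := c1 t => /cvgrPdist_lt; apply.
have h2 : \forall u \near t, `|Im (phi t) - Im (phi u)| < Re e / 2.
  by have := c2 t => /cvgrPdist_lt; apply.
near=> u; rewrite normc_def ltcE /= e2 eqxx /= -normcE.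
apply: (le_lt_trans (normc_le _)); rewrite ReD ImD ReN ImN.
have : `|Re (phi t) - Re (phi u)| < Re e / 2 by near: u.
have : `|Im (phi t) - Im (phi u)| < Re e / 2 by near: u.
lra.
Unshelve. all: by end_near. Qed.

(** The phase is written as an affine function, to which [bdd_expi] applies. *)
Definition trig (R : realType) (n : nat) (f : 'I_n -> R) (z : 'I_n -> R[i])
    (t : R) : R[i] := \sum_(i < n) z i * expi (2 * pi * f i * t + 0).

Lemma trig_bandlimited (R : realType) (a b : R) (n : nat) (f : 'I_n -> R)
    (z : 'I_n -> R[i]) :
  (forall i, a <= f i <= b) -> bandlimited a b (trig f z).
Proof.
move=> fab.
have bt : bdd (trig f z).
  apply: (@bdd_sum _ _ (fun i t => z i * expi (2 * pi * f i * t + 0))) => i.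
  exact: bddM (bdd_cst _) (bdd_expi _ _).
have [c1 c2 [K K0 hK]] := bt.
split; first exact: continuous_complex.
  exists (K + K) => t; have [k1 k2] := hK t; rewrite mulr1 in k1 k2.
  by apply: (le_trans (normc_le _)); exact: lerD.
move=> xi hxi; apply: contrapT => nxi; apply: hxi.
exists (~` `[a, b]%classic) => //; split.
  by apply: closed_openC; exact: interval_closed.
move=> psi tpsi sp; have [A sA] := test_supp_in tpsi; have [s1 s2 _] := tpsi.
have df := decay_fourier (conj s1 s2) sA.
rewrite /fourier_distr.
have dt i : decay (fun t => z i * (expi (2 * pi * f i * t + 0) * fourier psi t)).
  exact: bdd_decay (bdd_cst _) (bdd_decay (bdd_expi _ _) df).
rewrite (_ : (fun t => _) = fun t =>
  \sum_(i < n) z i * (expi (2 * pi * f i * t + 0) * fourier psi t)); last first.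
  by apply/funext => t; rewrite /trig mulr_suml; apply: eq_bigr => i _; rewrite mulrA.
have [_ ->] := cintegral_sum dt; apply: big1 => i _.
rewrite cintegralZ ?fourier_inversion_off ?mulr0//; last exact: bdd_decay (bdd_expi _ _) df.
by move=> /sp /=; rewrite in_itv /= fab.
Qed.

(** * Suprema and the distance *)

Lemma lebesgue_setT_gt0 (R : realType) : (0 < @lebesgue_measure R [set: R])%E.
Proof.
apply: (@lt_le_trans _ _ (@lebesgue_measure R `[0, 1]%classic)).
  by rewrite lebesgue_measure_itv /= lte_fin ltr01 -EFinB lte_fin subr0.
by apply: le_measure; rewrite ?inE.
Qed.

Lemma Linfty_le (R : realType) (D : set R) (f : R -> R[i]) (K : R) : 0 <= K ->
  (forall t, D t -> normc (f t) <= K) -> (Linfty_norm D f <= K%:E)%E.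
Proof.
move=> K0 hK; rewrite /Linfty_norm unlock lebesgue_setT_gt0; apply/ess_supP.
apply: aeW => t /=; rewrite patchE; case: ifPn => [|_]; last by rewrite abse0 lee_fin.
by rewrite inE => /hK; rewrite /= lee_fin ger0_norm ?normc_ge0.
Qed.

Lemma Linfty_ge0 (R : realType) (D : set R) (f : R -> R[i]) : (0 <= Linfty_norm D f)%E.
Proof.
rewrite /Linfty_norm unlock lebesgue_setT_gt0.
apply: ess_sup_gee; first exact: lebesgue_setT_gt0.
by apply: aeW => t; exact: abse_ge0.
Qed.

Lemma continuous_normc (R : realType) (f : R -> R[i]) :
  continuous (fun t => Re (f t)) -> continuous (fun t => Im (f t)) ->
  continuous (fun t => normc (f t)).
Proof.
move=> c1 c2; under eq_fun do rewrite normcE !expr2.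
move=> t; apply: continuous_comp; last exact: sqrt_continuous.
by apply: cvgD; apply: cvgM; by [exact: c1|exact: c2].
Qed.

(** If a continuous function exceeds [K] at a point of [D], it does so on an interval
contained in [D], which is not negligible. *)
Lemma Linfty_ge (R : realType) (D : set R) (f : R -> R[i]) (K : R) :
  continuous (fun t => Re (f t)) -> continuous (fun t => Im (f t)) ->
  (forall t d, D t -> 0 < d -> exists p q,
     p < q /\ forall u, p < u < q -> D u /\ `|t - u| < d) ->
  (Linfty_norm D f <= K%:E)%E -> forall t, D t -> normc (f t) <= K.
Proof.
move=> c1 c2 hD; rewrite /Linfty_norm unlock lebesgue_setT_gt0 => /ess_supP.
move=> [N [mN N0 sN]] t Dt; rewrite leNgt; apply/negP => Kt.
have cn := continuous_normc c1 c2.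
have e0 : 0 < normc (f t) - K by rewrite subr_gt0.
have := cn t => /cvgrPdist_lt /(_ _ e0) [d /= d0 hd].
have [p [q [pq hpq]]] := hD t d Dt d0.
have : (@lebesgue_measure R `]p, q[%classic <= @lebesgue_measure R N)%E.
  apply: le_measure; rewrite ?inE//.
  move=> u; rewrite /= in_itv /= => /hpq [Du tu]; apply: sN => /=.
  rewrite patchE mem_set//= lee_fin ger0_norm ?normc_ge0//.
  by have := hd u tu; rewrite ltr_norml => /andP[_ h1]; apply/negP; rewrite -ltNge; lra.
rewrite N0 lebesgue_measure_itv /= lte_fin pq -EFinB lee_fin subr_le0.
by rewrite leNgt pq.
Qed.

Lemma seg_dense (R : realType) (n : nat) : (0 < n)%N ->
  forall t d : R, `[- n%:R, n%:R]%classic t -> 0 < d -> exists p q,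
    p < q /\ forall u, p < u < q -> `[- n%:R, n%:R]%classic u /\ `|t - u| < d.
Proof.
move=> n0 t d; rewrite /= in_itv /= => /andP[t1 t2] d0.
have nR : 0 < n%:R :> R by rewrite ltr0n.
exists (Num.max (- n%:R) (t - d)), (Num.min n%:R (t + d)); split.
  by rewrite lt_min !gt_max; apply/andP; split; apply/andP; split; lra.
move=> u /andP[]; rewrite gt_max lt_min => /andP[u1 u2] /andP[u3 u4].
by rewrite in_itv /= ltr_norml; split; apply/andP; split; lra.
Qed.

Lemma sum_geom_tail (R : realType) (m N : nat) : (m <= N)%N ->
  \sum_(m <= n < N) (2 ^- n : R) <= 2 * 2 ^- m.
Proof.
move=> mN; have p0 n : 0 < 2 ^- n :> R by rewrite invr_gt0 exprn_gt0.
suff -> : \sum_(m <= n < N) (2 ^- n : R) = 2 * 2 ^- m - 2 * 2 ^- N by rewrite gerBl mulr_ge0// ltW.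
elim: N mN => [|N IH].
  by rewrite leqn0 => /eqP ->; rewrite big_geq// subrr.
rewrite leq_eqVlt => /orP[/eqP ->|]; first by rewrite big_geq// subrr.
rewrite ltnS => mN; rewrite big_nat_recr//= IH// (exprS _ N) invfM.
by field; rewrite ?expf_neq0//.
Qed.

Section distance.
Variables (R : realType) (f g : R -> R[i]).
Hypotheses (bf : bdd f) (bg : bdd g).
Let fg t := f t - g t.
Let L n := Linfty_norm `[(- n%:R)%R, n%:R%R] fg.

Lemma pow2V_gt0 n : 0 < 2 ^- n :> R. Proof. by rewrite invr_gt0 exprn_gt0. Qed.

Lemma term_ge0 n : (0 <= (2 ^- n)%:E * L n)%E.
Proof. by rewrite mule_ge0 ?Linfty_ge0// lee_fin ltW// pow2V_gt0. Qed.

Lemma bl_series_le (A e : R) (n0 : nat) : 0 <= A -> 0 <= e ->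
  (forall t, normc (fg t) <= A) -> (forall t, `|t| <= n0%:R -> normc (fg t) <= e) ->
  (\sum_(1 <= n <oo) ((2 ^- n)%:E * L n) <= (e + A * 2 ^- n0)%:E)%E.
Proof.
move=> A0 e0 hA he.
apply: lime_le; first by apply: is_cvg_nneseries => n _ _; exact: term_ge0.
apply: nearW => N.
have hn n : ((2 ^- n)%:E * L n <= (e * 2 ^- n + (if (n0 < n)%N then A * 2 ^- n else 0))%:E)%E.
  have [nn|nn] := ltnP n0 n.
    apply: (@le_trans _ _ ((2 ^- n)%:E * A%:E)%E).
      by apply: lee_wpmul2l; [rewrite lee_fin ltW// pow2V_gt0|apply: Linfty_le].
    by rewrite -EFinM lee_fin mulrC lerDr mulr_ge0// ltW// pow2V_gt0.
  apply: (@le_trans _ _ ((2 ^- n)%:E * e%:E)%E).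
    apply: lee_wpmul2l; [by rewrite lee_fin ltW// pow2V_gt0|apply: Linfty_le => // t].
    rewrite /= in_itv /= -ler_norml => tn; apply: he.
    by rewrite (le_trans tn)// ler_nat.
  by rewrite -EFinM lee_fin mulrC addr0.
apply: (@le_trans _ _ (\sum_(1 <= n < N)
    (e * 2 ^- n + (if (n0 < n)%N then A * 2 ^- n else 0))%:E)%E).
  by apply: lee_sum.
rewrite sumEFin lee_fin big_split /= lerD//.
  rewrite -mulr_sumr ler_piMr//.
  case: (leqP 1 N) => N1; last by rewrite big_geq// ltnW.
  by rewrite (le_trans (sum_geom_tail _ N1))// expr1 mulfV.
rewrite -big_mkcond /= -mulr_sumr ler_wpM2l//.
case: (leqP n0.+1 N) => N1; last first.
  rewrite big_nat_cond big_pred0; first by rewrite ltW// pow2V_gt0.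
  by move=> n; apply/negbTE; lia.
have -> : \sum_(1 <= n < N | (n0 < n)%N) (2 ^- n : R) = \sum_(n0.+1 <= n < N) (2 ^- n : R).
  rewrite (big_cat_nat (n := n0.+1))//= big_nat_cond big_pred0 ?add0r; last first.
    by move=> n; apply/negbTE; lia.
  by rewrite big_nat_cond [RHS]big_nat_cond; apply: eq_bigl => n; lia.
rewrite (le_trans (sum_geom_tail _ N1))// exprS invfM mulrA mulfV ?mul1r//.
Qed.

Lemma bl_dist_le (A e : R) (n0 : nat) : 0 <= A -> 0 <= e ->
  (forall t, normc (f t - g t) <= A) ->
  (forall t, `|t| <= n0%:R -> normc (f t - g t) <= e) ->
  bl_dist f g <= e + A * 2 ^- n0.
Proof.
move=> A0 e0 hA he; have h := bl_series_le A0 e0 hA he.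
rewrite -lee_fin; apply: le_trans h; rewrite /bl_dist.
have s0 : (0 <= \sum_(1 <= n <oo) ((2 ^- n)%:E * L n))%E.
  by apply: nneseries_ge0 => n _ _; exact: term_ge0.
rewrite fineK// ge0_fin_numE//; apply: le_lt_trans (bl_series_le A0 e0 hA he) _.
exact: ltry.
Qed.

Lemma bl_dist_ge (n : nat) (t : R) : (0 < n)%N -> `|t| <= n%:R ->
  normc (f t - g t) <= 2 ^+ n * bl_dist f g.
Proof.
move=> n0 tn; have [c1 c2 [K K0 hK]] := dominatedD bf (dominatedN bg).
have hA u : normc (fg u) <= K + K.
  have [k1 k2] := hK u; rewrite mulr1 in k1 k2.
  by apply: (le_trans (normc_le _)); exact: lerD.
have h := bl_series_le (addr_ge0 K0 K0) (addr_ge0 K0 K0) hA (fun u (_ : `|u| <= 0%:R) => hA u).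
have s0 : (0 <= \sum_(1 <= n <oo) ((2 ^- n)%:E * L n))%E.
  by apply: nneseries_ge0 => k _ _; exact: term_ge0.
have fs : (\sum_(1 <= n <oo) ((2 ^- n)%:E * L n))%E \is a fin_num.
  by rewrite ge0_fin_numE//; apply: le_lt_trans h _; exact: ltry.
have tl : ((2 ^- n)%:E * L n <= (bl_dist f g)%:E)%E.
  rewrite /bl_dist fineK//.
  apply: (@le_trans _ _ (\sum_(1 <= i < n.+1) ((2 ^- i)%:E * L i))%E); last first.
    by apply: nneseries_lim_ge => k _ _; exact: term_ge0.
  by rewrite big_nat_recr//= leeDr// sume_ge0// => k _; exact: term_ge0.
apply: (@Linfty_ge _ `[(- n%:R)%R, n%:R%R]%classic fg) => //.
- exact: seg_dense.
- have := @lee_wpmul2l _ (2 ^+ n)%:E _ _ _ tl; rewrite muleA -!EFinM mulfV ?expf_neq0//.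
  by rewrite mul1e; apply; rewrite lee_fin exprn_ge0.
- by rewrite /= in_itv /= -ler_norml.
Qed.

End distance.

Lemma ball_normc_le1 (R : realType) (a b : R) (phi : R -> R[i]) :
  bandlimited_ball a b phi -> band a b phi /\ forall t, normc (phi t) <= 1.
Proof.
move=> [bphi h1]; have bd := bandlimited_band bphi; split => // t.
have [[c1 c2 _] _] := bd.
apply: (@Linfty_ge _ setT phi 1) => // u d _ d0; exists (u - d), (u + d); split; first by lra.
by move=> v /andP[v1 v2]; split => //; rewrite ltr_norml; apply/andP; split; lra.
Qed.

(** Translating [phi] modulates the test functions paired with its transform, which
does not move their supports. *)
Lemma bandlimited_shift (R : realType) (a b : R) (phi : R -> R[i]) :
  bandlimited a b phi -> bandlimited a b (unit_shift phi).
Proof.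
move=> bphi; have [bd _] := bandlimited_band bphi.
move: bphi => [cphi [K hK] sphi]; have [c1 c2] := continuous_Re_Im cphi; split.
- by apply: continuous_complex; [exact: (continuous_translate c1)|exact: (continuous_translate c2)].
- by exists K => t; exact: hK.
move=> xi hxi; apply: sphi => -[U [oU vU] Uxi]; apply: hxi; exists U => //; split => //.
move=> psi tpsi sp; have [A sA] := test_supp_in tpsi; have [s1 s2 _] := tpsi.
pose chi x := expi (2 * pi * 1 * x + 0) * psi x.
have sc : smooth (fun x : R => cos (2 * pi * 1 * x + 0)) by apply: smooth_affine; exact: smooth_cos.
have ss : smooth (fun x : R => sin (2 * pi * 1 * x + 0)) by apply: smooth_affine; exact: smooth_sin.
have cchi : csmooth chi.
  split; rewrite /chi.
    under eq_fun do rewrite ReM /=.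
    by apply: smoothB; [exact: smoothM sc s1|exact: smoothM ss s2].
  under eq_fun do rewrite ImM /=.
  by apply: smoothD; [exact: smoothM sc s2|exact: smoothM ss s1].
have chi0 t : chi t != 0 -> psi t != 0.
  by apply: contra => /eqP pt; rewrite /chi pt mulr0.
have schi : supp_in (- A) A chi by move=> t /chi0 /sA.
have <- : fourier_distr phi chi = 0.
  apply: vU; first exact: supp_in_test schi.
  by apply: subset_trans sp; apply: closure_subset => t /chi0.
rewrite /fourier_distr.
have dc : decay (fun t => phi t * fourier chi t).
  exact: bdd_decay bd (decay_fourier cchi schi).
rewrite -(cintegral_translate 1 dc); congr cintegral; apply/funext => t.
congr (_ * _); rewrite /fourier; congr cintegral; apply/funext => x.
by rewrite /chi mulrA -expiD; congr (expi _ * _); ring.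
Qed.

Lemma ball_shift (R : realType) (a b : R) (phi : R -> R[i]) :
  bandlimited_ball a b phi -> bandlimited_ball a b (unit_shift phi).
Proof.
move=> h; have [_ h1] := ball_normc_le1 h; split; first exact: bandlimited_shift h.1.
by apply: Linfty_le => // t _; exact: h1.
Qed.

(** * Covering numbers of balls of trigonometric polynomials *)

Lemma expi_eq1 (R : realType) (D m : nat) : (0 < m < D)%N ->
  expi (2 * pi * (m%:R / D%:R)) != 1 :> R[i].
Proof.
move=> /andP[m0 mD]; apply/eqP => /(congr1 (@complex.Re R)) /=.
have DN : (0 < D)%N by lia.
have D0 : 0 < D%:R :> R by rewrite ltr0n.
pose x : R := pi * (m%:R / D%:R).
have -> : 2 * pi * (m%:R / D%:R) = x *+ 2 by rewrite -(mulr_natl x 2) /x mulrA.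
rewrite cos_mulr2n => c1.
have s0 : 0 < sin x.
  apply: sin_gt0_pi; rewrite /x mulr_gt0 ?pi_gt0 ?divr_gt0 ?ltr0n//=.
  by rewrite gtr_pMr ?pi_gt0// ltr_pdivrMr// mul1r ltr_nat.
have := cos2Dsin2 x; have : 0 < sin x ^+ 2 by exact: exprn_gt0.
move: c1; rewrite -(mulr_natl _ 2); lra.
Qed.

Lemma expi_nat (R : realType) (n : nat) : expi (2 * pi * n%:R) = 1 :> R[i].
Proof. by rewrite /expi cos_pi_even sin_pi_even. Qed.

Lemma expiX (R : realType) (x : R) (l : nat) : expi (x * l%:R) = expi x ^+ l.
Proof.
elim: l => [|l IH]; first by rewrite mulr0 expi0 expr0.
by rewrite -natr1 mulrDr mulr1 expiD IH exprSr.
Qed.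

Lemma expiN_mul (R : realType) (x : R) : expi (- x) * expi x = 1.
Proof. by rewrite -expiD addNr expi0. Qed.

Lemma sum_roots (R : realType) (D j k : nat) : (j < D)%N -> (k < D)%N ->
  \sum_(l < D) expi (2 * pi * ((j%:R - k%:R) / D%:R) * l%:R) =
  (if j == k then D%:R else 0) :> R[i].
Proof.
move=> jD kD; have D0 : D%:R != 0 :> R by rewrite pnatr_eq0; lia.
case: eqP => [->|jk].
  rewrite (eq_bigr (fun=> 1)); first by rewrite sumr_const card_ord.
  by move=> l _; rewrite subrr mul0r mulr0 mul0r expi0.
pose w : R[i] := expi (2 * pi * ((j%:R - k%:R) / D%:R)).
have wD : w ^+ D = 1.
  rewrite /w -expiX -mulrA divfK//.
  case: (leqP k j) => kj; first by rewrite -natrB// expi_nat.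
  have := expiN_mul (2 * pi * (j%:R - k%:R) : R).
  have -> : - (2 * pi * (j%:R - k%:R)) = 2 * pi * (k - j)%:R :> R.
    by rewrite (natrB _ (ltnW kj)); ring.
  by rewrite expi_nat mul1r.
have w1 : w != 1.
  rewrite /w; case: (ltngtP k j) => [kj|kj|]; last by move=> e; case: jk.
    by rewrite -(natrB _ (ltnW kj)) expi_eq1//; lia.
  apply/eqP => e; have := expiN_mul (2 * pi * ((j%:R - k%:R) / D%:R) : R).
  rewrite e mulr1 (_ : - _ = 2 * pi * ((k - j)%:R / D%:R)); last first.
    by rewrite (natrB _ (ltnW kj)); ring.
  by apply/eqP; rewrite expi_eq1//; lia.
rewrite (eq_bigr (fun l : 'I_D => w ^+ l)); last by move=> l _; rewrite expiX.
have : (w - 1) * \sum_(i < D) w ^+ i = 0 by rewrite -subrX1 wD subrr.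
by move/eqP; rewrite mulf_eq0 subr_eq0 (negbTE w1) => /eqP.
Qed.

Section trig_entropy.
Variables (R : realType) (D M : nat) (j0 : int).
Hypotheses (M0 : (0 < M)%N).

Let freq (j : 'I_D) : R := (j0%:~R + j%:R) / M%:R.
Let tp (z : 'I_D -> R[i]) := trig freq z.

Lemma tpB (z w : 'I_D -> R[i]) t : tp (fun j => z j - w j) t = tp z t - tp w t.
Proof. by rewrite /tp /trig -sumrB; apply: eq_bigr => j _; rewrite mulrBl. Qed.

Lemma tpD (z w : 'I_D -> R[i]) t : tp (fun j => z j + w j) t = tp z t + tp w t.
Proof. by rewrite /tp /trig -big_split; apply: eq_bigr => j _; rewrite mulrDl. Qed.

Lemma tpZ (c : R[i]) (z : 'I_D -> R[i]) t : tp (fun j => c * z j) t = c * tp z t.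
Proof. by rewrite /tp /trig big_distrr; apply: eq_bigr => j _; rewrite /= mulrA. Qed.

Lemma normc_sum (n : nat) (f : 'I_n -> R[i]) :
  normc (\sum_(i < n) f i) <= \sum_(i < n) normc (f i).
Proof.
elim: n f => [|n IH] f; first by rewrite !big_ord0 Normc.normc0.
by rewrite !big_ord_recr /= (le_trans (le_normcD _ _))// lerD.
Qed.

Lemma tp_le_sum z t : normc (tp z t) <= \sum_(j < D) normc (z j).
Proof.
apply: (le_trans (normc_sum _)); apply: ler_sum => j _.
by rewrite Normc.normcM normc_expi mulr1.
Qed.

(** The coefficient is the mean of [tp z t] times a conjugate exponential over [D]
equidistant points of a period, by discrete orthogonality. *)
Lemma coef_le_tp z (q : R) (k : 'I_D) :
  (forall t, normc (tp z t) <= q) -> normc (z k) <= q.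
Proof.
move=> hq; have D0 : 0 < D%:R :> R by rewrite ltr0n (leq_trans _ (ltn_ord k)).
have Mn0 : M%:R != 0 :> R by rewrite pnatr_eq0; lia.
have Dn0 : D%:R != 0 :> R by rewrite gt_eqF.
pose t (l : nat) : R := l%:R * M%:R / D%:R.
have e : \sum_(l < D) tp z (t l) * expi (- (2 * pi * freq k * t l)) = D%:R * z k.
  rewrite /tp /trig; under eq_bigr do rewrite mulr_suml.
  rewrite exchange_big /=.
  have hj (j : 'I_D) : \sum_(l < D) z j * expi (2 * pi * freq j * t l + 0) *
      expi (- (2 * pi * freq k * t l)) = z j * (if j == k then D%:R else 0).
    rewrite -(@sum_roots R D j k)// mulr_sumr; apply: eq_bigr => l _.
    rewrite -mulrA -expiD; congr (_ * expi _); rewrite /freq /t; field.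
    by rewrite Mn0 Dn0.
  rewrite (eq_bigr _ (fun j _ => hj j)) (bigD1 k) //= eqxx big1; last first.
    by move=> j jk; rewrite (negbTE jk) mulr0.
  by rewrite addr0 mulrC.
have nD : normc (D%:R * z k) = D%:R * normc (z k).
  rewrite Normc.normcM; congr (_ * _).
  rewrite -(mulr_natr 1) mul1r -[X in normc (X%:R)]/D.
  have -> : D%:R = (D%:R%:C)%C :> R[i] by rewrite rmorph_nat.
  by rewrite normcE /= expr0n addr0 sqrtr_sqr ger0_norm.
rewrite -(ler_pM2l D0) -nD -e (le_trans (normc_sum _))//.
have -> : D%:R * q = \sum_(l < D) q by rewrite sumr_const card_ord mulr_natl.
by apply: ler_sum => l _; rewrite Normc.normcM normc_expi mulr1.
Qed.

Lemma tp_periodic z t : tp z (t + M%:R) = tp z t.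
Proof.
have Mn0 : M%:R != 0 :> R by rewrite pnatr_eq0; lia.
apply: eq_bigr => j _; congr (_ * _).
have -> : 2 * pi * freq j * (t + M%:R) + 0 =
   2 * pi * freq j * t + 0 + 2 * pi * (j0%:~R + j%:R).
  by rewrite /freq; field.
rewrite expiD [X in _ * X](_ : _ = 1) ?mulr1//.
have -> : j0%:~R + j%:R = (j0 + j%:Z)%:~R :> R by rewrite rmorphD.
case: (j0 + j%:Z) => n; first by rewrite -pmulrn expi_nat.
have := expiN_mul (2 * pi * n.+1%:R : R); rewrite expi_nat mulr1 => <-.
by rewrite NegzE mulrNz; congr expi; rewrite -pmulrn; ring.
Qed.

(** Each ball of the covering at scale [q ^ k] is covered by a scaled and translated
copy of the given covering. *)
Lemma cover_iterate (n : nat) (R0 q : R) (p : 'I_n -> 'I_D -> R[i]) :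
  0 < q -> 0 < R0 ->
  (forall z, (forall t, normc (tp z t) <= R0) ->
    exists i, forall t, normc (tp z t - tp (p i) t) <= q * R0) ->
  forall k : nat, exists c : 'I_(n ^ k) -> 'I_D -> R[i],
    forall z, (forall t, normc (tp z t) <= R0) ->
    exists i, forall t, normc (tp z t - tp (c i) t) <= q ^+ k * R0.
Proof.
move=> q0 R00 hp; elim=> [|k [c hc]].
  exists (fun _ _ => 0) => z hz; exists (Ordinal (ltn0Sn 0)) => t.
  rewrite expr0 mul1r [X in _ - X](_ : _ = 0) ?subr0; first exact: hz.
  by rewrite /tp /trig big1// => j _; rewrite mul0r.
have qk : 0 < q ^+ k by rewrite exprn_gt0.
pose T := ('I_(n ^ k) * 'I_n)%type.
have cT : #|{: T}| = (n ^ k.+1)%N by rewrite card_prod !card_ord expnS mulnC.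
pose idx (i : 'I_(n ^ k.+1)) : T := enum_val (cast_ord (esym cT) i).
exists (fun i j => c (idx i).1 j + (q ^+ k)%:C%C * p (idx i).2 j) => z hz.
have [i hi] := hc z hz.
pose w j := ((q ^+ k)^-1)%:C%C * (z j - c i j).
have qC : (q ^+ k)%:C%C * ((q ^+ k)^-1)%:C%C = 1 :> R[i].
  by rewrite -rmorphM /= mulfV ?gt_eqF// rmorph1.
have nC (r : R) : 0 <= r -> normc (r%:C)%C = r.
  by move=> r0; rewrite normcE /= expr0n addr0 sqrtr_sqr ger0_norm.
have hw t : normc (tp w t) <= R0.
  rewrite tpZ Normc.normcM tpB nC; last by rewrite invr_ge0 ltW.
  by rewrite mulrC ler_pdivrMr// [leRHS]mulrC.
have [i' hi'] := hp w hw.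
pose ii : 'I_(n ^ k.+1) := cast_ord cT (enum_rank ((i, i') : T)).
have iiE : idx ii = (i, i') by rewrite /idx /ii cast_ordK enum_rankK.
exists ii => t; rewrite iiE /= tpD tpZ.
have -> : tp z t - (tp (c i) t + (q ^+ k)%:C%C * tp (p i') t) =
   (q ^+ k)%:C%C * (tp w t - tp (p i') t).
  by rewrite mulrBr /w tpZ mulrA qC mul1r tpB opprD addrA.
rewrite Normc.normcM nC; last exact: ltW.
by rewrite exprSr -mulrA ler_pM2l.
Qed.

(** The substitute for a comparison of volumes: at scale [q ^ k] the members of the
iterated covering separate a grid of about [(q ^ - k / (16 D)) ^ (2 D)]
coefficient vectors.  The loss [16 D] of this comparison becomes irrelevant in
the [k]-th root. *)
Lemma cover_ball_ge (n : nat) (R0 q : R) (p : 'I_n -> 'I_D -> R[i]) :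
  0 < q -> q < 1 -> 0 < R0 ->
  (forall z, (forall t, normc (tp z t) <= R0) ->
    exists i, forall t, normc (tp z t - tp (p i) t) <= q * R0) ->
  (2 * D)%:R * ln q^-1 <= ln n%:R :> R.
Proof.
move=> q0 q1 R00 hp.
have n0 : (0 < n)%N.
  have [t|i _] := hp (fun=> 0); last exact: leq_trans (ltn_ord i).
  rewrite (_ : tp _ t = 0) ?Normc.normc0 ?ltW//.
  by rewrite /tp /trig big1// => j _; rewrite mul0r.
have [D0|D0] := posnP D.
  by rewrite D0 muln0 mul0r ln_ge0// ler1n.
have DR : 0 < D%:R :> R by rewrite ltr0n.
(* two grid points with the same centre have coefficients closer than the mesh, by
   [coef_le_tp], and are equal *)
have grid (k G : nat) : (0 < G)%N -> 4 * D%:R * G%:R * q ^+ k < 1 -> (G ^ (2 * D) <= n ^ k)%N.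
  move=> G0 Gk; have [c hc] := cover_iterate q0 R00 hp k.
  have GR : 0 < G%:R :> R by rewrite ltr0n.
  have [eta etaE] : exists e, e = R0 / (2 * D%:R * G%:R) by eexists.
  have eta0 : 0 < eta by rewrite etaE divr_gt0// !mulr_gt0.
  pose T := {ffun 'I_D -> 'I_G * 'I_G}.
  pose g (m : T) j : R[i] := Complex (eta * (m j).1%:R) (eta * (m j).2%:R).
  have gB m t : normc (tp (g m) t) <= R0.
    apply: (le_trans (tp_le_sum _ _)).
    apply: (@le_trans _ _ (\sum_(j < D) (eta * (2 * G%:R)))).
      apply: ler_sum => j _; apply: (le_trans (normc_le _)) => /=.
      rewrite !normrM (gtr0_norm eta0) !normr_nat -mulrDr ler_pM2l//.
      by rewrite mulr_natl mulr2n lerD// ler_nat ltnW.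
    rewrite sumr_const card_ord -mulr_natl etaE.
    by rewrite le_eqVlt; apply/orP; left; apply/eqP; field; rewrite !gt_eqF.
  have /choice [f hf] : forall m : T, exists i, forall t,
      normc (tp (g m) t - tp (c i) t) <= q ^+ k * R0.
    by move=> m; exact: hc (gB m).
  have finj : injective f.
    move=> m m' ff; apply/ffunP => j.
    have d t : normc (tp (fun j => g m j - g m' j) t) <= 2 * (q ^+ k * R0).
      rewrite tpB (_ : _ - _ = (tp (g m) t - tp (c (f m)) t) - (tp (g m') t - tp (c (f m')) t)).
        by rewrite (le_trans (le_normcD _ _))// normcN mulr_natl mulr2n lerD.
      by rewrite ff opprB addrA subrK.
    have := coef_le_tp j d.
    have small : 2 * (q ^+ k * R0) < eta.
      rewrite etaE ltr_pdivlMr ?mulr_gt0//.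
      have -> : 2 * (q ^+ k * R0) * (2 * D%:R * G%:R) = R0 * (4 * D%:R * G%:R * q ^+ k) by ring.
      by rewrite -[ltRHS]mulr1 ltr_pM2l.
    have sep (x y : 'I_G) : `|eta * x%:R - eta * y%:R| < eta -> x = y.
      rewrite -mulrBr normrM gtr0_norm// -[ltRHS]mulr1 ltr_pM2l// => xy.
      apply/val_inj/eqP => /=; rewrite eq_sym eqn_leq.
      move: xy; rewrite ltr_norml => /andP[? ?].
      by apply/andP; split; rewrite -ltnS -(ltr_nat R) -natr1; lra.
    move=> h; have := Re_le_normc (g m j - g m' j); have := Im_le_normc (g m j - g m' j).
    rewrite ReD ImD ReN ImN /= => hi hr.
    have e1 := sep _ _ (le_lt_trans (le_trans hr h) small).
    have e2 := sep _ _ (le_lt_trans (le_trans hi h) small).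
    by move: e1 e2; case: (m j) (m' j) => x1 x2 [y1 y2] /= -> ->.
  have := leq_card f finj.
  by rewrite card_ffun card_prod !card_ord mulnn -expnM.
have lnq : 0 < ln q^-1 :> R by rewrite ln_gt0// invf_gt1.
have step (k : nat) : 1 <= (8 * D%:R * q ^+ k)^-1 ->
    k%:R * ((2 * D)%:R * ln q^-1 - ln n%:R) <= (2 * D)%:R * ln (16 * D%:R) :> R.
  move=> hk; have qk : 0 < q ^+ k by rewrite exprn_gt0.
  set y := (8 * D%:R * q ^+ k)^-1 in hk *.
  have y0 : 0 <= y by exact: le_trans hk.
  have /andP[t1 t2] := truncn_itv y0.
  set G := Num.truncn y in t1 t2.
  have G0 : (0 < G)%N by rewrite truncn_gt0.
  have GR : 0 < G%:R :> R by rewrite ltr0n.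
  have p8 : 0 < 8 * D%:R * q ^+ k by rewrite !mulr_gt0.
  have hG : 4 * D%:R * G%:R * q ^+ k < 1.
    have : G%:R * (8 * D%:R * q ^+ k) <= 1 by rewrite -ler_pdivlMr// div1r.
    have := mulr_gt0 GR p8; lra.
  have := grid k G G0 hG.
  have Gy : y / 2 <= G%:R.
    have : 1 <= G%:R :> R by rewrite ler1n.
    by move: t2; rewrite -natr1; lra.
  rewrite -(ler_nat R) !natrX => h.
  have h1 : (2 * D)%:R * ln (G%:R : R) <= k%:R * ln n%:R.
    rewrite !mulr_natl -!lnXn ?ltr0n//.
    by rewrite ler_ln ?posrE ?exprn_gt0 ?ltr0n.
  have h2 : ln (y / 2) <= ln (G%:R : R) by rewrite ler_ln ?posrE// divr_gt0// (lt_le_trans _ hk).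
  have yE : y / 2 = (16 * D%:R)^-1 * (q^-1) ^+ k.
    by rewrite /y exprVn; field; rewrite !gt_eqF// exprn_gt0.
  have l1 : ln (16 * D%:R)^-1 = - ln (16 * D%:R) :> R by rewrite lnV// posrE mulr_gt0.
  have l2 : ln (q^-1 ^+ k) = k%:R * ln q^-1 by rewrite lnXn ?invr_gt0// mulr_natl.
  have p1 : (16 * D%:R)^-1 \is @Num.pos R by rewrite posrE invr_gt0 mulr_gt0.
  have p2 : q^-1 ^+ k \is Num.pos by rewrite posrE exprn_gt0// invr_gt0.
  rewrite yE (lnM p1 p2) l1 l2 in h2.
  have D2 : 0 <= (2 * D)%:R :> R by [].
  have h3 := ler_wpM2l D2 h2.
  move: (ln q^-1) (ln n%:R) (ln (16 * D%:R)) ((2 * D)%:R : R) h1 h3.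
  by move=> u v w x h1 h3; lra.
rewrite leNgt; apply/negP => bad; set e := (2 * D)%:R * ln q^-1 - ln n%:R in step.
have e0 : 0 < e by rewrite subr_gt0.
have c0 : 0 <= ln (16 * D%:R) :> R.
  by rewrite ln_ge0// -natrM ler1n muln_gt0.
pose B := (2 * D)%:R * ln (16 * D%:R) / e + ln (16 * D%:R) / ln q^-1.
have B0 : 0 <= B by rewrite addr_ge0// !mulr_ge0// invr_ge0 ltW.
have := archi_boundP B0; set k := Num.bound B => hk.
have k1 : (2 * D)%:R * ln (16 * D%:R) / e < k%:R.
  by apply: le_lt_trans hk; rewrite lerDl mulr_ge0// invr_ge0 ltW.
have k2 : ln (16 * D%:R) / ln q^-1 < k%:R.
  by apply: le_lt_trans hk; rewrite lerDr !mulr_ge0// invr_ge0 ltW.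
have := step k; apply/implyP; rewrite negb_imply -ltNge; apply/andP; split; last first.
  by rewrite -ltr_pdivrMr.
have qk : 0 < q ^+ k by rewrite exprn_gt0.
rewrite invf_ge1 ?mulr_gt0//; apply: (@le_trans _ _ (16 * D%:R * q ^+ k)).
  by rewrite (ler_pM2r qk) (ler_pM2r DR) ler_nat.
rewrite -ler_pdivlMr// div1r -exprVn -ler_ln ?posrE ?mulr_gt0 ?exprn_gt0 ?invr_gt0//.
by move: k2; rewrite lnXn ?invr_gt0// ltr_pdivrMr// (mulr_natl _ k) => /ltW.
Qed.

End trig_entropy.

(** * Lower bound for covering numbers *)

Lemma iter_unit_shift (R : realType) (phi : R -> R[i]) (m : nat) (t : R) :
  iter m (@unit_shift R) phi t = phi (t + m%:R).
Proof.
elim: m t => [|m IH] t; first by rewrite addr0.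
by rewrite iterS /unit_shift IH -natr1 -addrA (addrC 1).
Qed.

Lemma dyn_dist_le (R : realType) (E : Type) (d : E -> E -> R) (T : E -> E)
    (M : nat) (x y : E) (q : R) : 0 <= q ->
  (forall m, (m < M)%N -> d (iter m T x) (iter m T y) <= q) ->
  dyn_dist d T M x y <= q.
Proof. by move=> q0 h; apply: bigmax_le => // i _; exact: h. Qed.

Lemma dyn_dist_ge (R : realType) (E : Type) (d : E -> E -> R) (T : E -> E)
    (M m : nat) (x y : E) : (m < M)%N ->
  d (iter m T x) (iter m T y) <= dyn_dist d T M x y.
Proof.
move=> mM; exact: (le_bigmax 0 (fun i : 'I_M => d (iter i T x) (iter i T y)) (Ordinal mM)).
Qed.

Lemma dist_diamP (R : realType) (E : Type) (d : E -> E -> R) (U : set E) (q : R) :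
  (dist_diam d U <= q%:E)%E <-> forall x y, U x -> U y -> d x y <= q.
Proof.
split=> [h x y Ux Uy|h].
  rewrite -lee_fin; apply: le_trans h; apply: ereal_sup_ubound.
  by exists (x, y).
by apply: ge_ereal_sup => _ [[x y] [/= Ux Uy] <-]; rewrite lee_fin h.
Qed.

Lemma bdd_iter (R : realType) (phi : R -> R[i]) (m : nat) :
  bdd phi -> bdd (iter m (@unit_shift R) phi).
Proof.
rewrite (_ : iter m _ phi = fun t => phi (t + m%:R)); last first.
  by apply/funext => t; exact: iter_unit_shift.
move=> [c1 c2 [K K0 hK]]; split.
- exact: (@continuous_translate _ (fun t => Re (phi t)) _ c1).
- exact: (@continuous_translate _ (fun t => Im (phi t)) _ c2).
- by exists K => // t; exact: hK.
Qed.

(** The sup norm on [[- n, n]] enters the distance with the weight [2 ^ - n], and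
translation by [m < M] is built into the dynamical distance: values in [[0, M]]
are controlled up to a factor 2. *)
Lemma dyn_normc (R : realType) (f g : R -> R[i]) (M m n : nat) (t : R) :
  bdd f -> bdd g -> (m < M)%N -> (0 < n)%N -> `|t - m%:R| <= n%:R ->
  normc (f t - g t) <= 2 ^+ n * dyn_dist (@bl_dist R) (@unit_shift R) M f g.
Proof.
move=> bf bg mM n0 tm.
have := bl_dist_ge (bdd_iter m bf) (bdd_iter m bg) n0 tm.
rewrite !iter_unit_shift subrK => /le_trans; apply.
by rewrite ler_pM2l ?exprn_gt0//; exact: dyn_dist_ge.
Qed.

Lemma near_index (R : realType) (M : nat) (t : R) : (0 < M)%N -> 0 <= t -> t <= M%:R ->
  exists2 m, (m < M)%N & `|t - m%:R| <= 1.
Proof.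
move=> M0 t0 tM; have /andP[h1 h2] := truncn_itv t0.
case: (ltnP (Num.truncn t) M) => hM.
  exists (Num.truncn t) => //; rewrite -natr1 in h2.
  by rewrite ler_norml; apply/andP; split; lra.
exists M.-1; first by lia.
have e : M%:R = M.-1%:R + 1 :> R by rewrite natr1 prednK.
have : M%:R <= (Num.truncn t)%:R :> R by rewrite ler_nat.
by rewrite ler_norml => ?; apply/andP; split; lra.
Qed.

Lemma tp_periodic_int (R : realType) (D M : nat) (j0 : int) (z : 'I_D -> R[i]) :
  (0 < M)%N -> forall (k : int) (t : R),
  trig (fun j : 'I_D => (j0%:~R + j%:R) / M%:R) z (t + k%:~R * M%:R) =
  trig (fun j : 'I_D => (j0%:~R + j%:R) / M%:R) z t.
Proof.
move=> M0; have hn (n : nat) t : trig (fun j : 'I_D => (j0%:~R + j%:R) / M%:R) z (t + n%:R * M%:R) =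
  trig (fun j : 'I_D => (j0%:~R + j%:R) / M%:R) z t.
  elim: n => [|n IH]; first by rewrite mul0r addr0.
  by rewrite -natr1 mulrDl mul1r addrA (tp_periodic j0 M0).
case=> n t; first by rewrite -pmulrn hn.
by rewrite NegzE mulrNz -pmulrn -(hn n.+1) mulNr subrK.
Qed.

(** [[a, b]] contains [D] consecutive multiples of [1/M], so that the ball contains a
ball of a space of [M]-periodic trigonometric polynomials of dimension [D]. *)
Lemma ball_cover_ge (R : realType) (a b r rho : R) (M n : nat) :
  a < b -> (0 < M)%N -> 0 < rho -> rho < r / 4 -> r <= 1 ->
  covered_by (bandlimited_ball a b) (dyn_dist (@bl_dist R) (@unit_shift R) M)
    (dist_cball (bandlimited_ball a b) (dyn_dist (@bl_dist R) (@unit_shift R) M)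
       (fun=> 0) r) rho n ->
  (2 * Num.truncn ((b - a) * M%:R))%:R * ln (r / (4 * rho)) <= ln n%:R :> R.
Proof.
move=> ab M0 rho0 rr r1 [U [hU cU]].
set dM := dyn_dist _ _ _ in hU cU.
set D := Num.truncn _; pose j0 : int := Num.ceil (a * M%:R).
have MR : 0 < M%:R :> R by rewrite ltr0n.
pose freq (j : 'I_D) : R := (j0%:~R + j%:R) / M%:R.
have abM : 0 <= (b - a) * M%:R by rewrite mulr_ge0 ?ltW// subr_gt0.
have freqP j : a <= freq j <= b.
  have /andP[t1 _] := truncn_itv abM.
  have c1 : a * M%:R <= j0%:~R by exact: ceil_ge.
  have c2 : j0%:~R < a * M%:R + 1 by have := ceilB1_lt (a * M%:R); rewrite -/j0 rmorphB /=; lra.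
  have jD : j.+1%:R <= D%:R :> R by rewrite ler_nat.
  rewrite -natr1 in jD; rewrite /freq ler_pdivlMr// ler_pdivrMr//.
  have j_ge : 0 <= j%:R :> R by [].
  by apply/andP; split; rewrite -/D in t1; lra.
have r0 : 0 < r by lra.
(* the distance to 0 is at most twice the sup norm, and sets of diameter [rho] have
   diameter [2 rho = q R0] for the sup norm *)
pose R0 := r / 2; pose q := 4 * rho / r.
have R00 : 0 < R0 by rewrite divr_gt0.
have q0 : 0 < q by rewrite divr_gt0// mulr_gt0.
have q1 : q < 1 by rewrite /q ltr_pdivrMr//; lra.
have qV : r / (4 * rho) = q^-1 by rewrite /q invf_div.
have trig0 t : trig freq (fun=> 0) t = 0.
  by rewrite /trig big1// => j _; rewrite mul0r.
have bd0 : bdd (fun=> 0 : R[i]) := bdd_cst 0.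
have inB z : (forall t, normc (trig freq z t) <= R0) ->
    dist_cball (bandlimited_ball a b) dM (fun=> 0) r (trig freq z).
  move=> hz; have bz : bandlimited a b (trig freq z) by exact: trig_bandlimited.
  split.
    split=> //; apply: Linfty_le => // t _; apply: le_trans (hz t) _.
    by rewrite /R0; lra.
  apply: dyn_dist_le => [|m mM]; first exact: ltW.
  have h t : normc (iter m (@unit_shift R) (fun=> 0) t -
      iter m (@unit_shift R) (trig freq z) t) <= R0.
    by rewrite !iter_unit_shift sub0r normcN.
  have := @bl_dist_le R _ _ R0 R0 0%N (ltW R00) (ltW R00) h (fun t _ => h t).
  by move=> /le_trans; apply; rewrite expr0 invr1 mulr1 /R0; lra.
have bz z : bdd (trig freq z).
  by have [] := bandlimited_band (trig_bandlimited z freqP).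
have close z w : dM (trig freq z) (trig freq w) <= rho ->
    forall t, normc (trig freq z t - trig freq w t) <= q * R0.
  move=> zw t; pose k := Num.floor (t / M%:R).
  have k1 : k%:~R * M%:R <= t by rewrite -ler_pdivlMr// floor_le_tmp.
  have k2 : t < k%:~R * M%:R + M%:R.
    have := floorD1_gt (t / M%:R); rewrite -/k rmorphD /= ltr_pdivrMr// mulrDl mul1r.
    exact.
  set s := t - k%:~R * M%:R.
  have -> : t = s + k%:~R * M%:R by rewrite /s subrK.
  rewrite !tp_periodic_int//.
  have [m mM sm] := @near_index R M s M0 (ltac:(rewrite /s; lra)) (ltac:(rewrite /s; lra)).
  apply: (le_trans (@dyn_normc R _ _ M m 1 s (bz z) (bz w) mM isT sm)).
  rewrite expr1 (_ : q * R0 = 2 * rho); first by rewrite ler_pM2l.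
  by rewrite /q /R0; field; rewrite gt_eqF.
have /choice [p hp] : forall i, exists p, forall z,
    (forall t, normc (trig freq z t) <= R0) -> U i (trig freq z) ->
    U i (trig freq p).
  move=> i; case: (pselect (exists2 z, (forall t, normc (trig freq z t) <= R0) &
      U i (trig freq z))) => [[p _ Up]|no]; first by exists p.
  by exists (fun=> 0) => z hz Uz; case: no; exists z.
rewrite qV; apply: (@cover_ball_ge R D M j0 M0 n R0 q p q0 q1 R00) => z hz.
have [i _ Ui] := cU _ (inB z hz).
have [_ /dist_diamP hd] := hU i.
exists i; apply: close; apply: hd => //.
exact: hp Ui.
Qed.

(** * Upper bound for covering numbers *)

Lemma fin_slack (R : realType) (J : finType) (p : J -> R) :
  (forall j, 0 < p j) -> exists2 e : R, 0 < e & forall j, e <= p j.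
Proof.
move=> p0; exists (\big[Num.min/1]_j p j); last by move=> j; exact: bigmin_le_cond.
by apply: lt_bigmin => // j _; exact: p0.
Qed.

(** The cells of a grid in finitely many real coordinates are open because the
coordinates are Lipschitz for [d], and small if the coordinates control [d].  The
intervals that define them overlap since they must be open and cover. *)
Lemma cover_cells (R : realType) (E : Type) (X K : set E) (d : E -> E -> R)
    (J : finType) (val : J -> E -> R) (n : J -> nat) (cen : J -> nat -> R)
    (L delta rho : R) :
  0 < L -> K `<=` X ->
  (forall y j, K y -> exists2 i, (i < n j)%N & `|val j y - cen j i| < delta) ->
  (forall y z j, X y -> X z -> `|val j y - val j z| <= L * d y z) ->
  (forall y z, X y -> X z -> (forall j, `|val j y - val j z| < 2 * delta) -> d y z <= rho) ->
  covered_by X d K rho (\prod_j n j).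
Proof.
move=> L0 KX Hc Hl Hd; pose T := {dffun forall j : J, 'I_(n j)}.
have cT : #|T| = (\prod_j n j)%N.
  by rewrite card_dep_ffun foldrE big_map big_enum /=; apply: eq_bigr => j _; rewrite card_ord.
pose W (f : T) : set E := [set y | X y /\ forall j, `|val j y - cen j (f j)| < delta].
exists (fun i => W (enum_val (cast_ord (esym cT) i))); split.
  move=> i; move: (enum_val _) => f; split.
    split=> [y []//|y [Xy hy]].
    have [e e0 he] := @fin_slack R J (fun j => delta - `|val j y - cen j (f j)|)
      (fun j => ltac:(rewrite subr_gt0; exact: hy)).
    exists (e / L); first by rewrite divr_gt0.
    move=> z Xz; rewrite ltr_pdivlMr// => yz; split=> // j.
    have h1 := he j; have h2 := Hl y z j Xy Xz.
    have : `|val j z - cen j (f j)| <= `|val j y - cen j (f j)| + `|val j y - val j z|.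
      rewrite (_ : val j z - _ = (val j y - cen j (f j)) - (val j y - val j z)); last by ring.
      exact: ler_normB.
    rewrite mulrC in yz; lra.
  apply/dist_diamP => y z [Xy hy] [Xz hz]; apply: Hd => // j.
  have := hy j; have := hz j; rewrite !ltr_norml => /andP[? ?] /andP[? ?].
  by apply/andP; split; lra.
move=> y Ky; have hj j : exists i : 'I_(n j), `|val j y - cen j i| < delta.
  by have [i ni hi] := Hc y j Ky; exists (Ordinal ni).
pose f : T := [ffun j => xchoose (hj j)].
exists (cast_ord cT (enum_rank f)) => //.
rewrite cast_ordK enum_rankK; split; first exact: KX.
by move=> j; rewrite /f ffunE; exact: xchooseP (hj j).
Qed.

Lemma cell_exists (R : realType) (B delta v : R) : 0 < delta -> `|v| <= B ->
  exists2 i, (i < (Num.truncn (2 * B / delta)).+1)%N & `|v - (i%:R * delta - B)| < delta.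
Proof.
move=> d0; rewrite ler_norml => /andP[v1 v2].
have p0 : 0 <= (v + B) / delta by rewrite divr_ge0 ?(ltW d0)//; lra.
have /andP[t1 t2] := truncn_itv p0.
exists (Num.truncn ((v + B) / delta)).
  by rewrite ltnS le_truncn// ler_pM2r ?invr_gt0//; lra.
rewrite ler_pdivlMr// in t1; rewrite ltr_pdivrMr// -natr1 mulrDl mul1r in t2.
by rewrite ltr_norml; apply/andP; split; lra.
Qed.

Lemma tail_index (R : realType) (C e : R) : 0 <= C -> 0 < e ->
  exists n0 : nat, C * 2 ^- n0 <= e.
Proof.
move=> C0 e0; have p0 : 0 <= C / e by rewrite divr_ge0// ltW.
exists (Num.bound (C / e)); have := archi_boundP p0; set n := Num.bound _ => hn.
rewrite ler_pdivrMr ?exprn_gt0// mulrC -ler_pdivrMr// (le_trans (ltW hn))//.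
by rewrite -natrX ler_nat ltnW// ltn_expl.
Qed.

(** Only the [s M] samples in [[0, M]] are restricted to a range of size [r] by the
ball; those on either side, needed to control functions near the ends of [[0, M]]
and beyond, range over the unit disc, but their number does not depend on [M] and
they contribute to [k] only. *)
Lemma ball_cover_le (R : realType) (a b s : R) : a < b -> b - a < s ->
  exists2 C : R, 1 <= C & forall r rho : R, 0 < rho -> rho < r ->
  exists2 k : R, 0 <= k & forall (M : nat) x, (0 < M)%N -> bandlimited_ball a b x ->
  exists2 n, (0 < n)%N & covered_by (bandlimited_ball a b)
      (dyn_dist (@bl_dist R) (@unit_shift R) M)
      (dist_cball (bandlimited_ball a b) (dyn_dist (@bl_dist R) (@unit_shift R) M) x r)
      rho n /\ ln n%:R <= M%:R * (2 * s * ln (C * (r / rho))) + k.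
Proof.
move=> ab sab; have [Cs Cs0 hsamp] := sampling ab sab.
have s0 : 0 < s by lra.
pose h := s^-1; have h0 : 0 < h by rewrite invr_gt0.
exists (64 * Cs + 1) => [|r rho rho0 rr]; first by lra.
(* two points of a cell have samples at distance at most [4 delta], which the
   sampling inequality turns into [rho / 4]; truncation costs another [rho / 4] *)
pose delta := rho / (16 * Cs).
have delta0 : 0 < delta by rewrite divr_gt0// mulr_gt0.
have [n0 hn0] := @tail_index R 2 (rho / 2) (ltac:(by [])) (ltac:(by rewrite divr_gt0)).
have [T0 hT] := wgt_small ltr01 (mulr_ge0 (ltW Cs0) (ler0n R 2)) (divr_gt0 rho0 (ltr0n R 4)).
have {}hT := hT T0 (leqnn _); rewrite mulr1 in hT.
pose T : R := T0%:R.
pose Ko := (Num.truncn ((n0%:R + T) * s)).+2.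
have Ko1 : n0%:R + T <= (Ko%:R - 1) * h.
  have p0 : 0 <= (n0%:R + T) * s by rewrite mulr_ge0 ?addr_ge0// ltW.
  have /andP[_ t2] := truncn_itv p0.
  rewrite /h ler_pdivlMr// (le_trans (ltW t2))// /Ko -(natr1 (_.+1)); lra.
pose nin := (Num.truncn (2 * (2 * r) / delta)).+1.
pose nout := (Num.truncn (2 * 2 / delta)).+1.
have r0 : 0 < r by exact: lt_trans rr.
have rrho : 1 < r / rho by rewrite ltr_pdivlMr// mul1r.
have lnin : 1 <= nin%:R :> R by rewrite ler1n.
have nin_le : nin%:R <= (64 * Cs + 1) * (r / rho).
  have p0 : 0 <= 2 * (2 * r) / delta by rewrite divr_ge0 ?(ltW delta0)//; lra.
  have /andP[t1 _] := truncn_itv p0.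
  rewrite /nin -natr1; apply: (@le_trans _ _ (2 * (2 * r) / delta + 1)); first by lra.
  have -> : 2 * (2 * r) / delta = 64 * Cs * (r / rho).
    by rewrite /delta; field; rewrite !gt_eqF.
  by lra.
have lnl : 0 <= ln ((64 * Cs + 1) * (r / rho)).
  by rewrite ln_ge0// (le_trans lnin).
have lnout : 0 <= ln (nout%:R : R) by rewrite ln_ge0// ler1n.
exists (2 * ln ((64 * Cs + 1) * (r / rho)) + 4 * Ko%:R * ln nout%:R).
  by rewrite addr_ge0// !mulr_ge0.
move=> M x M0 Xx; have MR : 0 < M%:R :> R by rewrite ltr0n.
pose K1 := (Num.truncn (M%:R * s)).+1.
have Ms0 : 0 <= M%:R * s by rewrite mulr_ge0// ltW.
have /andP[K1a K1b] := truncn_itv Ms0.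
have K1M : M%:R <= K1%:R * h by rewrite /h ler_pdivlMr// ltW.
(* [K1] samples in [[0, M]] and [Ko] samples on either side *)
pose J := (('I_K1 + ('I_Ko + 'I_Ko)) * bool)%type.
pose smp (j : 'I_K1 + ('I_Ko + 'I_Ko)) : int :=
  match j with inl i => Posz i | inr (inl i) => - (Posz i.+1) | inr (inr i) => Posz (K1 + i) end.
pose val (j : J) (y : R -> R[i]) : R :=
  if j.2 then Re (y ((smp j.1)%:~R * h)) else Im (y ((smp j.1)%:~R * h)).
pose nn (j : J) := if j.1 is inl _ then nin else nout.
pose bnd (j : J) : R := if j.1 is inl _ then 2 * r else 2.
set dM := dyn_dist _ _ _.
exists (\prod_j nn j)%N.
  by rewrite prodn_gt0// => -[[i|i] c].
split; last first.
  have -> : (\prod_j nn j = (nin ^ 2) ^ K1 * (nout ^ 2) ^ (Ko + Ko))%N.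
    rewrite (eq_bigr (fun j : J => (fun (p : 'I_K1 + ('I_Ko + 'I_Ko)) (_ : bool) =>
      if p is inl _ then nin else nout) j.1 j.2)); last by case.
    rewrite -(pair_bigA _ (fun (p : 'I_K1 + ('I_Ko + 'I_Ko)) (_ : bool) =>
      if p is inl _ then nin else nout)) /=.
    rewrite (eq_bigr (fun p : 'I_K1 + ('I_Ko + 'I_Ko) =>
      (if p is inl _ then nin else nout) ^ 2)%N); last first.
      by move=> p _; rewrite prod_nat_const card_bool.
    rewrite big_sumType /= !prod_nat_const card_ord; congr (_ * _ ^ _)%N.
    have := card_sum 'I_Ko 'I_Ko; rewrite !card_ord => <-; exact: eq_card.
  rewrite -!expnM natrM lnM ?posrE ?ltr0n ?expn_gt0// !natrX !lnXn ?ltr0n//.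
  have pw (u : R) (k : nat) : u *+ (2 * k) = 2 * k%:R * u.
    by rewrite -(mulr_natl u (2 * k)) natrM.
  rewrite !pw natrD.
  have l1 : ln (nin%:R : R) <= ln ((64 * Cs + 1) * (r / rho)).
    by rewrite ler_ln ?posrE ?(lt_le_trans _ nin_le)// ltr0n.
  have l2 : K1%:R * ln (nin%:R : R) <= (M%:R * s + 1) * ln ((64 * Cs + 1) * (r / rho)).
    by apply: ler_pM => //; [rewrite ln_ge0|rewrite /K1 -natr1 lerD2r].
  lra.
have [bx hx] := ball_normc_le1 Xx.
apply: (@cover_cells R _ _ _ dM J val nn (fun j i => val j x + (i%:R * delta - bnd j))
  (2 ^+ (K1 + Ko + Num.bound (K1%:R * h + Ko%:R * h)).+1) delta).
- by rewrite exprn_gt0.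
- by move=> y [].
- move=> y j [Xy xy]; have [by_ hy] := ball_normc_le1 Xy.
  have key : `|val j y - val j x| <= bnd j.
    have hn : normc (y ((smp j.1)%:~R * h) - x ((smp j.1)%:~R * h)) <= bnd j.
      case: j => [[i|i] c] /=; rewrite /bnd /=; last first.
        rewrite (le_trans (le_normcD _ _))// normcN -[leRHS]/(1 + 1).
        by apply: lerD; [exact: hy|exact: hx].
      rewrite -normcN opprB.
      have ih0 : 0 <= i%:R * h by rewrite mulr_ge0// ltW.
      have ihM : i%:R * h <= M%:R.
        rewrite /h ler_pdivrMr// (le_trans _ K1a)// ler_nat -ltnS.
        exact: ltn_ord.
      have [m mM hm] := near_index M0 ih0 ihM.
      rewrite -pmulrn; apply: (le_trans (dyn_normc bx.1 by_.1 mM (ltn0Sn 0) hm)).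
      by rewrite expr1 ler_pM2l.
    apply: le_trans hn; rewrite /val; case: (j.2).
      by rewrite -ReN -ReD Re_le_normc.
    by rewrite -ImN -ImD Im_le_normc.
  have [i i1 i2] := cell_exists delta0 key.
  exists i; last by rewrite opprD addrA.
  by move: i1; rewrite /nn /bnd; case: (j.1).
- move=> y z j Xy Xz; have [by_ _] := ball_normc_le1 Xy; have [bz _] := ball_normc_le1 Xz.
  apply: (@le_trans _ _ (normc (y ((smp j.1)%:~R * h) - z ((smp j.1)%:~R * h)))).
    rewrite /val; case: (j.2); first by rewrite -ReN -ReD Re_le_normc.
    by rewrite -ImN -ImD Im_le_normc.
  apply: (dyn_normc by_.1 bz.1 M0) => //; rewrite subr0.
  set B := Num.bound _.
  have B0 : 0 <= K1%:R * h + Ko%:R * h by rewrite addr_ge0// mulr_ge0// ltW.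
  have hB : K1%:R * h + Ko%:R * h < B%:R by exact: archi_boundP.
  have BN : B%:R <= (K1 + Ko + B).+1%:R :> R by rewrite ler_nat leqW// leq_addl.
  have Kh : 0 <= K1%:R * h by rewrite mulr_ge0// ltW.
  have Koh : 0 <= Ko%:R * h by rewrite mulr_ge0// ltW.
  apply: le_trans BN; apply: le_trans (ltW hB).
  case: (j.1) => [i|[i|i]] /=.
  + rewrite -pmulrn ger0_norm ?mulr_ge0// ?(ltW h0)//.
    have : i%:R * h <= K1%:R * h by rewrite ler_pM2r// ler_nat ltnW.
    lra.
  + rewrite mulrNz mulNr normrN -pmulrn ger0_norm ?mulr_ge0// ?(ltW h0)//.
    have : i.+1%:R * h <= Ko%:R * h by rewrite ler_pM2r// ler_nat.
    lra.
  + rewrite -pmulrn ger0_norm ?mulr_ge0// ?(ltW h0)// natrD mulrDl.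
    have : i%:R * h <= Ko%:R * h by rewrite ler_pM2r// ler_nat ltnW.
    lra.
move=> y z Xy Xz hyz; have [by_ hy] := ball_normc_le1 Xy; have [bz hz] := ball_normc_le1 Xz.
have le2 t : normc (y t - z t) <= 2.
  rewrite (le_trans (le_normcD _ _))// normcN -[leRHS]/(1 + 1).
  by apply: lerD; [exact: hy|exact: hz].
have small t : - n0%:R <= t -> t <= M%:R + n0%:R -> normc (y t - z t) <= rho / 2.
  move=> t1 t2.
  apply: le_trans (hsamp _ (bandB by_ bz) t (4 * delta) 2 T _ (ler0n _ _) le2 _) _.
  - by rewrite mulr_ge0// ltW.
  - move=> k hk.
    have [j jk] : exists j, smp j = k.
      have k1 : - (Ko%:R) * h <= k%:~R * h by move: hk; rewrite ler_norml -/h => /andP[? ?]; lra.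
      have k2 : k%:~R * h <= K1%:R * h + (Ko%:R - 1) * h.
        by move: hk; rewrite ler_norml -/h => /andP[? ?]; lra.
      rewrite ler_pM2r// in k1; rewrite -mulrDl ler_pM2r// in k2.
      case: k {hk} k1 k2 => k k1 k2.
        rewrite -pmulrn in k2.
        have k3 : (k < K1 + Ko)%N.
          by rewrite -(ltr_nat R) natrD; have : (0 : R) < 1 by []; lra.
        case: (ltnP k K1) => kK; first by exists (inl (Ordinal kK)).
        have k4 : (k - K1 < Ko)%N by rewrite ltn_subLR.
        by exists (inr (inr (Ordinal k4))) => /=; rewrite subnKC.
      rewrite NegzE mulrNz -pmulrn lerN2 ler_nat in k1.
      by exists (inr (inl (Ordinal k1))); rewrite NegzE.
    apply: (le_trans (normc_le _)).
    have := hyz (j, true); have := hyz (j, false); rewrite /val /= jk -/h.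
    by rewrite ReD ImD ReN ImN; lra.
  - rewrite mulrDr (_ : Cs * (4 * delta) = rho / 4); last first.
      by rewrite /delta; field; rewrite gt_eqF.
    by rewrite mulrA; lra.
apply: dyn_dist_le => [|m mM]; first exact: ltW.
have mM' : m%:R <= M%:R :> R by rewrite ler_nat ltnW.
have m0 : 0 <= m%:R :> R by [].
apply: (le_trans (@bl_dist_le R _ _ 2 (rho / 2) n0 _ _ _ _)) => //.
- by rewrite divr_ge0// ltW.
- by move=> t; rewrite !iter_unit_shift.
- move=> t; rewrite !iter_unit_shift ler_norml => /andP[? ?].
  by apply: small; lra.
- by lra.
Qed.

(** * Subadditive sequences and entropy *)

(** Fekete's lemma: write [n = q m + k] with [m] chosen so that [u m / m] almost
reaches the infimum. *)
Lemma fekete (R : realType) (u : nat -> R) :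
  (forall m, (0 < m)%N -> 0 <= u m) ->
  (forall m n, (0 < m)%N -> (0 < n)%N -> u (m + n)%N <= u m + u n) ->
  exists l : R, forall e, 0 < e -> exists N, forall n, (N <= n)%N ->
    `|n%:R^-1 * u n - l| <= e.
Proof.
move=> u0 uD; pose S := [set n%:R^-1 * u n | n in [set n : nat | (0 < n)%N]].
have Sge x : S x -> 0 <= x.
  by move=> [n n0 <-]; rewrite mulr_ge0 ?invr_ge0// u0.
have hS : has_inf S.
  by split; [exists (1%:R^-1 * u 1%N); exists 1%N|exists 0 => x /Sge].
exists (inf S) => e e0.
have [_ [m m0 <-] hm] := inf_adherent (divr_gt0 e0 (ltr0n R 2)) hS.
have mR : 0 < m%:R :> R by rewrite ltr0n.
have umul (k j : nat) : (0 < j)%N -> u (k.+1 * j)%N <= k.+1%:R * u j.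
  move=> j0; elim: k => [|k IH]; first by rewrite mul1n mul1r.
  rewrite mulSn (le_trans (uD _ _ _ _))// ?muln_gt0//.
  by rewrite -[in leRHS]natr1 mulrDl mul1r addrC lerD2r.
have u1 : 0 <= u 1%N by exact: u0.
have bound n : (m <= n)%N -> u n <= n%:R * (m%:R^-1 * u m) + m%:R * u 1%N.
  move=> mn; rewrite {1}(divn_eq n m).
  have q0 : (0 < (n %/ m)%N)%N by rewrite divn_gt0.
  have qE : (n %/ m)%N.-1.+1 = (n %/ m)%N by rewrite prednK.
  have h1 : u (n %/ m * m)%N <= n%:R * (m%:R^-1 * u m).
    rewrite -qE (le_trans (umul _ _ m0))// qE mulrA ler_wpM2r ?u0//.
    by rewrite ler_pdivlMr// -natrM ler_nat leq_trunc_div.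
  have [r0|r0] := posnP (n %% m)%N.
    by rewrite r0 addn0 (le_trans h1)// lerDl mulr_ge0.
  rewrite (le_trans (uD _ _ _ r0))// ?muln_gt0 ?q0//; apply: lerD => //.
  have := umul (n %% m)%N.-1 1%N isT; rewrite prednK// muln1 => /le_trans; apply.
  by rewrite ler_wpM2r// ler_nat ltnW// ltn_mod.
have p0 : 0 <= m%:R * u 1%N / (e / 2) by rewrite divr_ge0 ?mulr_ge0// ltW// divr_gt0.
exists (maxn m (Num.bound (m%:R * u 1%N / (e / 2)))) => n; rewrite geq_max => /andP[mn bn].
have n0 : (0 < n)%N by exact: leq_trans mn.
have nR : 0 < n%:R :> R by rewrite ltr0n.
have lb : inf S <= n%:R^-1 * u n by apply: ge_inf; [exact: hS.2|exists n].
have ub : n%:R^-1 * u n <= m%:R^-1 * u m + e / 2.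
  rewrite ler_pdivrMl// (le_trans (bound n mn))// mulrDr lerD2l.
  rewrite -ler_pdivrMr ?divr_gt0// (le_trans (ltW (archi_boundP p0)))//.
  by rewrite ler_nat.
by rewrite ler_norml; apply/andP; split; lra.
Qed.

Lemma eps_lim_le (R : realType) (u : nat -> R) (l B c : R) :
  (forall e, 0 < e -> exists N, forall n, (N <= n)%N -> `|n%:R^-1 * u n - l| <= e) ->
  (forall n, (0 < n)%N -> u n <= n%:R * B + c) -> l <= B.
Proof.
move=> hl hu; rewrite leNgt; apply/negP => Bl.
pose e := (l - B) / 3; have e0 : 0 < e by rewrite divr_gt0// subr_gt0.
have [N hN] := hl e e0.
have p0 : 0 <= `|c| / e by rewrite divr_ge0// ltW.
pose n := (maxn N (Num.bound (`|c| / e))).+1.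
have nN : (N <= n)%N by rewrite /n leqW// leq_maxl.
have nR : 0 < n%:R :> R by rewrite ltr0n.
have nc : `|c| / e < n%:R.
  by apply: lt_le_trans (archi_boundP p0) _; rewrite ler_nat /n leqW// leq_maxr.
have e1 : u n = n%:R^-1 * u n * n%:R by rewrite mulrAC mulVf ?mul1r// gt_eqF.
have := hN n nN; have := hu n isT; rewrite {1}e1.
move: (n%:R^-1 * u n) => w h1; rewrite ler_norml => /andP[h2 _].
rewrite ltr_pdivrMr// in nc; have := ler_norm c.
have h3 : n%:R * (w - B) <= c by lra.
have h4 : n%:R * (2 * e) <= n%:R * (w - B) by rewrite ler_pM2l// /e; rewrite /e in h2; lra.
have := mulr_gt0 nR e0; lra.
Qed.

Lemma eps_lim_ge (R : realType) (u : nat -> R) (l A c : R) :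
  (forall e, 0 < e -> exists N, forall n, (N <= n)%N -> `|n%:R^-1 * u n - l| <= e) ->
  (forall n, (0 < n)%N -> n%:R * A - c <= u n) -> A <= l.
Proof.
move=> hl hu; rewrite -lerN2; apply: (@eps_lim_le R (fun n => - u n) _ _ c).
  move=> e e0; have [N hN] := hl e e0; exists N => n /hN.
  by rewrite mulrN -opprD normrN.
by move=> n n0; have := hu n n0; lra.
Qed.

Section covering_numbers.
Variables (R : realType) (E : Type) (X : set E) (d : E -> E -> R).

Lemma covnum_ge (K : set E) (eps c : R) :
  (forall n, (0 < n)%N -> covered_by X d K eps n -> c <= n%:R) ->
  (c%:E <= covnum X d K eps)%E.
Proof.
by move=> h; apply: le_ereal_inf_tmp => _ [n [n0 cn] <-]; rewrite lee_fin h.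
Qed.

Lemma covnum_attained (K : set E) (eps : R) (n : nat) : (0 < n)%N ->
  covered_by X d K eps n ->
  exists m, [/\ (0 < m)%N, (m <= n)%N, covered_by X d K eps m &
    covnum X d K eps = m%:R%:E].
Proof.
move=> n0 cn; pose P k := `[< (0 < k)%N /\ covered_by X d K eps k >].
have exP : exists k, P k by exists n; apply/asboolP.
have [m /asboolP[m0 cm] mmin] := ex_minnP exP.
exists m; split=> //; first by apply: mmin; apply/asboolP.
apply/eqP; rewrite eq_le; apply/andP; split; first by apply: ereal_inf_lbound; exists m.
by apply: covnum_ge => k k0 ck; rewrite ler_nat; apply: mmin; apply/asboolP.
Qed.

Lemma covered_by_sub (K K' : set E) (eps : R) (n : nat) :
  K `<=` K' -> covered_by X d K' eps n -> covered_by X d K eps n.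
Proof. by move=> KK [U [hU cU]]; exists U; split=> //; exact: subset_trans cU. Qed.

Lemma dyn_distD (T : E -> E) (M N : nat) (x y : E) :
  dyn_dist d T (M + N) x y =
  Num.max (dyn_dist d T M x y) (dyn_dist d T N (iter M T x) (iter M T y)).
Proof.
have ge0 K z w : 0 <= dyn_dist d T K z w by exact: bigmax_ge_id.
apply/eqP; rewrite eq_le; apply/andP; split.
  apply: dyn_dist_le => [|m mMN]; first by rewrite le_max ge0.
  rewrite le_max; case: (ltnP m M) => mM; first by rewrite dyn_dist_ge.
  apply/orP; right; have mN : (m - M < N)%N by rewrite ltn_subLR.
  by have := dyn_dist_ge d T (iter M T x) (iter M T y) mN; rewrite -!iterD subnK.
rewrite ge_max; apply/andP; split; apply: dyn_dist_le => // m mM.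
  by apply: dyn_dist_ge; rewrite ltn_addr.
by rewrite -!iterD addnC; apply: dyn_dist_ge; rewrite ltn_add2l.
Qed.

Lemma covered_by_mul (T : E -> E) (K K1 K2 : set E) (rho : R) (M N n m : nat) :
  (forall x, X x -> X (T x)) -> K `<=` X -> 
  K `<=` K1 -> (forall y, K y -> K2 (iter M T y)) ->
  covered_by X (dyn_dist d T M) K1 rho n -> covered_by X (dyn_dist d T N) K2 rho m ->
  covered_by X (dyn_dist d T (M + N)) K rho (n * m).
Proof.
move=> TX KX KK1 KK2 [U [hU cU]] [V [hV cV]].
have TXn k x : X x -> X (iter k T x) by elim: k => //= k IH /IH; exact: TX.
have cT : #|{: 'I_n * 'I_m}| = (n * m)%N by rewrite card_prod !card_ord.
pose W (p : 'I_n * 'I_m) := [set y | X y /\ U p.1 y /\ V p.2 (iter M T y)].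
exists (fun i => W (enum_val (cast_ord (esym cT) i))); split.
  move=> i; move: (enum_val _) => -[p q]; rewrite /W /=.
  have [[Up oU] /dist_diamP dU] := hU p; have [[Vp oV] /dist_diamP dV] := hV q.
  split; last first.
    by apply/dist_diamP => x y [Xx [Ux Vx]] [Xy [Uy Vy]]; rewrite dyn_distD ge_max dU// dV.
  split=> [y []//|y [Xy [Uy Vy]]].
  have [e1 e10 h1] := oU y Uy; have [e2 e20 h2] := oV _ Vy.
  exists (Num.min e1 e2); first by rewrite lt_min e10.
  move=> z Xz; rewrite dyn_distD gt_max !lt_min => /andP[/andP[z1 _] /andP[_ z2]].
  by split=> //; split; [exact: h1|apply: h2 => //; exact: TXn].
move=> y Ky; have [p _ Up] := cU _ (KK1 _ Ky); have [q _ Vq] := cV _ (KK2 _ Ky).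
exists (cast_ord cT (enum_rank (p, q))) => //.
by rewrite cast_ordK enum_rankK; split; [exact: KX|].
Qed.

End covering_numbers.

Lemma lne_nat (R : realType) (n : nat) : (0 < n)%N -> lne (n%:R%:E : \bar R) = (ln n%:R)%:E.
Proof. by move=> n0; rewrite lne_EFin// ltr0n. Qed.

Section system_entropy.
Variables (R : realType) (a b : R).
Hypothesis ab : a < b.
Let X := @bandlimited_ball R a b.
Let dM := dyn_dist (@bl_dist R) (@unit_shift R).

Lemma ball_cst0 : X (fun=> 0).
Proof.
have -> : (fun=> 0) = trig (fun i : 'I_0 => (0 : R)) (fun=> 0).
  by apply/funext => t; rewrite /trig big_ord0.
split; first by apply: trig_bandlimited => -[].
by apply: Linfty_le => // t _; rewrite /trig big_ord0 Normc.normc0.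
Qed.

Lemma ball_iter_shift m x : X x -> X (iter m (@unit_shift R) x).
Proof. by elim: m => //= m IH /IH; exact: ball_shift. Qed.

(** Existence of growth rates, for balls and for the whole space at once: the two
inclusions say that the orbit segment of length [M + N] of a point of [K (M + N) x]
is cut into orbit segments of points of [K M x] and of [K N] at the [M]-th iterate
of [x].  This makes the supremum over [x] of the log covering numbers
subadditive, and bounds that are linear in [M] pass to the rate [l]. *)
Lemma entropy_exists (rho : R) (K : nat -> (R -> R[i]) -> set (R -> R[i])) (B0 k0 : R) :
  (forall M x, K M x `<=` X) ->
  (forall M N x, X x -> K (M + N)%N x `<=` K M x) ->
  (forall M N x y, X x -> K (M + N)%N x y ->
     K N (iter M (@unit_shift R) x) (iter M (@unit_shift R) y)) ->
  (forall M x, (0 < M)%N -> X x ->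
    exists2 n, (0 < n)%N & covered_by X (dM M) (K M x) rho n /\ ln n%:R <= M%:R * B0 + k0) ->
  let v M := ereal_sup [set lne (covnum X (dM M) (K M x) rho) | x in X] in
  exists2 l : R,
    (exists2 u : nat -> R, (forall M, (0 < M)%N -> v M = (u M)%:E) &
      forall e, 0 < e -> exists N, forall n, (N <= n)%N -> `|n%:R^-1 * u n - l| <= e) &
    (forall B k, (forall M x, (0 < M)%N -> X x ->
      exists2 n, (0 < n)%N & covered_by X (dM M) (K M x) rho n /\ ln n%:R <= M%:R * B + k) ->
      l <= B) /\
    (forall A c, (forall M n, (0 < M)%N -> (0 < n)%N ->
      covered_by X (dM M) (K M (fun=> 0)) rho n -> M%:R * A - c <= ln n%:R) -> A <= l).
Proof.
move=> KX K1 K2 hK v.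
have cv M x : (0 < M)%N -> X x -> exists m, [/\ (0 < m)%N,
    covered_by X (dM M) (K M x) rho m &
    lne (covnum X (dM M) (K M x) rho) = (ln m%:R)%:E].
  move=> M0 Xx; have [n n0 [cn _]] := hK M x M0 Xx.
  have [m [m0 mn cm e]] := covnum_attained n0 cn.
  by exists m; split=> //; rewrite e lne_nat.
have vle B k M : (0 < M)%N -> (forall x, X x ->
    exists2 n, (0 < n)%N & covered_by X (dM M) (K M x) rho n /\ ln n%:R <= M%:R * B + k) ->
    (v M <= (M%:R * B + k)%:E)%E.
  move=> M0 h; apply: ge_ereal_sup => _ [x Xx <-].
  have [n n0 [cn ln_n]] := h x Xx; have [m [m0 mn cm ->]] := covnum_attained n0 cn.
  rewrite lne_nat// lee_fin (le_trans _ ln_n)//.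
  by rewrite ler_ln ?posrE ?ltr0n// ler_nat.
have v_ub M x : X x -> (lne (covnum X (dM M) (K M x) rho) <= v M)%E.
  by move=> Xx; apply: ereal_sup_ubound; exists x.
have v0 M : (0 < M)%N -> (0 <= v M)%E.
  move=> M0; apply: le_trans (v_ub M _ ball_cst0); have [m [m0 _ ->]] := cv M _ M0 ball_cst0.
  by rewrite lee_fin ln_ge0// ler1n.
have vfin M : (0 < M)%N -> v M = (fine (v M))%:E.
  move=> M0; rewrite fineK// ge0_fin_numE ?v0//.
  by apply: le_lt_trans (vle B0 k0 M M0 (fun x => hK M x M0)) _; exact: ltry.
pose u M := fine (v M).
have u0 M : (0 < M)%N -> 0 <= u M by move=> M0; rewrite fine_ge0// v0.
have uD M N : (0 < M)%N -> (0 < N)%N -> u (M + N)%N <= u M + u N.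
  move=> M0 N0; rewrite -lee_fin EFinD /u -!vfin// ?addn_gt0 ?M0//.
  apply: ge_ereal_sup => _ [x Xx <-].
  have [m [m0 cm em]] := cv M x M0 Xx.
  have [n [n0 cn en]] := cv N _ N0 (ball_iter_shift M Xx).
  have cmn := @covered_by_mul _ _ X (@bl_dist R) (@unit_shift R) (K (M + N)%N x) _ _
    rho M N m n (@ball_shift R a b) (KX _ _) (K1 M N x Xx) (fun y => K2 M N x y Xx) cm cn.
  have mn0 : (0 < m * n)%N by rewrite muln_gt0 m0.
  have [k [kk0 kmn ck ->]] := covnum_attained mn0 cmn.
  apply: (@le_trans _ _ ((ln m%:R)%:E + (ln n%:R)%:E)%E); last first.
    by rewrite -em -en leeD// v_ub//; exact: ball_iter_shift.
  rewrite lne_nat// -EFinD lee_fin -lnM ?posrE ?ltr0n// -natrM.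
  by rewrite ler_ln ?posrE ?ltr0n// ler_nat.
have [l hl] := fekete u0 uD.
exists l; first by exists u.
split.
  move=> B k hB; apply: (@eps_lim_le R u l B k hl) => M M0.
  by rewrite -lee_fin /u -vfin//; exact: vle (fun x => hB M x M0).
move=> A c hA; apply: (@eps_lim_ge R u l A c hl) => M M0.
rewrite -lee_fin /u -vfin//; apply: le_trans (v_ub M _ ball_cst0).
have [m [m0 cm ->]] := cv M _ M0 ball_cst0.
by rewrite lee_fin; exact: hA cm.
Qed.

End system_entropy.

(** * The dimensions *)

Lemma limn_eps (R : realType) (f : nat -> \bar R) (w : nat -> R) (l : R) :
  (forall M, (0 < M)%N -> f M = (w M)%:E) ->
  (forall e, 0 < e -> exists N, forall n, (N <= n)%N -> `|w n - l| <= e) ->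
  limn f = l%:E.
Proof.
move=> fw hw; apply/cvg_lim => //.
have wl : w @ \oo --> l.
  apply/cvgrPdist_le => e e0; have [N hN] := hw e e0.
  by exists N => // n /= Nn; rewrite distrC; exact: hN.
have fwn : \forall M \near \oo, f M = (w M)%:E by exists 1%N => // M; exact: fw.
apply/fine_cvgP; split; first by apply: filterS fwn => M ->.
apply: cvg_trans wl; apply: near_eq_cvg.
by apply: filterS fwn => M /= ->.
Qed.

Section entropies.
Variables (R : realType) (a b s : R).
Hypotheses (ab : a < b) (sab : b - a < s).
Let X := @bandlimited_ball R a b.
Let d := @bl_dist R.
Let T := @unit_shift R.

Lemma ball_cover_ge_linear (M n : nat) (r rho : R) :
  (0 < M)%N -> 0 < rho -> rho < r / 4 -> r <= 1 ->
  covered_by X (dyn_dist d T M) (dist_cball X (dyn_dist d T M) (fun=> 0) r) rho n ->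
  M%:R * (2 * (b - a) * ln (r / (4 * rho))) - 2 * ln (r / (4 * rho)) <= ln n%:R.
Proof.
move=> M0 rho0 rr r1 cn; apply: le_trans (ball_cover_ge ab M0 rho0 rr r1 cn).
have L0 : 0 <= ln (r / (4 * rho)) by rewrite ln_ge0// ler_pdivlMr ?mulr_gt0//; lra.
have p0 : 0 <= (b - a) * M%:R by rewrite mulr_ge0// subr_ge0 ltW.
have /andP[_ t2] := truncn_itv p0; rewrite -natr1 in t2.
rewrite natrM; have := ler_wpM2r L0 (ltW t2); lra.
Qed.

Lemma local_entropy_bounds :
  exists2 C : R, 1 <= C & forall r rho : R, 0 < rho -> rho < r ->
  exists2 l : R, local_entropy X d T r rho = l%:E &
    l <= 2 * s * ln (C * (r / rho)) /\
    (rho < r / 4 -> r <= 1 -> 2 * (b - a) * ln (r / (4 * rho)) <= l).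
Proof.
have [C C1 hC] := ball_cover_le ab sab.
exists C => // r rho rho0 rr; have [k k0 hk] := hC r rho rho0 rr.
have [] := @entropy_exists R a b rho
  (fun M x => dist_cball X (dyn_dist d T M) x r) (2 * s * ln (C * (r / rho))) k.
- by move=> M x y [].
- move=> M N x Xx y [Xy]; rewrite dyn_distD ge_max => /andP[h _].
  by split.
- move=> M N x y Xx [Xy]; rewrite dyn_distD ge_max => /andP[_ h].
  by split => //; exact: ball_iter_shift.
- exact: hk.
move=> l [u vu hl] [lub llb]; exists l.
  apply: (limn_eps _ hl) => M M0; rewrite EFinM; congr (_ * _)%E.
  exact: vu.
split; first exact: lub hk.
move=> r4 r1; apply: llb => M n M0 n0 cn.
exact: ball_cover_ge_linear cn.
Qed.

Lemma bl_dist_le4 x y : X x -> X y -> d x y <= 4.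
Proof.
move=> /ball_normc_le1[_ hx] /ball_normc_le1[_ hy].
have h t : normc (x t - y t) <= 2.
  rewrite (le_trans (le_normcD _ _))// normcN -[leRHS]/(1 + 1).
  by apply: lerD; [exact: hx|exact: hy].
have := @bl_dist_le R x y 2 2 0%N (ler0n _ 2) (ler0n _ 2) h (fun t _ => h t).
by move=> /le_trans; apply; rewrite expr0 invr1; lra.
Qed.

Lemma mdimM_at_scale_bounds :
  exists2 C : R, 1 <= C & forall eps : R, 0 < eps -> eps < 1 / 4 ->
  exists2 l : R, mdimM_at_scale X d T eps = (l / ln eps^-1)%:E &
    2 * (b - a) * ln (1 / (4 * eps)) <= l /\ l <= 2 * s * ln (C / eps).
Proof.
have [C C1 hC] := ball_cover_le ab sab.
exists (C * 4) => [|eps eps0 e4]; first by lra.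
have [k k0 hk] := hC 4 eps eps0 (ltac:(lra)).
have XB (M : nat) x : X x -> X `<=` dist_cball X (dyn_dist d T M) x 4.
  move=> Xx y Xy; split=> //; apply: dyn_dist_le => // m mM.
  by apply: bl_dist_le4; exact: ball_iter_shift.
have hK (M : nat) x : (0 < M)%N -> X x -> exists2 n, (0 < n)%N &
    covered_by X (dyn_dist d T M) X eps n /\
    ln n%:R <= M%:R * (2 * s * ln (C * 4 / eps)) + k.
  move=> M0 Xx; have [n n0 [cn ln_n]] := hk M x M0 Xx.
  exists n => //; split; last by rewrite -(mulrA C).
  exact: covered_by_sub (XB M x Xx) cn.
have [] := @entropy_exists R a b eps (fun _ _ => X) (2 * s * ln (C * 4 / eps)) k.
- by move=> M x y.
- by move=> M N x Xx y.
- by move=> M N x y Xx Xy; exact: ball_iter_shift.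
- exact: hK.
move=> l [u vu hl] [lub llb]; exists l.
  apply: (@limn_eps _ _ (fun M => M%:R^-1 * u M / ln eps^-1)).
    move=> M M0; rewrite invfM mulrAC [_ * u M]mulrC (EFinM (u M)); congr (_ * _)%E.
    rewrite -(vu M M0); apply/esym/eqP; rewrite eq_le; apply/andP; split.
      by apply: ge_ereal_sup => _ [x _ <-].
    by apply: ereal_sup_ubound; exists (fun=> 0) => //; exact: ball_cst0.
  have L0 : 0 < ln eps^-1 by rewrite ln_gt0// invf_gt1//; lra.
  move=> e e0; have [N hN] := hl (e * ln eps^-1) (mulr_gt0 e0 L0).
  exists N => n Nn; rewrite -mulrBl normrM normfV (gtr0_norm L0) ler_pdivrMr//.
  exact: hN.
split; last exact: lub hK.
apply: (llb _ (2 * ln (1 / (4 * eps)))) => M n M0 n0 cn.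
apply: (@ball_cover_ge_linear M n 1 eps) => //.
by apply: covered_by_sub cn => y [].
Qed.

End entropies.

Lemma limf_esup_eq (R : realType) (f : R -> \bar R) (c : R) :
  (forall eta, 0 < eta -> exists2 e, 0 < e & forall x, 0 < x -> x < e ->
    (f x <= (c + eta)%:E)%E /\ ((c - eta)%:E <= f x)%E) ->
  limf_esup f 0^'+ = c%:E.
Proof.
move=> h; apply/eqP; rewrite eq_le; apply/andP; split.
  apply/lee_addgt0Pr => eta eta0; have [e e0 he] := h eta eta0.
  rewrite /limf_esup; apply: ge_ereal_inf.
  exists (ereal_sup (f @` [set x | 0 < x /\ x < e])).
    exists [set x | 0 < x /\ x < e] => //.
    near=> x => /=; split; [near: x; exact: nbhs_right_gt|near: x; exact: nbhs_right_lt].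
  by apply: ge_ereal_sup => _ [x [x0 xe] <-]; have [] := he x x0 xe.
apply: le_ereal_inf_tmp => _ [V FV <-].
apply/lee_subgt0Pr => eta eta0; have [e e0 he] := h eta eta0.
have FW : \forall x \near 0^'+, V x /\ (0 < x /\ x < e).
  near=> x; split; first by near: x.
  by split; [near: x; exact: nbhs_right_gt|near: x; exact: nbhs_right_lt].
have [x [Vx [x0 xe]]] := filter_ex FW.
have [_ h2] := he x x0 xe; rewrite -EFinB; apply: le_trans h2 _.
by apply: ereal_sup_ubound; exists x.
Unshelve. all: by end_near. Qed.

Lemma limf_einf_eq (R : realType) (f : R -> \bar R) (c : R) :
  (forall eta, 0 < eta -> exists2 e, 0 < e & forall x, 0 < x -> x < e ->
    (f x <= (c + eta)%:E)%E /\ ((c - eta)%:E <= f x)%E) ->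
  limf_einf f 0^'+ = c%:E.
Proof.
move=> h; rewrite /limf_einf (@limf_esup_eq R _ (- c)) ?EFinN ?oppeK// => eta eta0.
have [e e0 he] := h eta eta0; exists e => // x x0 xe; have [h1 h2] := he x x0 xe.
by split; rewrite -leeN2 oppeK -EFinN ?opprD ?opprB ?opprK// addrC.
Qed.

Lemma slope_le (R : realType) (p q k : R) :
  (forall B : R, exists2 x, B <= x & p * x <= q * x + k) -> p <= q.
Proof.
move=> h; rewrite leNgt; apply/negP => qp.
have [x Bx hx] := h ((k + 1) / (p - q)).
rewrite ler_pdivrMr ?subr_gt0// in Bx; lra.
Qed.

Lemma expeR_le_powR (R : realType) (l C x s : R) : 0 < C -> 0 < x ->
  (expeR l%:E <= (C * x `^ s)%:E)%E = (l <= ln C + s * ln x).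
Proof.
move=> C0 x0; rewrite -[expeR _]/((expR l)%:E) lee_fin -(ln_powR x).
have xs := powR_gt0 s x0.
by rewrite -lnM ?posrE// -ler_expR lnK// posrE mulr_gt0.
Qed.

Section dimensions.
Variables (R : realType) (a b : R).
Hypothesis ab : a < b.
Let X := @bandlimited_ball R a b.
Let d := @bl_dist R.
Let T := @unit_shift R.

Lemma mdimM_at_scale_near eta : 0 < eta -> exists2 e : R, 0 < e &
  forall eps, 0 < eps -> eps < e ->
    (mdimM_at_scale X d T eps <= (2 * (b - a) + eta)%:E)%E /\
    ((2 * (b - a) - eta)%:E <= mdimM_at_scale X d T eps)%E.
Proof.
move=> eta0; have sab : b - a < b - a + eta / 4 by rewrite ltrDl divr_gt0.
have [C C1 hC] := mdimM_at_scale_bounds ab sab.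
set s := b - a + _ in hC.
have s0 : 0 < s by rewrite /s addr_gt0 ?divr_gt0// subr_gt0.
have C0 : 0 < C by lra.
have lC : 0 <= ln C by rewrite ln_ge0.
have l4 : 0 <= ln (4 : R) by rewrite ln_ge0//; lra.
pose K := (4 * s * ln C + 2 * (b - a) * ln 4) / eta.
exists (Num.min (1 / 4) (expR (- K))) => [|eps eps0].
  by rewrite lt_min expR_gt0 andbT; lra.
rewrite lt_min => /andP[e4 eK].
have [l -> [l1 l2]] := hC eps eps0 e4.
have lnE : ln eps^-1 = - ln eps by rewrite lnV.
have KL : K < - ln eps by rewrite ltrNr -[ltRHS]expRK ltr_ln ?posrE ?expR_gt0.
have L0 : 0 < - ln eps by rewrite -lnE ln_gt0// invf_gt1//; lra.
have c0 : 0 <= 2 * (b - a) * ln 4 by rewrite !mulr_ge0// subr_ge0 ltW.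
have sC : 0 <= s * ln C by rewrite mulr_ge0// ltW.
rewrite ltr_pdivrMr// in KL.
rewrite div1r lnV ?posrE ?mulr_gt0// lnM ?posrE// in l1.
rewrite lnM ?posrE ?invr_gt0// lnV ?posrE// in l2.
rewrite lnE !lee_fin ler_pdivrMr// ler_pdivlMr//.
have sE : s = b - a + eta / 4 by [].
split; last by lra.
apply: le_trans l2 _; rewrite mulrDr {2}sE; lra.
Qed.

Lemma mdimM_eq : is_mdimM X d T (2 * (b - a))%:E.
Proof.
split; first exact: limf_esup_eq mdimM_at_scale_near.
exact: limf_einf_eq mdimM_at_scale_near.
Qed.

Lemma mdimA_le : (mdimA X d T <= (2 * (b - a))%:E)%E.
Proof.
apply/lee_addgt0Pr => eta eta0; rewrite -EFinD.
have ba : 0 < b - a by rewrite subr_gt0.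
have sab : b - a < (2 * (b - a) + eta) / 2 by lra.
have [C C1 hC] := local_entropy_bounds ab sab.
have C0 : 0 < C by lra.
apply: ereal_inf_lbound; exists (2 * (b - a) + eta) => //; split; first by lra.
exists (C `^ (2 * (b - a) + eta)); first exact: powR_gt0.
move=> r rho rho0 rr; have [l -> [lle _]] := hC r rho rho0 rr.
have x0 : 0 < r / rho by rewrite divr_gt0// (lt_trans rho0).
rewrite expeR_le_powR ?powR_gt0// ln_powR -mulrDr -lnM ?posrE//.
by apply: le_trans lle _; rewrite mulrCA divff ?mulr1// pnatr_eq0.
Qed.

Lemma mdimA_spectrum_le (theta : R) : 0 < theta -> theta < 1 ->
  (mdimA_spectrum X d T theta <= mdimA X d T)%E.
Proof.
move=> t0 t1; apply: ereal_inf_le_tmp => _ [s [s0 [C C0 h]] <-].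
exists s => //; split=> //; exists C => // r r0 r1; apply: h; first exact: powR_gt0.
rewrite /powR gt_eqF// -[ltRHS]lnK ?posrE// ltr_expR.
have := ln_lt0 (introT andP (conj r0 r1)).
have : 1 < theta^-1 by rewrite invf_gt1.
move=> h1 h2; rewrite -subr_gt0 -[X in X - _]mul1r -mulrBl nmulr_lgt0//; lra.
Qed.

(** Only radii [r] tending to [0] matter: there [r / r ^ (1 / theta)] is
unbounded, so the exponent of a power bound is at least the entropy slope. *)
Lemma mdimA_spectrum_ge (theta : R) : 0 < theta -> theta < 1 ->
  ((2 * (b - a))%:E <= mdimA_spectrum X d T theta)%E.
Proof.
move=> t0 t1; apply: le_ereal_inf_tmp => _ [s [s0 [C C0 h]] <-].
rewrite lee_fin; apply: (@slope_le R _ _ (ln C + 2 * (b - a) * ln 4)) => B.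
have sab : b - a < b - a + 1 by rewrite ltrDl.
have [C' _ hC'] := local_entropy_bounds ab sab.
pose g := theta^-1 - 1; have g0 : 0 < g by rewrite subr_gt0 invf_gt1.
have l4 : 0 <= ln (4 : R) by rewrite ln_ge0//; lra.
have B0 := normr_ge0 B; have BB := ler_norm B.
pose x := `|B| + ln 4 + 1; have x0 : 0 < x by rewrite /x; lra.
exists x; first by rewrite /x; lra.
pose r := expR (- (x / g)).
have rhoE : r `^ theta^-1 = expR (- (x / g) - x).
  rewrite /r -expRM; congr expR; rewrite (_ : theta^-1 = g + 1); last by rewrite /g subrK.
  by field; rewrite gt_eqF.
have r1 : r < 1 by rewrite -expR0 ltr_expR oppr_lt0 divr_gt0.
have qE : r / r `^ theta^-1 = expR x.
  by rewrite rhoE /r -expRN -expRD; congr expR; ring.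
have rho0 : 0 < r `^ theta^-1 by rewrite rhoE expR_gt0.
have e4 : 4 < expR x.
  by rewrite -[ltLHS]lnK ?posrE// ltr_expR /x; lra.
have rr4 : r `^ theta^-1 < r / 4.
  by rewrite ltr_pdivlMr// -ltr_pdivlMl// mulrC qE.
have rr : r `^ theta^-1 < r by apply: lt_trans rr4 _; have := expR_gt0 (- (x / g)); rewrite -/r; lra.
have [l lE [_ lge]] := hC' r _ rho0 rr.
have := h r (expR_gt0 _) r1; rewrite lE expeR_le_powR ?qE ?expR_gt0// expRK.
have := lge rr4 (ltW r1).
have -> : r / (4 * r `^ theta^-1) = expR x / 4 by rewrite invfM mulrCA qE mulrC.
rewrite lnM ?posrE ?expR_gt0 ?invr_gt0// lnV ?posrE// expRK; lra.
Qed.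

End dimensions.

Theorem proposition4p5 (R : realType) (a b theta : R)
    (hab : a < b) (htheta0 : 0 < theta) (htheta1 : theta < 1) :
  [/\ is_mdimM (bandlimited_ball a b) (@bl_dist R) (@unit_shift R)
        (2 * (b - a))%:E,
      mdimA_spectrum (bandlimited_ball a b) (@bl_dist R) (@unit_shift R) theta
        = (2 * (b - a))%:E &
      mdimA (bandlimited_ball a b) (@bl_dist R) (@unit_shift R)
        = (2 * (b - a))%:E].
Proof.
have ge := mdimA_spectrum_ge hab htheta0 htheta1.
have mid := @mdimA_spectrum_le R a b theta htheta0 htheta1.
have le := mdimA_le hab.
split; first exact: mdimM_eq.
  by apply/eqP; rewrite eq_le ge (le_trans mid le).
by apply/eqP; rewrite eq_le le (le_trans ge mid).
Qed.
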